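(* Let $X$ be a standard Borel space and let $G\subset X^2$ be a countable Borel median graph such that $E_G^X$ is smooth. Suppose that there exists $D\in\mathbb{N}\cup\{0\}$ such that every $G$-component is a CAT(0) cube complex of dimension at most $D$. Then $\mathrm{asdim}_{\mathbf{B}}(X,G)\le D$.
   Context: A graph on a set $X$ is an irreflexive symmetric subset $G\subset X^2$; its connected components are called $G$-components, $E_G^X$ is the equivalence relation on $X$ whose classes are the $G$-components, and $G$ is countable if all classes are countable. A median graph is a connected graph such that for any vertices $x_1,x_2,x_3$ there is a unique vertex $y$ with $d(x_i,x_j)=d(x_i,y)+d(y,x_j)$ for all distinct $i,j\in\{1,2,3\}$ ($d$ the graph metric). Each median graph is the 1-skeleton of a CAT(0) cube complex, obtained by attaching, inductively over $k\ge 2$, a $k$-cube along each subcomplex isomorphic to the boundary of a $k$-cube (starting with a square for each induced 4-cycle); one identifies a median graph with this complex, and its dimension is the supremum of $k$ such that it contains a $k$-cube. A Borel median graph on a standard Borel space $X$ is a graph $G$ on $X$ that is a Borel subset of $X^2$ and all of whose components are median graphs. A Borel equivalence relation $E$ on $X$ is smooth if there are a standard Borel space $Z$ and a Borel map $f\colon X\to Z$ with $x\,E\,y\iff f(x)=f(y)$. Borel asymptotic dimension: let $(Y,\rho)$ be a standard Borel space with a Borel extended metric $\rho\colon Y^2\to[0,\infty]$ such that the equivalence relation $\rho(x,y)<\infty$ has countable classes. For $U\subset Y$ and $r>0$, $\mathfrak{F}_r(U)$ is the equivalence relation on $U$ in which $x,y$ are equivalent iff there are $x=x_0,\dots,x_k=y$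 in $U$ with $\rho(x_{i-1},x_i)\le r$ for all $i$. $\mathrm{asdim}_{\mathbf{B}}(Y,\rho)$ is the least $d\in\mathbb{N}\cup\{0\}$ such that for every $r>0$ there are Borel sets $U_0,\dots,U_d\subset Y$ with $Y=\bigcup_{i=0}^d U_i$ and some $M>0$ such that $\rho(x,y)\le M$ for all $i$ and all $(x,y)\in\mathfrak{F}_r(U_i)$ (and $\infty$ if there is no such $d$). For a countable Borel graph $G$ on $X$, $\mathrm{asdim}_{\mathbf{B}}(X,G)$ is $\mathrm{asdim}_{\mathbf{B}}(X,d_G)$, where $d_G$ is the graph metric ($\infty$ between different components). *)

(* Defs.v *)
From HB Require Import structures.
From mathcomp Require Import all_boot all_order all_algebra.
From mathcomp Require Import all_classical all_reals all_analysis.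
Set Implicit Arguments.
Unset Strict Implicit.
Unset Printing Implicit Defensive.
Import Order.TTheory GRing.Theory Num.Theory.
Local Open Scope classical_set_scope.
Local Open Scope ring_scope.

(* X is Borel isomorphic, via f, to a separable complete metric space P with
   its Borel sets; a pseudometric is a metric when its topology is Hausdorff. *)
Definition standard_borel (R : realType) (d : measure_display)
    (X : measurableType d) : Prop :=
  exists (P : completePseudoMetricType R) (f : X -> P),
    [/\ hausdorff_space P,
        exists2 Q : set P, countable Q & dense Q,
        bijective f
      & forall B : set P, <<s @open P >> B <-> measurable (f @^-1` B)].

Section Graphs.
Variable T : choiceType.
Implicit Types (V : set T) (G : set (T * T)).

Definition is_graph G : Prop :=
  (forall x, ~ G (x, x)) /\ (forall x y, G (x, y) -> G (y, x)).

(* The walk x, p_0, ..., p_{n-1} = y has length n = size p. *)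
Definition walk G (x y : T) (p : seq T) : Prop :=
  path (fun a b => (a, b) \in G) x p /\ last x p = y.

Definition graph_eqrel G : set (T * T) :=
  [set xy | exists p, walk G xy.1 xy.2 p].

Definition graph_component G (x : T) : set T :=
  [set y | graph_eqrel G (x, y)].

Definition countable_graph G : Prop :=
  forall x, countable (graph_component G x).

Definition induced_subgraph G V : set (T * T) := G `&` (V `*` V).

(* The infimum of the empty set is +oo. *)
Definition graph_dist (R : realType) G (x y : T) : \bar R :=
  ereal_inf [set ((size p)%:R)%:E | p in walk G x y].

Definition median_graph (R : realType) V G : Prop :=
  let dist := graph_dist R G in
  [/\ G `<=` V `*` V, is_graph G,
      forall x y, V x -> V y -> graph_eqrel G (x, y)
    & forall x1 x2 x3, V x1 -> V x2 -> V x3 ->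
        exists! y, [/\ V y,
          dist x1 x2 = (dist x1 y + dist y x2)%E,
          dist x1 x3 = (dist x1 y + dist y x3)%E
        & dist x2 x3 = (dist x2 y + dist y x3)%E]].

(* Insertion of b as i-th coordinate: the parametrization of a facet of
   {0,1}^(k+1) by {0,1}^k. *)
Definition facet (k : nat) (i : 'I_k.+1) (b : bool)
    (v : {ffun 'I_k -> bool}) : {ffun 'I_k.+1 -> bool} :=
  [ffun j => if unlift i j is Some j' then v j' else b].

(* A cell of the cube complex of (V, G) is given by a labelling of its vertices
   by {0,1}^k.  The cells of dimension 0 and 1 are the vertices and edges, those
   of dimension 2 are the induced 4-cycles, and for k >= 3 there is one for each
   subcomplex isomorphic to the boundary of a k-cube: an injective labelling
   whose restriction to each of the 2k facets is already a cell. *)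
Inductive cube V G : forall k : nat, ({ffun 'I_k -> bool} -> T) -> Prop :=
| Cube0 (f : {ffun 'I_0 -> bool} -> T) :
    (forall v, V (f v)) -> cube V G f
| Cube1 (f : {ffun 'I_1 -> bool} -> T) :
    G (f [ffun=> false], f [ffun=> true]) -> cube V G f
| Cube2 (f : {ffun 'I_2 -> bool} -> T) :
    injective f ->
    (forall v w, G (f v, f w) <-> #|[pred i | v i != w i]| = 1%N) ->
    cube V G f
| CubeS (k : nat) (f : {ffun 'I_k.+3 -> bool} -> T) :
    injective f -> (forall i b, cube V G (f \o @facet k.+2 i b)) ->
    cube V G f.

Definition cube_dim (R : realType) V G : \bar R :=
  ereal_sup [set (k%:R)%:E | k in
    [set k : nat | exists f : {ffun 'I_k -> bool} -> T, cube V G f]].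

End Graphs.

Definition borel_median_graph (R : realType) (d : measure_display)
    (X : measurableType d) (G : set (X * X)) : Prop :=
  [/\ is_graph G, measurable G
    & forall x, median_graph R (graph_component G x)
                  (induced_subgraph G (graph_component G x))].

Definition smooth_eqrel (R : realType) (d : measure_display)
    (X : measurableType d) (E : set (X * X)) : Prop :=
  exists (d' : measure_display) (Z : measurableType d') (f : X -> Z),
    [/\ standard_borel R Z, measurable_fun [set: X] f
      & forall x y, E (x, y) <-> f x = f y].

Section BorelAsymptoticDimension.
Variables (R : realType) (d : measure_display) (Y : measurableType d).
Variable rho : Y -> Y -> \bar R.

(* The relation F_r(U). *)
Definition chain_rel (r : R) (U : set Y) (x y : Y) : Prop :=
  exists s : seq Y,
    [/\ forall z, z \in x :: s -> U z,
        path (fun a b => (rho a b <= r%:E)%E) x s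
      & last x s = y].

Definition asdimB_bound (n : nat) : Prop :=
  forall r : R, 0 < r ->
  exists U : 'I_n.+1 -> set Y,
    [/\ forall i, measurable (U i),
        \bigcup_i U i = [set: Y]
      & exists2 M : R, 0 < M &
          forall i x y, chain_rel r (U i) x y -> (rho x y <= M%:E)%E].

(* The least n with asdimB_bound n, and +oo if there is none. *)
Definition asdimB : \bar R := ereal_inf [set (n%:R)%:E | n in asdimB_bound].

End BorelAsymptoticDimension.

Definition graph_asdimB (R : realType) (d : measure_display)
    (X : measurableType d) (G : set (X * X)) : \bar R :=
  asdimB (graph_dist R G).

(* Main.v *)
(** By the Lusin-Novikov theorem, a smooth equivalence relation with countable
    classes is covered by countably many Borel partial transversals, so that every
    class is, measurably, indexed by a set of integers.  If the classes have
    colourings whose monochromatic [r]-chains are bounded by a common [M], then the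
    leftmost branch of the tree of finite approximations is a Borel choice of one.

    It thus remains to colour each median graph of dimension at most [D] with
    [D + 1] colours, with a bound depending only on [D] and [r].  For a base vertex
    [o], order the vertices by [x <= y] iff [d(o, y) = d(o, x) + d(x, y)], and send
    [x] to the set of join-irreducible vertices below it.  This is an isometry onto
    a family of finite down-sets with the symmetric difference metric, and its
    antichains have at most [D] elements since an antichain of size [k] yields a
    [k]-cube.

    Such a family is coloured by induction on [D].  By a Hurewicz-type theorem for
    the height function, it suffices to colour, with [D] colours, the sets [x] whose
    height lies in a fixed short interval.  Consider, far below, the elements of [x]
    of a given height with many elements of [x] above them.  For an antichain [S] of
    these, [x] is determined up to bounded distance by the part of [x] concurrent
    with [S], which lives in a family of width [D - #|S|], coloured by induction.
    The cells of these colourings label the [x], and the thresholds that select [S]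
    are arranged so that every ball of a given radius meets at most [D] labels. *)
Require Import Defs.
From HB Require Import structures.
From mathcomp Require Import finmap.
From mathcomp Require Import all_boot all_order all_algebra.
From mathcomp Require Import all_classical all_reals all_analysis.
From mathcomp Require Import zify lra.
Set Implicit Arguments.
Unset Strict Implicit.
Unset Printing Implicit Defensive.

(** * Bounded colourings *)

Section Colorings.
Local Open Scope fset_scope.
Local Open Scope nat_scope.

(** Why a ball meets at most [D] labels: an antichain with [k] elements leaves [D - k + 1] colours,
    so labels would be few if one antichain were selected on the whole ball; but a mark whose depth
    is close to a threshold makes the selection vary. There are at most [D] marks, one of them
    deeper than all thresholds, while [D] disjoint ranges of thresholds are used in turn. Some range
    is thus free of marks, and there at most [D - k + 1] labels occur, with [k] the number of deeper
    marks. In the later ranges each mark creates at most one more label, and fewer than [k] of the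
    deeper marks lie there, so that the total is at most [D]. The layers thus need one colour less
    than the whole family, which is what the Hurewicz step requires. On the Borel side, quantifiers
    over vertices would only yield analytic sets. Indexing the classes by integers makes these
    quantifiers countable; and the tree of approximations depends on the class alone, so that all
    vertices of a class follow the same branch. *)

Lemma quot_inj K i k p m1 m2 q1 q2 t : i <= k ->
  q1 * K + t + k - i = p * K + m1 -> q2 * K + t + k - i = p * K + m2 ->
  m1 < K -> m2 < K -> q1 = q2.
Proof.
have aux a a' : a < a' -> a * K + K <= a' * K.
  by rewrite -mulSnr leq_mul2r orbC => ->.
move=> ik f1 f2 l1 l2; have := aux q1 q2; have := aux q2 q1.
move: f1 f2; move: (q1 * K) (q2 * K) (p * K) => X Y Z f1 f2 a1 a2.
have [/a2|/a1|//] := ltngtP q1 q2; lia.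
Qed.

Section Chains.
Variable T : Type.

(** The trivial chain exists at every point, even outside the set under study; hence the case
    [x = y] in [conn_ends]. *)
Inductive conn (R : T -> T -> Prop) (x : T) : T -> Prop :=
| conn0 : conn R x x
| connS y z : conn R x y -> R y z -> conn R x z.

Lemma conn_sub (R R' : T -> T -> Prop) x y :
  (forall u v, R u v -> R' u v) -> conn R x y -> conn R' x y.
Proof. by move=> RR'; elim=> [|u v _ ? /RR' ?]; [left|right with u]. Qed.

Lemma conn_trans (R : T -> T -> Prop) x y z :
  conn R x y -> conn R y z -> conn R x z.
Proof. by move=> xy; elim=> // u v _ xu uv; right with u. Qed.

Lemma conn_sym (R : T -> T -> Prop) x y :
  (forall u v, R u v -> R v u) -> conn R x y -> conn R y x.
Proof.
move=> Rs; elim=> [|u v _ ux uv]; first by left.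
by apply: conn_trans ux; right with v; [left|exact: Rs].
Qed.

Lemma conn_img (R R' : T -> T -> Prop) (P : T -> Prop) x y :
  P x -> (forall u v, P u -> R u v -> P v /\ R' u v) ->
  conn R x y -> conn R' x y /\ P y.
Proof.
move=> Px PR; elim=> [|u v _ [xu Pu] /(PR _ _ Pu)[Pv uv]]; first by split; [left|].
by split=> //; right with u.
Qed.

Variable dist : T -> T -> nat.

Definition step (A : T -> Prop) r x y := [/\ A x, A y & dist x y <= r].

Definition bdd (A : T -> Prop) r M :=
  forall x y, conn (step A r) x y -> dist x y <= M.

Definition col (A : T -> Prop) k r M := exists c : T -> nat,
  (forall x, A x -> c x < k) /\ forall i, bdd (fun x => A x /\ c x = i) r M.

Definition pseudometric := [/\ forall x, dist x x = 0,
  forall x y, dist x y = dist y x &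
  forall x y z, dist x z <= dist x y + dist y z].

Lemma conn_ends A r x y : conn (step A r) x y -> x = y \/ (A x /\ A y).
Proof.
elim=> [|u v _ [->|[Ax _]] [Au Av _]]; first by left.
  by right.
by right.
Qed.

Lemma bdd_sub (A B : T -> Prop) r s M N : (forall x, A x -> B x) ->
  r <= s -> M <= N -> bdd B s M -> bdd A r N.
Proof.
move=> AB rs MN Bb x y xy; apply: leq_trans MN; apply: Bb.
apply: conn_sub xy => u v [/AB Bu /AB Bv uv].
by split=> //; apply: leq_trans uv rs.
Qed.

Hypothesis dP : pseudometric.

Let d0 x : dist x x = 0. Proof. by case: dP. Qed.
Let dC x y : dist x y = dist y x. Proof. by case: dP. Qed.
Let dT x y z : dist x z <= dist x y + dist y z. Proof. by case: dP. Qed.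

Lemma step_sym A r u v : step A r u v -> step A r v u.
Proof. by case=> *; split=> //; rewrite dC. Qed.

(** A stretch of the chain in [U] has diameter at most [M1], so consecutive visits to [V] are at
    distance at most [M1 + 2 * r] and form a chain at this scale. Each end costs a further
    [M1 + r]. *)
Lemma bdd_union (U V : T -> Prop) r M1 M2 : bdd U r M1 ->
  bdd V (M1 + 2 * r) M2 ->
  bdd (fun x => U x \/ V x) r (M2 + 2 * M1 + 2 * r).
Proof.
move=> bU bV x y xy.
suff: (conn (step U r) x y /\ (U y \/ x = y)) \/
   exists v1 v, [/\ dist x v1 <= M1 + r, V v1, V v &
     conn (step V (M1 + 2 * r)) v1 v /\
     (y = v \/ exists u, [/\ U u, U y, dist v u <= r & conn (step U r) u y])].
  case=> [[/bU]|[v1 [v [xv1 _ _ [/bV v1v H]]]]]; first lia.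
  have : dist v y <= r + M1.
    case: H => [->|[u [_ _ vu /bU uy]]]; first by rewrite d0.
    by have := dT v u y; lia.
  by have := dT x v1 y; have := dT v1 v y; lia.
elim: xy => [|u v xu IH [uUV vUV uv]]; first by left; split; [left|right].
have [Vv|nVv] := pselect (V v).
  right; case: IH => [[xu' _]|[v1 [v' [xv1 V1 V' [v1v' H]]]]].
    exists v, v; split=> //; last by split; [left|left].
    by have := bU _ _ xu'; have := dT x u v; lia.
  exists v1, v; split=> //; split; last by left.
  right with v' => //; split=> //.
  case: H => [<-|[w [_ _ vw /bU wu]]]; first by lia.
  by have := dT v' w v; have := dT w u v; lia.
have Uv : U v by case: vUV.
case: IH => [[xu' Uu]|[v1 [v' [xv1 V1 V' [v1v' H]]]]].
  have [Vu|nVu] := pselect (V u).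
    right; exists u, u; split=> //; first by have := bU _ _ xu'; lia.
    split; first by left.
    by right; exists v; split=> //; left.
  left; split; last by left.
  by right with u => //; split=> //; case: uUV.
right; exists v1.
have [Vu|nVu] := pselect (V u).
  exists u; split=> //; split; last by right; exists v; split=> //; left.
  case: H => [->//|[w [_ _ vw /bU wu]]]; right with v' => //; split=> //.
  by have := dT v' w u; lia.
have Uu : U u by case: uUV.
exists v'; split=> //; split=> //; right.
case: H => [uv'|[w [Uw _ vw wu]]]; first by rewrite uv' in nVu.
exists w; split=> //; right with u => //; split.
Qed.

Fixpoint union_bound (Mf : nat -> nat) r t :=
  if t is t'.+1 then
    Mf (union_bound Mf r t' + 2 * r) + 2 * union_bound Mf r t' + 2 * r
  else 0.

Lemma bdd_unions (U : nat -> T -> Prop) (Mf : nat -> nat) r n :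
  (forall t, t < n -> bdd (U t) (union_bound Mf r t + 2 * r)
                        (Mf (union_bound Mf r t + 2 * r))) ->
  bdd (fun x => exists2 t, t < n & U t x) r (union_bound Mf r n).
Proof.
elim: n => [|n IH] H.
  by move=> x y [|u v _ [_ [t]]]; rewrite ?d0.
have H1 := IH (fun t tn => H t (ltnW tn)).
apply: bdd_sub (bdd_union H1 (H n (leqnn _))) => // x [t].
rewrite ltnS leq_eqVlt => /orP[/eqP->|tn] Utx; [by right|by left; exists t].
Qed.

(* Kolmogorov's trick: one more set makes every point covered twice. *)
Lemma col_twice (A : T -> Prop) k r M : col A k (3 * r) M ->
  exists W : nat -> T -> Prop,
    [/\ forall i x, W i x -> A x,
        forall x, A x -> exists i j, [/\ i < j, j < k.+1, W i x & W j x]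
      & forall i, bdd (W i) r (M + 2 * r)].
Proof.
case=> c [ck cb].
pose N i x := exists u, [/\ A u, c u = i & dist x u <= r].
(* For [i < k], [W i] is the [r]-neighbourhood of colour [i], whose [r]-chains are shadowed by
   [3 * r]-chains of that colour. [W k] consists of the points with a monochromatic [r]-ball, where
   chains keep their colour; any other point lies in a second neighbourhood. *)
pose W i x := A x /\ (i < k /\ N i x \/
  i = k /\ forall j, N j x -> j = c x).
exists W; split=> [i x []//|x Ax|i].
  have Nx : N (c x) x by exists x; split=> //; rewrite d0.
  have [[j [jc Nj]]|H] := pselect (exists j, j <> c x /\ N j x).
    have jk : j < k by case: Nj => u [/ck uk <-].
    have Wj : W j x by split=> //; left.
    have Wc : W (c x) x by split=> //; left; split=> //; apply: ck.
    have [jlt|jgt|//] := ltngtP j (c x).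
      by exists j, (c x); split=> //; rewrite ltnS ltnW // ck.
    by exists (c x), j; split=> //; rewrite ltnS ltnW.
  exists (c x), k; split=> //; first exact: ck.
    by split=> //; left; split=> //; apply: ck.
  split=> //; right; split=> // j Nj.
  by apply: contrapT => jc; apply: H; exists j.
move=> x y xy; have [ik|ik] := eqVneq i k.
  rewrite {}ik in xy.
  suff [/cb] : conn (step (fun z => A z /\ c z = c x) (3 * r)) x y /\ c y = c x.
    by move=> /leq_trans ->//; rewrite leq_addr.
  elim: xy => [|u v _ [xu cu] [[Au Wu] [Av Wv] uv]]; first by split; [left|].
  have cv : c v = c x.
    rewrite -cu; case: Wu => [[]|[_ ku]]; first by rewrite ltnn.
    by apply: ku; exists v.
  by split=> //; right with u => //; split=> //; lia.
have WN z : W i z -> N i z by move=> [_ [[]|[/eqP]]] //; rewrite (negbTE ik).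
suff [->|[u [v [xu yv /cb uv _]]]] : y = x \/ exists u v,
    [/\ dist x u <= r, dist y v <= r,
     conn (step (fun z => A z /\ c z = i) (3 * r)) u v & A v /\ c v = i].
- by rewrite d0.
- by have := dT x u y; have := dT u v y; rewrite (dC v); lia.
elim: xy => [|u v _ IH [Wu Wv uv]]; first by left.
right; have [v' [Av' cv' vv']] := WN _ Wv.
have [u' [Au' cu' uu']] := WN _ Wu.
case: IH => [ux|[a [b [xa ub ab [Ab cb']]]]].
  exists u', v'; split=> //; first by rewrite -ux.
  right with u'; [by left|split=> //].
  by have := dT u' u v'; have := dT u v v'; rewrite (dC u' u); lia.
exists a, v'; split=> //; right with b => //; split=> //.
by have := dT b u v'; have := dT u v v'; rewrite (dC b u); lia.
Qed.

(* Hurewicz's theorem for a map to the integers: a block b omits the colour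
   b mod (k + 1), so a monochromatic chain stays within k consecutive blocks;
   these have distinct residues, to which increasing scales are attached. *)
Lemma col_layers (A : T -> Prop) (n : T -> nat) k r (Mf : nat -> nat) :
  (forall x y, A x -> A y -> n x <= n y + dist x y) ->
  (forall a s, col (fun x => A x /\ a <= n x < a + r.+1) k s (Mf s)) ->
  col A k.+1 r (union_bound (fun s => Mf (3 * s) + 2 * s) r k.+1).
Proof.
move=> nL Acol.
set Mf' := fun s => _; pose sc t := union_bound Mf' r t + 2 * r.
pose b x := n x %/ r.+1.
pose good bl (W : nat -> T -> Prop) :=
  [/\ forall i x, W i x -> A x /\ b x = bl,
        forall x, A x -> b x = bl ->
          exists i j, [/\ i < j, j < k.+1, W i x & W j x]
      & forall i, bdd (W i) (sc (bl %% k.+1)) (Mf' (sc (bl %% k.+1)))].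
have /choice[W WP] bl : exists W, good bl W.
  have [W [WA W2 Wb]] := col_twice (Acol (bl * r.+1) (3 * sc (bl %% k.+1))).
  have bE x : (bl * r.+1 <= n x < bl * r.+1 + r.+1) = (b x == bl).
    rewrite /b; apply/idP/eqP => [/andP[h1 h2]|<-]; nia.
  exists W; split=> //; first by move=> i x /WA []; rewrite bE => Ax /eqP.
  by move=> x Ax /eqP bx; apply: W2; rewrite bE.
(* Of the two indices that cover [x], at least one differs from the residue of its block. *)
have /choice[c cP] x : exists i, A x ->
    [/\ i < k.+1, W (b x) i x & i <> b x %% k.+1].
  have [Ax|nAx] := pselect (A x); last by exists 0.
  have [_ W2 _] := WP (b x); have [i [j [ij jk Wi Wj]]] := W2 x Ax erefl.
  have [ib|/eqP ib] := eqVneq i (b x %% k.+1).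
    by exists j; split=> //; rewrite -ib; lia.
  by exists i; split=> //; apply: ltn_trans jk.
exists c; split=> [x /cP[]//|i x y xy].
have [ik|ik] := leqP k.+1 i.
  case: xy => [|u v _ [_ [/cP[]]]]; first by rewrite d0.
  by move=> ? _ _ cv _; lia.
(* [w] jumps exactly between a block congruent to [i] and the next one; a chain of colour [i] enters
   no such block, so [w] is constant along it. *)
pose w bl := (bl + k - i) %/ k.+1.
have wE u v : A u -> c u = i -> A v -> c v = i -> dist u v <= r ->
    w (b u) = w (b v).
  have aux u' v' : A u' -> c u' = i -> A v' -> c v' = i -> dist u' v' <= r ->
      w (b u') <= w (b v').
    move=> /[dup] Au /cP[_ _ +] cu /[dup] Av /cP[_ _ +] cv uv.
    rewrite cu cv => iu iv.
    have buv : b u' <= b v' + 1.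
      have -> : b v' + 1 = (n v' + r.+1) %/ r.+1 by rewrite divnDr ?divnn.
      by apply: leq_div2r; have := nL _ _ Au Av; lia.
    have [le|gt] := leqP (b u') (b v'); first by apply: leq_div2r; lia.
    have {buv gt} buv : b u' = (b v').+1 by lia.
    rewrite /w buv leqNgt; apply/negP => lt; apply: iv.
    have e1 := divn_eq (b v' + k - i) k.+1.
    have e2 := divn_eq ((b v').+1 + k - i) k.+1.
    have l1 := ltn_pmod (b v' + k - i) (ltn0Sn k).
    have l2 := ltn_pmod ((b v').+1 + k - i) (ltn0Sn k).
    have : b v' = (b v' + k - i) %/ k.+1 * k.+1 + i by nia.
    by move=> ->; rewrite modnMDl modn_small.
  move=> Au cu Av cv uv; apply/eqP; rewrite eqn_leq !aux // dC //.
pose U t z := [/\ A z, c z = i, w (b z) = w (b x) & b z %% k.+1 = t].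
have bddU t : t < k.+1 -> bdd (U t) (sc t) (Mf' (sc t)).
  move=> tk; have [[x0 [Ax0 cx0 wx0 tx0]]|nU] := pselect (exists z, U t z).
    have [WA _ Wb] := WP (b x0); have := Wb i; rewrite tx0.
    apply: bdd_sub => // z [Az cz wz tz].
    suff -> : b x0 = b z by have [_] := cP _ Az; rewrite cz.
    have /cP[_ _ +] := Ax0; rewrite cx0 tx0 => it.
    move: wz; rewrite -wx0 /w => wz.
    have e1 := divn_eq (b x0) k.+1; have e2 := divn_eq (b z) k.+1.
    rewrite tx0 in e1; rewrite tz in e2.
    have f1 := divn_eq (b x0 + k - i) k.+1; have f2 := divn_eq (b z + k - i) k.+1.
    have l1 := ltn_pmod (b x0 + k - i) (ltn0Sn k).
    have l2 := ltn_pmod (b z + k - i) (ltn0Sn k).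
    rewrite wz in f2.
    have [f1' f2'] : b x0 %/ k.+1 * k.+1 + t + k - i = b x0 + k - i /\
        b z %/ k.+1 * k.+1 + t + k - i = b z + k - i by rewrite -e1 -e2.
    rewrite e1 e2; congr (_ * _ + _).
    exact: (quot_inj (ltnSE ik) (etrans f1' f1) (etrans f2' f2) l1 l2).
  move=> u v; case=> [|v' v'' _ [_ Uv _]]; first by rewrite d0.
  by case: nU; exists v''.
apply: (@bdd_unions U Mf' r k.+1) => //.
have [|xy' _] := @conn_img (step (fun z => A z /\ c z = i) r)
   (step (fun z => exists2 t, t < k.+1 & U t z) r) 
   (fun z => w (b z) = w (b x)) x y erefl _ xy => //.
move=> u v wu [[Au cu] [Av cv] uv]; have wv := wE _ _ Au cu Av cv uv.
split; first by rewrite -wv.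
split=> //; [exists (b u %% k.+1)|exists (b v %% k.+1)]; rewrite ?ltn_mod //.
by split=> //; rewrite -wv.
Qed.

(* The number of labels met by the balls of radius 0, r, ..., k r about a point
   is stationary at some step, and this step is its colour. *)
Lemma col_labels (A : T -> Prop) (L : choiceType) (l : T -> L) k r M :
  (forall x, A x -> exists2 s : {fset L}, #|` s| <= k &
     forall y, A y -> dist x y <= k * r -> l y \in s) ->
  (forall x y, A x -> A y -> l x = l y -> dist x y <= M) ->
  col A k r (M + 2 * (k * r)).
Proof.
move=> lk lM.
pose B x i t := exists y, [/\ A y, dist x y <= i * r & l y = t].
have /choice[i iP] x : exists i, A x ->
    i < k /\ forall t, B x i.+1 t -> B x i t.
  have [Ax|nAx] := pselect (A x); last by exists 0.
  have [s sk sP] := lk x Ax.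
  apply: contrapT => no.
  have {}no i : i < k -> exists t, B x i.+1 t /\ ~ B x i t.
    move=> ik; apply: contrapT => no'; apply: no; exists i => _; split=> // t Bt.
    by apply: contrapT => nBt; apply: no'; exists t.
  pose S i := [fset t in s | `[< B x i t >]]%fset.
  (* Each of the [k] radii would reveal a new label, which gives more than [k] labels in all. *)
  have Sk i : i <= k -> i < #|` S i|.
    elim: i => [_|i IH ik].
      rewrite cardfs_gt0; apply/fset0Pn; exists (l x).
      rewrite !inE sP ?d0 //=; apply/asboolP; exists x; rewrite d0; split=> //.
    have [t [Bt nBt]] := no i ik; apply: leq_ltn_trans (IH (ltnW ik)) _.
    have <- : #|` t |` S i|%fset = #|` S i|.+1.
      by rewrite cardfsU1 !inE (asboolF nBt) andbF.
    apply/fsubset_leq_card/fsubsetP => u; rewrite !inE => /orP[/eqP->|].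
      rewrite (asboolT Bt) andbT; case: Bt => y [Ay xy <-]; apply: sP => //.
      by apply: leq_trans xy _; rewrite leq_mul2r ik orbT.
    move=> /andP[-> /asboolP[y [Ay xy ly]]] /=.
    by apply/asboolP; exists y; split=> //; apply: leq_trans xy _; nia.
  have := Sk k (leqnn _); apply/negP; rewrite -leqNgt; apply: leq_trans sk.
  by apply/fsubset_leq_card/fsubsetP => t; rewrite !inE => /andP[].
exists i; split=> [x /iP[]//|j x y xy].
(* A label seen from [v] within [j * r] is seen from [u] within [j.+1 * r], hence within [j * r] by
   the choice of [j]. *)
have BE u v : step (fun z => A z /\ i z = j) r u v ->
    forall t, B v j t -> B u j t.
  move=> [[/iP[_ Bu] iu] [_ iv] uv] t [z [Az vz lz]].
  rewrite iu in Bu; apply: Bu; exists z; split=> //.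
  by have := dT u v z; nia.
have [->|[Ay iy]] : y = x \/ A y /\ i y = j.
- by case: xy => [|z z' _ [_ ? _]]; [left|right].
- by rewrite d0.
have jk : j < k by have [] := iP _ Ay; rewrite iy.
have : B y j (l y) by exists y; rewrite d0.
have : forall t, B y j t -> B x j t.
  by elim: xy {Ay iy} => // u v _ IH uv t /(BE _ _ uv)/IH.
move=> /[apply] -[z [Az xz /(lM _ _ Az Ay) zy]].
by have := dT x z y; nia.
Qed.

End Chains.

(** * Families of finite down-sets *)

Section SymmetricDifference.
Variable E : choiceType.
Implicit Types x y z : {fset E}.

Lemma in_sep (P : pred E) x e : (e \in [fset u in x | P u]) = (e \in x) && P e.
Proof. by rewrite !inE. Qed.

Lemma leq_fsetU x y z : x `<=` y `|` z -> #|` x| <= #|` y| + #|` z|.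
Proof. by move/fsubset_leq_card/leq_trans; apply; exact: (leq_card_fsetU y z).1. Qed.

Definition sdist x y := #|` x `\` y| + #|` y `\` x|.

Lemma leq_cardfD_tri x y z : #|` x `\` z| <= #|` x `\` y| + #|` y `\` z|.
Proof.
apply: leq_fsetU; apply/fsubsetP => e; rewrite !inE => /andP[-> ->].
by case: (e \in y).
Qed.

Lemma sdist_metric : pseudometric sdist.
Proof.
apply: And3 => [x|x y|x y z]; rewrite /sdist; first by rewrite fsetDv cardfs0.
- by rewrite addnC.
- by have := leq_cardfD_tri x y z; have := leq_cardfD_tri z y x; lia.
Qed.

Lemma sdistxx x : sdist x x = 0. Proof. by case: sdist_metric. Qed.
Lemma sdistC x y : sdist x y = sdist y x. Proof. by case: sdist_metric. Qed.
Lemma sdistT x y z : sdist x z <= sdist x y + sdist y z.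
Proof. by case: sdist_metric. Qed.

Lemma leq_card_sep (Q : pred E) x y :
  #|` [fset e in x | Q e]| <= #|` [fset e in y | Q e]| + sdist x y.
Proof.
suff : #|` [fset e in x | Q e]| <= #|` [fset e in y | Q e]| + #|` x `\` y|.
  by rewrite /sdist; lia.
apply: leq_fsetU; apply/fsubsetP => e; rewrite !inE => /andP[-> ->].
by rewrite !andbT orbN.
Qed.

End SymmetricDifference.

(* The finite configurations of an event structure, with causality [lt]. *)
Record downfam (E : choiceType) (lt : rel E) (C : {fset E} -> Prop) (D : nat) :
    Prop := Downfam {
  df_irr : irreflexive lt;
  df_trans : transitive lt;
  df_closed : forall x e e', C x -> e \in x -> lt e' e -> e' \in x;
  df_sub : forall x x', C x -> x' `<=` x ->
    (forall e e', e \in x' -> lt e' e -> e' \in x') -> C x';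
  df_width : forall x q, C x -> q `<=` x -> {in q &, forall e e', ~~ lt e e'} ->
    #|` q| <= D }.

(** * Heights, depths and marks *)

Section Heights.
Variables (E : choiceType) (lt : rel E) (C : {fset E} -> Prop) (D : nat).
Hypothesis dfC : downfam lt C D.
Implicit Types (e h : E) (x y z S F : {fset E}).

Let closedC := df_closed dfC.
Let transC := df_trans dfC.
Let irrC := df_irr dfC.

Fixpoint up n e : Prop :=
  if n is n'.+1 then exists2 e', lt e' e & up n' e' else True.

Lemma up_leq m n e : m <= n -> up n e -> up m e.
Proof.
elim: n m e => [|n IH] [|m] e //= mn [e' e'e /(IH m)]; exists e' => //; auto.
Qed.

Lemma up_bound n e x : C x -> e \in x -> up n e -> n < #|` x|.
Proof.
elim: n e x => [|n IH] e x Cx ex /=.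
  by move=> _; rewrite cardfs_gt0; apply/fset0Pn; exists e.
case=> e' e'e ue'; pose x' := [fset u in x | lt u e].
have Cx' : C x'.
  apply: (df_sub dfC Cx); first by apply/fsubsetP => u; rewrite !inE => /andP[].
  move=> u u'; rewrite !inE => /andP[ux ue] u'u.
  by rewrite (closedC Cx ux u'u) (transC u'u ue).
have e'x' : e' \in x' by rewrite !inE (closedC Cx ex e'e).
apply: leq_ltn_trans (IH _ _ Cx' e'x' ue') _.
rewrite (cardfsD1 e x) ex add1n ltnS.
apply/fsubset_leq_card/fsubsetP => u; rewrite !inE => /andP[-> ue].
by rewrite andbT; apply: contraTneq ue => ->; rewrite irrC.
Qed.

(** The default [0] can only be taken at events in no member of [C], by [up_bound]. *)
Definition ht e : nat :=
  if pselect (exists n, up n e /\ ~ up n.+1 e) is left H then projT1 (cid H) else 0.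

Lemma htP x e n : C x -> e \in x -> up n e <-> n <= ht e.
Proof.
move=> Cx ex; rewrite /ht; case: pselect => [H|[]].
  case: (cid H) => /= m [um num]; split=> [un|]; last by move/up_leq; apply.
  by rewrite leqNgt; apply/negP => /up_leq/(_ un).
have [m um] : exists m, ~ up m e.
  by exists #|` x| => /(up_bound Cx ex); rewrite ltnn.
elim: m um => [[]//|m IH um].
by have [um'|/IH//] := pselect (up m e); exists m.
Qed.

Lemma lt_ht x e e' : C x -> e \in x -> lt e' e -> ht e' < ht e.
Proof.
move=> Cx ex e'e; apply/(htP _ Cx ex); exists e' => //.
by apply/(htP _ Cx (closedC Cx ex e'e)).
Qed.

Definition cle h e := (h == e) || lt h e.

Lemma cle_mem x e h : C x -> e \in x -> cle h e -> h \in x.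
Proof. by move=> Cx ex /orP[/eqP->//|]; apply: closedC Cx ex. Qed.

Lemma cle_lt_trans h e e' : cle h e -> lt e e' -> lt h e'.
Proof. by move=> /orP[/eqP->//|he]; apply: transC. Qed.

(** Descending through predecessors whose height is exactly one less gives a chain from [e] to [h]
    with one event per height; only its length is kept, as a bound on an interval. *)
Lemma ht_chain x e n : C x -> e \in x -> n <= ht e ->
  exists h, [/\ h \in x, ht h = n, cle h e &
    ht e - n < #|` [fset u in x | cle h u && cle u e]|].
Proof.
move=> Cx; move dE: (ht e - n) => d; elim: d e dE => [|d IH] e dE ex ne.
  exists e; split=> //; [by lia|by rewrite /cle eqxx|].
  by rewrite cardfs_gt0; apply/fset0Pn; exists e; rewrite !inE ex /cle eqxx.
have [e' e'e ue'] : up (ht e).-1.+1 e by apply/(htP _ Cx ex); lia.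
have e'x := closedC Cx ex e'e.
have hte' : ht e' = (ht e).-1.
  have := lt_ht Cx ex e'e; have /(htP _ Cx e'x) := ue'; lia.
have [||h [hx hth he' cd]] := IH e' _ e'x; [lia|lia|].
exists h; split=> //; first by rewrite /cle (cle_lt_trans he' e'e) orbT.
apply: leq_ltn_trans cd _.
rewrite [ltnRHS](cardfsD1 e) !inE ex /cle eqxx (cle_lt_trans he' e'e) !orbT /= add1n ltnS.
apply/fsubset_leq_card/fsubsetP => u; rewrite !inE => /and3P[-> -> le_ue'].
have ue := cle_lt_trans le_ue' e'e.
rewrite ue orbT !andbT.
by apply: contraTneq ue => ->; rewrite irrC.
Qed.

Definition hgt x := \max_(e <- x) (ht e).+1.

Lemma ltn_hgt x e : e \in x -> ht e < hgt x.
Proof. by move=> ex; rewrite /hgt (big_rem e) //= leq_maxl. Qed.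

Lemma hgtP x n : n < hgt x -> exists2 e, e \in x & n <= ht e.
Proof.
rewrite /hgt big_seq; elim/big_ind : _ => // [a b Ha Hb|e ex].
  by rewrite leq_max => /orP[/Ha|/Hb].
by rewrite ltnS; exists e.
Qed.

(** A chain of [x] that starts at height [hgt y] avoids [y] altogether, so its length is at most
    [sdist x y]. *)
Lemma hgt_lip x y : C x -> C y -> hgt x <= hgt y + sdist x y.
Proof.
move=> Cx Cy; rewrite leqNgt; apply/negP => /hgtP[e ex hte].
have [|h [hx hth he]] := ht_chain Cx ex (n := hgt y); first by lia.
apply/negP; rewrite -leqNgt.
suff : #|` [fset u in x | cle h u & cle u e]| <= #|` x `\` y|.
  by rewrite /sdist in hte *; lia.
apply/fsubset_leq_card/fsubsetP => u; rewrite !inE => /and3P[ux hu _].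
rewrite ux andbT; apply: contraT; rewrite negbK => /ltn_hgt.
have : ht h <= ht u.
  by case/orP: hu => [/eqP->//|]; move/(lt_ht Cx ux)/ltnW.
by rewrite hth; lia.
Qed.

Lemma level_card x a w : C x ->
  #|` [fset e in x | a <= ht e < a + w]| <= D * w.
Proof.
move=> Cx; elim: w => [|w IH].
  by rewrite muln0 leqn0 cardfs_eq0; apply/fset0Pn => -[e]; rewrite !inE; lia.
rewrite mulnSr.
have lev : #|` [fset e in x | ht e == a + w]| <= D.
  apply: (df_width dfC (q := [fset e in x | ht e == a + w]) Cx).
    by apply/fsubsetP => e; rewrite !inE => /andP[].
  move=> e e'; rewrite !inE => /andP[ex /eqP he] /andP[e'x /eqP he'].
  by apply/negP => /(lt_ht Cx e'x); rewrite he he' ltnn.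
apply: leq_trans (leq_add IH lev); apply: leq_fsetU.
by apply/fsubsetP => e; rewrite !inE => /andP[-> /=]; lia.
Qed.

Definition depth h x := #|` [fset e in x | cle h e]|.

Lemma depth_lip h x y : depth h x <= depth h y + sdist x y.
Proof. exact: leq_card_sep. Qed.

Lemma depth_gt0 h x : C x -> 0 < depth h x -> h \in x.
Proof.
move=> Cx; rewrite cardfs_gt0 => /fset0Pn[e]; rewrite !inE => /andP[].
exact: cle_mem.
Qed.

Lemma depth_leq h x N w : C x -> h \in x -> ht h = N -> hgt x <= N + w ->
  depth h x <= D * w.
Proof.
move=> Cx hx hN xw; apply: leq_trans (level_card N w Cx).
apply/fsubset_leq_card/fsubsetP => e; rewrite !inE => /andP[ex he].
rewrite ex /= -{1}hN (leq_trans _ xw) ?ltn_hgt // andbT.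
by case/orP: he => [/eqP->//|/(lt_ht Cx ex)/ltnW].
Qed.

Definition marks N b x := [fset h in x | (ht h == N) && (b <= depth h x)].

Lemma marks_gt0 N m x : C x -> 0 < m -> N + m <= hgt x ->
  exists h, h \in marks N m x.
Proof.
move=> Cx m0 Nm; have [|e ex hte] := @hgtP x (N + m).-1; first by lia.
have [|h [hx hth he cd]] := ht_chain Cx ex (n := N); first by lia.
exists h; rewrite !inE hx hth eqxx /=.
suff : #|` [fset u in x | cle h u & cle u e]| <= depth h x by lia.
by apply/fsubset_leq_card/fsubsetP => u; rewrite !inE => /and3P[-> ->].
Qed.

Lemma marks_anti N b x : C x -> {in marks N b x &, forall e e', ~~ lt e e'}.
Proof.
move=> Cx e e'; rewrite !inE => /and3P[ex /eqP he _] /and3P[e'x /eqP he' _].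
by apply/negP => /(lt_ht Cx e'x); rewrite he he' ltnn.
Qed.

Lemma marks_sub N b x : marks N b x `<=` x.
Proof. by apply/fsubsetP => e; rewrite !inE => /andP[]. Qed.

Lemma marks_card N b x : C x -> #|` marks N b x| <= D.
Proof.
by move=> Cx; exact: (df_width dfC Cx (marks_sub _ _ _) (marks_anti Cx)).
Qed.

Lemma marks_leq N b b' x : b' <= b -> marks N b x `<=` marks N b' x.
Proof.
move=> bb; apply/fsubsetP => h; rewrite !inE => /and3P[-> -> /=].
exact: leq_trans.
Qed.

(** The strict bound keeps the depth of a mark positive in [y], which is what puts the mark in
    [y]. *)
Lemma marks_lip N b b' x y : C x -> C y -> b' + sdist x y <= b ->
  sdist x y < b -> marks N b x `<=` marks N b' y.
Proof.
move=> Cx Cy bb b0; apply/fsubsetP => h; rewrite !inE => /and3P[hx -> dh].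
have := depth_lip h x y => dl; rewrite depth_gt0 //=; lia.
Qed.

End Heights.

(** * Projections off an antichain *)

Section Projections.
Variables (E : choiceType) (lt : rel E).
Implicit Types (e h : E) (x y z S F : {fset E}).
Local Notation cle := (cle lt).

Definition incomp h e := ~~ cle h e && ~~ lt e h.
Definition incomps S e := all (fun h => incomp h e) S.
(* The events of [x] concurrent with all of [S]; adding [S] cuts the width of
   these families by [#|S|], see [downfam_proj]. *)
Definition proj S x := [fset e in x | incomps S e].
(** An event below a concurrent one may lie below [S], so the projections are down-closed only for
    this restricted order. *)
Definition lt_proj S e' e := [&& lt e' e, incomps S e' & incomps S e].
Definition fam_proj (C : {fset E} -> Prop) S z :=
  exists x, [/\ C x, S `<=` x & z = proj S x].
Definition pdist S x y := sdist (proj S x) (proj S y).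

Lemma in_proj S x e : (e \in proj S x) = (e \in x) && incomps S e.
Proof. by rewrite !inE. Qed.

Lemma pdistxx S x : pdist S x x = 0. Proof. exact: sdistxx. Qed.

Lemma pdist_leq S x y : pdist S x y <= sdist x y.
Proof.
by rewrite leq_add //; apply/fsubset_leq_card/fsubsetP => e;
  rewrite !in_fsetD !in_proj; do !case: (_ \in _); case: incomps.
Qed.

Variables (C : {fset E} -> Prop) (D : nat).
Hypothesis dfC : downfam lt C D.
Let closedC := df_closed dfC.
Let transC := df_trans dfC.
Let irrC := df_irr dfC.

Definition anti S := {in S &, forall e e', ~~ lt e e'}.

Lemma incompsPn S x e : C x -> S `<=` x -> ~~ incomps S e ->
  (exists2 h, h \in S & cle h e) \/ e \in x.
Proof.
move=> Cx /fsubsetP Sx; rewrite -has_predC => /hasP[h hS] /=.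
rewrite negb_and !negbK => /orP[he|eh]; first by left; exists h.
by right; apply: closedC eh => //; apply: Sx.
Qed.

Lemma incomps_self S h : h \in S -> ~~ incomps S h.
Proof. by move=> hS; apply/allPn; exists h; rewrite // /incomp /cle eqxx. Qed.

(** An antichain of concurrent events remains one when [S] is added, whence the width. A down-closed
    part of a projection is realized by adding to it the events of [x] at or below [S]. *)
Lemma downfam_proj S : anti S ->
  downfam (lt_proj S) (fam_proj C S) (D - #|` S|).
Proof.
move=> aS; split.
- by move=> e; rewrite /lt_proj irrC.
- move=> e2 e1 e3 /and3P[l1 i1 _] /and3P[l2 _ i3].
  by rewrite /lt_proj (transC l1 l2) i1 i3.
- move=> _ e e' [x [Cx Sx ->]]; rewrite !in_proj => /andP[ex _] /and3P[l i _].
  by rewrite (closedC Cx ex l) i.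
- move=> _ z' [x [Cx Sx ->]] /fsubsetP z'x z'c.
  have z'P e : e \in z' -> e \in x /\ incomps S e.
    by move/z'x; rewrite in_proj => /andP.
  pose x' := [fset e in x | (e \in z') || has (cle e) S].
  exists x'; split.
  + apply: (df_sub dfC Cx); first by apply/fsubsetP => e; rewrite !inE => /andP[].
    move=> e e'; rewrite in_sep /= in_sep /= => /andP[ex ez] e'e.
    rewrite (closedC Cx ex e'e) /=; case/orP: ez => [ez|/hasP[s sS es]].
      have [ie'|] := boolP (incomps S e').
        by rewrite (z'c e) // /lt_proj e'e ie'; case: (z'P _ ez).
      rewrite -has_predC => /hasP[h hS] /=; rewrite negb_and !negbK.
      case/orP => [he'|e'h].
        case: (z'P _ ez) => _ /allP/(_ _ hS)/andP[].
        by rewrite /cle (cle_lt_trans dfC he' e'e) orbT.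
      by apply/orP; right; apply/hasP; exists h; rewrite // /cle e'h orbT.
    apply/orP; right; apply/hasP; exists s => //.
    have e's : lt e' s by case/orP: es => [/eqP<-|/(transC e'e)].
    by rewrite /cle e's orbT.
  + apply/fsubsetP => s sS; rewrite in_sep /= (fsubsetP Sx) //=.
    by apply/orP; right; apply/hasP; exists s; rewrite // /cle eqxx.
  apply/fsetP => e; rewrite in_proj in_sep /=.
  apply/idP/andP => [/[dup] ez /z'P[-> ->]|[/andP[_ ez] ie]]; first by rewrite ez.
  case/orP: ez => // /hasP[s sS]; case/orP => [/eqP es|es].
    by rewrite es (negbTE (incomps_self sS)) in ie.
  by move/allP: ie => /(_ _ sS)/andP[_]; rewrite es.
move=> _ q [x [Cx Sx ->]] /fsubsetP qx qa.
have qP e : e \in q -> e \in x /\ incomps S e.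
  by move/qx; rewrite in_proj => /andP.
have qS : [disjoint q & S].
  apply/fdisjointP => e /qP[_ ie]; apply: contraTN ie.
  exact: incomps_self.
suff : #|` q `|` S| <= D.
  by rewrite cardfsU (disjoint_fsetI0 qS) cardfs0 subn0; lia.
apply: (df_width dfC Cx); first by rewrite fsubUset Sx andbT; apply/fsubsetP => e /qP[].
move=> e e'; rewrite !in_fsetU => /orP[eq|eS] /orP[eq'|eS'].
- have := qa _ _ eq eq'; rewrite /lt_proj.
  by have [_ ->] := qP _ eq; have [_ ->] := qP _ eq'; rewrite !andbT.
- by have [_ /allP/(_ _ eS')/andP[]] := qP _ eq.
- have [_ /allP/(_ _ eS)/andP[+ _]] := qP _ eq'.
  by rewrite negb_or => /andP[].
- exact: aS.
Qed.

Lemma card_upS (S : seq E) x K : {in S, forall h, depth lt h x <= K} ->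
  #|` [fset e in x | has (fun h => cle h e) S]| <= size S * K.
Proof.
elim: S => [|h S IH] SK.
  by rewrite leqn0 cardfs_eq0; apply/fset0Pn => -[e]; rewrite !inE andbF.
rewrite mulSn.
apply: leq_trans (leq_add (SK h (mem_head _ _)) (IH _)); last first.
  by move=> h' h'S; apply: SK; rewrite in_cons h'S orbT.
apply: leq_fsetU; apply/fsubsetP => e; rewrite in_sep /=.
by rewrite in_fsetU !in_sep /= => /andP[-> /orP[->|->]]; rewrite ?orbT.
Qed.

(** What the projection forgets lies below [S], hence in both [x] and [y], or above [S], with at
    most [K] events above each element. *)
Lemma sdist_leq_pdist S x y K : C x -> C y -> S `<=` x -> S `<=` y ->
  {in S, forall h, depth lt h x <= K} -> {in S, forall h, depth lt h y <= K} ->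
  sdist x y <= pdist S x y + 2 * (#|` S| * K).
Proof.
have aux x1 y1 : C x1 -> C y1 -> S `<=` x1 -> S `<=` y1 ->
    {in S, forall h, depth lt h x1 <= K} ->
    #|` x1 `\` y1| <= #|` proj S x1 `\` proj S y1| + #|` S| * K.
  move=> Cx Cy Sx Sy Sk.
  apply: leq_trans (leq_add (leqnn _) (card_upS Sk)).
  apply: leq_fsetU; apply/fsubsetP => e.
  rewrite in_fsetD in_fsetU in_fsetD !in_proj in_sep /= => /andP[ey ex].
  rewrite ex (negbTE ey) /=; apply/orP.
  have [|/(incompsPn Cy Sy)] := boolP (incomps S e); first by left.
  by case=> [[h hS he]|]; [right; apply/hasP; exists h|rewrite (negbTE ey)].
move=> Cx Cy Sx Sy Kx Ky; rewrite /sdist /pdist /sdist.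
by have := aux x y Cx Cy Sx Sy Kx; have := aux y x Cy Cx Sy Sx Ky; lia.
Qed.

Definition cut S S' x := [fset e in x | ~~ has (fun h => cle h e) (S `\` S')].

Lemma cutP S S' x : C x -> anti S -> S' `<=` S -> S `<=` x ->
  C (cut S S' x) /\ S' `<=` cut S S' x.
Proof.
move=> Cx aS /fsubsetP S'S /fsubsetP Sx; split.
  apply: (df_sub dfC Cx); first by apply/fsubsetP => e; rewrite in_sep => /andP[].
  move=> e e'; rewrite in_sep /= in_sep /= => /andP[ex /hasPn ne] e'e.
  rewrite (closedC Cx ex e'e) /=; apply/hasPn => h /ne; apply: contra.
  by move=> he'; rewrite /cle (cle_lt_trans dfC he' e'e) orbT.
apply/fsubsetP => s sS'; rewrite in_sep /= Sx ?S'S //=.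
apply/hasPn => h; rewrite in_fsetD => /andP[hS' hS].
rewrite /cle negb_or (aS _ _ hS (S'S _ sS')) andbT.
by apply: contraNneq hS' => ->.
Qed.

(** When [S] shrinks to [S'], events above a discarded element may become visible. In [R] they are
    cut off, as nothing is known about them; in [y] they are few by the bound on depths. Newly
    visible events below [S] belong to both sides. *)
Lemma pdist_cut S S' y R K : C y -> C R -> S' `<=` S -> S `<=` y -> S `<=` R ->
  {in S `\` S', forall h, depth lt h y <= K} ->
  pdist S' y (cut S S' R) <= pdist S y R + #|` S| * K.
Proof.
move=> Cy CR /fsubsetP S'S Sy SR SK.
have indS e z : C z -> S `<=` z -> e \notin z -> incomps S' e ->
    ~~ has (fun h => cle h e) (S `\` S') -> incomps S e.
  move=> Cz Sz ez ie nh; apply: contraT => /(incompsPn Cz Sz)[[h hS he]|].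
    have [hS'|hS'] := boolP (h \in S').
      by move/allP: ie => /(_ _ hS')/andP[]; rewrite he.
    by case/hasP: nh; exists h; rewrite // in_fsetD hS'.
  by rewrite (negbTE ez).
suff [H1 H2] : #|` proj S' y `\` proj S' (cut S S' R)| <=
        #|` proj S y `\` proj S R| + #|` S| * K /\
   #|` proj S' (cut S S' R) `\` proj S' y| <= #|` proj S R `\` proj S y|.
  by rewrite /pdist /sdist; lia.
split.
  have SS : #|` S `\` S'| <= #|` S| by apply/fsubset_leq_card/fsubsetDl.
  apply: (@leq_trans (#|` proj S y `\` proj S R| + #|` S `\` S'| * K)); last first.
    by rewrite leq_add2l leq_mul2r SS orbT.
  apply: leq_trans (leq_add (leqnn _) (card_upS SK)).
  apply: leq_fsetU; apply/fsubsetP => e.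
  rewrite in_fsetD in_fsetU in_fsetD !in_proj !in_sep /= => /andP[+ /andP[ey ie]].
  rewrite ey ie andbT /= => eR.
  have [|nh] := boolP (has _ _); rewrite ?orbT // orbF.
  rewrite nh andbT in eR.
  by rewrite (indS e R) // ?(negbTE eR).
apply/fsubset_leq_card/fsubsetP => e.
rewrite !in_fsetD !in_proj !in_sep /= => /andP[+ /andP[/andP[eR nh] ie]].
rewrite ie andbT => ey.
by rewrite eR (indS e y) // (negbTE ey).
Qed.

(* [c] colours the projections off [S] and [cl] picks a representative of each
   monochromatic [r]-component. *)
Definition cell_system S k r B (c : {fset E} -> nat) (cl : {fset E} -> {fset E}) :=
  [/\ forall x, C x -> S `<=` x -> c x < k,
      forall x, C x -> S `<=` x -> [/\ C (cl x), S `<=` cl x,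
        pdist S x (cl x) <= B & c (cl x) = c x]
    & forall x y, C x -> S `<=` x -> C y -> S `<=` y -> c x = c y ->
        pdist S x y <= r -> cl x = cl y].

Lemma cells S r B k : col (@sdist E) (fam_proj C S) k r B ->
  exists c cl, cell_system S k r B c cl.
Proof.
case=> c [ck cb].
pose rel_ (x y : {fset E}) := [/\ C y, S `<=` y & c (proj S y) = c (proj S x) /\
  conn (step (@sdist E) (fun z => fam_proj C S z /\ c z = c (proj S x)) r)
    (proj S x) (proj S y)].
exists (fun x => c (proj S x)), (fun x => xget x (rel_ x)); split.
- by move=> x Cx Sx; apply: ck; exists x.
- move=> x Cx Sx; have : rel_ x (xget x (rel_ x)).
    by apply: (@xgetPex _ x (rel_ x)); exists x; split=> //; split=> //; left.
  case=> Cc Sc [cc /cb d]; split=> //.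
move=> x y Cx Sx Cy Sy cxy xy.
have xyR : conn (step (@sdist E) (fun z => fam_proj C S z /\ c z = c (proj S x)) r)
    (proj S x) (proj S y).
  by right with (proj S x); [left|split=> //; split=> //; [exists x|exists y]].
have relE : rel_ x = rel_ y.
  apply/funext => z; apply/propext; rewrite /rel_ -cxy.
  split=> -[Cz Sz [cz xz]]; split=> //; split=> //; apply: conn_trans xz => //.
  by apply: conn_sym xyR => u v; apply: step_sym; exact: sdist_metric.
(* The two sides differ only in the default of [xget], which is not reached since [x] itself
   qualifies. *)
rewrite -relE /xget; case: pselect => // nP; case: nP; exists x.
by apply/asboolP; split=> //; split=> //; left.
Qed.

End Projections.

(** On [P], [f] factors through [g], so it takes no more values than [g]. The list has no other
    entries, so that each label listed comes from a point. *)
Lemma image_seq (T : Type) (A B : eqType) (P : T -> Prop) (f : T -> A)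
    (g : T -> B) (r : seq B) :
  (forall x y, P x -> P y -> g x = g y -> f x = f y) ->
  (forall x, P x -> g x \in r) ->
  exists s : seq A, [/\ uniq s, size s <= size r, forall x, P x -> f x \in s &
    forall a, a \in s -> exists2 x, P x & f x = a].
Proof.
elim: r P => [|b r IH] P gf gr.
  by exists [::]; split=> // x /gr.
have [||s [us sz fs sP]] := IH (fun x => P x /\ g x != b).
- by move=> x y [Px _] [Py _]; apply: gf.
- by move=> x [/gr]; rewrite inE => /orP[->|].
have [[x0 [Px0 gx0]]|nx0] := pselect (exists x0, P x0 /\ g x0 = b); last first.
  exists s; split=> // [|x Px|a /sP[x [Px _] <-]]; last by exists x.
    exact: leqW.
  by apply: fs; split=> //; apply/eqP => gxb; apply: nx0; exists x.
exists (undup (f x0 :: s)); split; first exact: undup_uniq.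
- by apply: leq_trans (size_undup _) _.
- move=> x Px; rewrite mem_undup inE.
  have [gxb|gxb] := eqVneq (g x) b; last by rewrite fs ?orbT.
  by rewrite (gf x x0) ?eqxx // gxb.
- move=> a; rewrite mem_undup inE => /orP[/eqP->|/sP[x [Px _] <-]].
    by exists x0.
  by exists x.
Qed.

(** Double counting: by injectivity of [a], each [h] contributes to at most one [l]. *)
Lemma sum_count_inj (A B : eqType) (a : A -> nat) (q : B -> nat) (z : pred B)
    (s : seq A) (r : seq B) :
  uniq s -> {in s &, injective a} ->
  (forall l h, l \in s -> q h = a l -> z h) ->
  \sum_(l <- s) count (fun h => q h == a l) r <= count z r.
Proof.
move=> us ainj az; elim: r => [|h r IH] /=; first by rewrite big1.
rewrite big_split /= leq_add // -big_mkcond /= sum1_count.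
rewrite (eq_count (a2 := preim a (pred1 (q h)))); last by move=> l; rewrite /= eq_sym.
rewrite -count_map count_uniq_mem ?map_inj_in_uniq //.
by case: mapP => // -[l ls ql]; rewrite (az l).
Qed.

(** * Labels from antichains of deep marks *)

Section Labels.
Variables (E : choiceType) (lt : rel E) (C : {fset E} -> Prop) (D : nat).
Hypothesis dfC : downfam lt C D.
Hypothesis D_gt0 : 0 < D.
Implicit Types (h : E) (x y z S F : {fset E}).

Variables (N rad : nat) (rho ecc Bd : nat -> nat).
Variables (c : {fset E} -> {fset E} -> nat) (cl : {fset E} -> {fset E} -> {fset E}).

(** [gap] exceeds the diameter of a ball of radius [rad]. A window of length [W] holds the
    thresholds of index [1] to [D.+1], and those that select, of index at most [D], keep a margin of
    [gap] at both ends. [K] bounds the number of types of labels; each of the [D] stages owns [K]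
    windows, and [Tmax] is the end of the last one. *)
Let gap := (2 * rad).+1.
Let W := D.+2 * gap.
Let K := D.+1 * D.+1.
Let Tmax := D * K * W.
Let thr a i := a * W + (D.+1 - i) * gap.
Local Notation marks := (marks lt N).
Local Notation depth := (depth lt).
Local Notation pdist := (pdist lt).

Hypothesis cellP : forall S, anti lt S -> 0 < #|` S| <= D ->
  cell_system lt C S (D - #|` S|).+1 (rho #|` S|) (Bd #|` S|) (c S) (cl S).
(** [ecc k] bounds the error of a label whose antichain has size [k]. When the antichain shrinks,
    the error grows by the events above the discarded marks and by the size of the old cell. [rho]
    is so large that nearby points with labels of the same type share a cell. *)
Hypothesis eccP : forall k' k, k' < k -> k <= D ->
  D * Tmax + ecc k + Bd k <= ecc k'.
Hypothesis rhoP : forall k, k <= D -> 2 * ecc k + 2 * rad <= rho k.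

Definition far y := C y /\ exists h, h \in marks Tmax y.

Lemma thr_ltn a b i j : a < b -> 0 < i -> j <= D.+1 -> thr a i < thr b j.
Proof.
move=> ab i0 jD; rewrite /thr /W.
have : a.+1 * (D.+2 * gap) <= b * (D.+2 * gap) by rewrite leq_mul2r ab orbT.
have : (D.+1 - i) * gap <= D * gap by rewrite leq_mul2r; apply/orP; right; lia.
by rewrite mulSn !mulSn; lia.
Qed.

Lemma thr_gap a i j : i < j -> j <= D.+1 -> thr a j + gap <= thr a i.
Proof.
move=> ij jD; rewrite /thr -addnA leq_add2l -mulSnr leq_mul2r.
by apply/orP; right; lia.
Qed.

Lemma thr_gt0 a i : i <= D -> gap <= thr a i.
Proof.
by move=> iD; rewrite /thr subSn // mulSn addnCA leq_addr.
Qed.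

Lemma thr_max a i : a < D * K -> 0 < i -> thr a i <= Tmax.
Proof.
move=> aK i0; rewrite /thr /Tmax.
have : a.+1 * W <= D * K * W by rewrite leq_mul2r aK orbT.
have : (D.+1 - i) * gap <= W by rewrite leq_mul2r; apply/orP; right; lia.
by rewrite mulSn; lia.
Qed.

(* Each [a] gives a window of thresholds [thr a i] that are more than [2 * rad]
   apart.  As at most [D] marks survive, for some [k > 0] exactly [k] marks survive
   at both [thr a k] and [thr a k.+1]; on a ball, this set [Sel a] is then
   determined by its size. *)
Definition ksel a y := \max_(k < D.+1 | k <= #|` marks (thr a k) y|) (k : nat).
Definition Sel a y := marks (thr a (ksel a y)) y.

Lemma selP a y : far y -> a < D * K ->
  [/\ 0 < ksel a y <= D, #|` Sel a y| = ksel a y &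
      marks (thr a (ksel a y).+1) y = Sel a y].
Proof.
move=> [Cy [h hm]] aK.
have ge1 : 0 < ksel a y.
  rewrite /ksel; pose k1 : 'I_D.+1 := Ordinal (D_gt0 : 1 < D.+1).
  apply: (@leq_trans k1) => //; apply: leq_bigmax_cond.
  rewrite cardfs_gt0; apply/fset0Pn; exists h.
  by apply: (fsubsetP (marks_leq _ _ _ _)) hm; apply: thr_max.
have [k km kE] : {k : 'I_D.+1 | k <= #|` marks (thr a k) y| & ksel a y = k}.
  apply: eq_bigmax_cond; apply/card_gt0P; exists ord0 => //.
have kD : k <= D by rewrite -ltnS.
have sub : marks (thr a k) y `<=` marks (thr a k.+1) y.
  by apply: marks_leq; have := thr_gap a (ltnSn k); lia.
(* By maximality of [k], or by the width bound if [k = D], the next threshold admits no further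
   mark. *)
have up1 : #|` marks (thr a k.+1) y| <= k.
  move: kD; rewrite leq_eqVlt => /orP[/eqP->|kD].
    exact: (marks_card dfC N _ Cy).
  rewrite leqNgt; apply/negP => lt1.
  have := @leq_bigmax_cond _ (fun k : 'I_D.+1 => k <= #|` marks (thr a k) y|)
    (fun k => k : nat) (Ordinal (kD : k.+1 < D.+1)) lt1.
  by rewrite -/(ksel a y) kE /= ltnn.
have eqm : marks (thr a k) y = marks (thr a k.+1) y.
  by apply/eqP; rewrite eqEfcard sub (leq_trans up1).
rewrite ge1 /Sel kE kD -eqm; split=> //.
by apply/eqP; rewrite eqn_leq km andbT eqm.
Qed.

Lemma Sel_anti a y : C y -> anti lt (Sel a y).
Proof. by move=> Cy; apply: (marks_anti dfC Cy). Qed.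

Lemma Sel_sub a y : Sel a y `<=` y.
Proof. exact: marks_sub. Qed.

Lemma Sel_mono a b y : far y -> a < b -> b < D * K -> Sel b y `<=` Sel a y.
Proof.
move=> fy ab bK; have [/andP[b1 b2] _ _] := selP fy bK.
have [/andP[a1 a2] _ _] := selP fy (ltn_trans ab bK).
by apply/marks_leq/ltnW/thr_ltn => //; apply: ltnW.
Qed.

(** For [a <= b], the marks selected in [y] reappear in [x] at the next lower threshold of window
    [a], which by [selP] admits nothing new; equal sizes then force equality. *)
Lemma Sel_eq a b x y : far x -> far y -> a < D * K -> b < D * K ->
  sdist x y <= 2 * rad -> #|` Sel a x| = #|` Sel b y| -> Sel a x = Sel b y.
Proof.
wlog ab : a b x y / a <= b.
  move=> H fx fy aK bK xy; case/orP: (leq_total a b) => [ab|ba] e.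
    exact: H.
  by apply/esym/H => //; rewrite sdistC.
move=> fx fy aK bK xy.
have [/andP[k1 k2] -> e1] := selP fx aK; have [/andP[k3 k4] cb e2] := selP fy bK.
rewrite cb => kk; apply/eqP; rewrite eq_sym eqEfcard -e1; apply/andP; split.
  apply: (marks_lip dfC _ (proj1 fy) (proj1 fx)).
    rewrite sdistC -kk.
    have := thr_gap a (ltnSn (ksel a x)); rewrite ltnS => /(_ k2).
    have : thr a (ksel a x) <= thr b (ksel a x).
      by rewrite /thr leq_add2r leq_mul2r ab orbT.
    by rewrite /gap; lia.
  by rewrite sdistC; have := thr_gt0 b k4; rewrite /gap; lia.
by rewrite e1; have [_ -> _] := selP fx aK; rewrite cb kk.
Qed.

Definition typ (SR : {fset E} * {fset E}) := (#|` SR.1|, c SR.1 SR.2).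
Definition idx s (t : nat * nat) := s * K + t.1 * D.+1 + t.2.

(* The label of [y] is refined in [D] stages.  At each stage the window of
   thresholds depends on the type of the present label, different types having
   disjoint windows: hence a mark of a point creates at most one new label. *)
Fixpoint stage s y : {fset E} * {fset E} :=
  if s is s'.+1 then
    let t := stage s' y in
    let S' := Sel (idx s (typ t)) y in
    (S', if S' == t.1 then t.2 else cl S' (cut lt t.1 S' t.2))
  else (Sel 0 y, cl (Sel 0 y) y).

Definition asel s y := if s is s'.+1 then idx s (typ (stage s' y)) else 0.

Lemma stage1 s y : (stage s y).1 = Sel (asel s y) y.
Proof. by case: s. Qed.

Lemma idx_range s t : t.1 <= D -> t.2 <= D -> s * K <= idx s t < s.+1 * K.
Proof.
move=> t1 t2; rewrite /idx -addnA leq_addr /= mulSnr ltn_add2l /K.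
have : t.1 * D.+1 <= D * D.+1 by rewrite leq_mul2r t1 orbT.
by rewrite [D.+1 * D.+1]mulSn; lia.
Qed.

Lemma idx_inj s t t' : t.2 <= D -> t'.2 <= D -> idx s t = idx s t' -> t = t'.
Proof.
case: t t' => [k j] [k' j'] /= jD jD' /eqP; rewrite /idx -!addnA eqn_add2l /=.
move=> /eqP e; have : (k * D.+1 + j) %/ D.+1 = (k' * D.+1 + j') %/ D.+1 by rewrite e.
rewrite !divnMDl // !divn_small // !addn0 => kk.
by move: e; rewrite kk => /addnI ->.
Qed.

(** [z] is a point of the cell that [SR.2] represents. It need not be [y]: the representative is cut
    and passed on rather than recomputed from [y], so that a label depends only on the previous
    label and the new antichain. *)
Definition stage_ok s y (SR : {fset E} * {fset E}) :=
  [/\ s * K <= asel s y < s.+1 * K, 0 < #|` SR.1| <= D,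
      C SR.2 /\ SR.1 `<=` SR.2, c SR.1 SR.2 <= D - #|` SR.1| &
      exists z, [/\ C z, SR.1 `<=` z, cl SR.1 z = SR.2, c SR.1 z = c SR.1 SR.2 &
        pdist SR.1 y z <= ecc #|` SR.1|]].

Lemma ltn_zone s a : s < D -> a < s.+1 * K -> a < D * K.
Proof. by move=> sD /leq_trans; apply; rewrite leq_mul2r sD orbT. Qed.

Lemma stageP s y : far y -> s < D -> stage_ok s y (stage s y).
Proof.
move=> fy; have Cy : C y by case: fy.
elim: s => [|s IH] sD.
  have a0 : 0 < D * K by rewrite muln_gt0 D_gt0.
  have [k1 k2 _] := selP fy a0; rewrite -k2 in k1.
  have [cc1 cc2 cc3] := cellP (@Sel_anti 0 y Cy) k1.
  have [h1 h2 h3 h4] := cc2 _ Cy (Sel_sub 0 y).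
  split=> //=; first by rewrite h4 -ltnS; apply: cc1 => //; apply: Sel_sub.
  exists y; split=> //; [exact: Sel_sub|].
  by rewrite pdistxx.
have {}IH := IH (ltnW sD).
have e1 := stage1 s y.
move: IH; rewrite /= /stage_ok /=; case: (stage s y) e1 => S R /= e1.
case=> /andP[a1 a2] /andP[S0 SD] [CR SR] cSR [z [Cz Sz zR czR yz]].
have [i1 i2] : idx s.+1 (typ (S, R)) >= s.+1 * K /\ idx s.+1 (typ (S, R)) < s.+2 * K.
  by apply/andP/idx_range => //=; lia.
set a' := idx s.+1 (typ (S, R)) in i1 i2 *.
have a'K := ltn_zone sD i2.
have S'S : Sel a' y `<=` S.
  by rewrite e1; apply: Sel_mono => //; apply: leq_trans a2 i1.
have [k1 k2 k3] := selP fy a'K.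
have [cc1 cc2 cc3] := cellP (@Sel_anti a' y Cy) (eq_ind_r (fun n => 0 < n <= D) k1 k2).
rewrite i1 i2 k2 k1.
have [eS|neS] := eqVneq (Sel a' y) S.
  rewrite eS; split=> //; first by rewrite -k2 eS.
  by exists z; rewrite -k2 eS.
have aS : anti lt S by rewrite e1; apply: Sel_anti.
have Sy : S `<=` y by rewrite e1; apply: Sel_sub.
have [Cc S'c] := cutP dfC CR aS S'S SR.
have [h1 h2 h3 h4] := cc2 _ Cc S'c.
split=> //; first by rewrite h4 -k2 -ltnS; apply: cc1.
exists (cut lt S (Sel a' y) R); split=> //.
have lt1 : ksel a' y < #|` S|.
  rewrite -k2; apply: fproper_ltn_card; rewrite fproperEneq neS S'S //.
apply: leq_trans (eccP lt1 SD).
have [_ cb _] := cellP aS (introT andP (conj S0 SD)).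
have [_ _ zR' _] := cb _ Cz Sz; rewrite zR in zR'.
apply: leq_trans (pdist_cut dfC (K := Tmax) Cy CR S'S Sy SR _) _; last first.
  have := sdistT (proj lt S y) (proj lt S z) (proj lt S R).
  have : #|` S| * Tmax <= D * Tmax by rewrite leq_mul2r SD orbT.
  by rewrite -!/(pdist _ _ _); lia.
(* A discarded mark missed a threshold of window [a'], so its depth is at most [Tmax]. *)
move=> h; rewrite in_fsetD => /andP[hS' hS].
have hy : h \in y by apply: (fsubsetP Sy).
have hN : ht lt h == N by move: hS; rewrite e1 in_sep => /and3P[].
move: hS'; rewrite in_sep hy hN /= -ltnNge => /ltnW /leq_trans; apply.
by apply: thr_max => //; case/andP: k1.
Qed.

(** Equal sizes give equal antichains by [Sel_eq]; the points [z1] and [z2] behind the two labels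
    then have the same colour and projections within [rho], hence share a cell. *)
Lemma stage_inj s x y : far x -> far y -> s < D -> sdist x y <= 2 * rad ->
  typ (stage s x) = typ (stage s y) -> stage s x = stage s y.
Proof.
move=> fx fy sD xy.
have := stageP fx sD; have := stageP fy sD; rewrite /stage_ok.
have := stage1 s x; have := stage1 s y.
case: (stage s x) => S1 R1; case: (stage s y) => S2 R2 /= e2 e1.
move=> [/andP[_ a2] /andP[k2 l2] [CR2 SR2] cd2 [z2 [Cz2 Sz2 cl2 cz2 pd2]]].
move=> [/andP[_ a1] /andP[k1 l1] [CR1 SR1] cd1 [z1 [Cz1 Sz1 cl1 cz1 pd1]]].
move=> [kk cc].
have eS : S1 = S2.
  rewrite e1 e2; apply: Sel_eq => //; rewrite -?e1 -?e2 //; exact: ltn_zone a1 || exact: ltn_zone a2.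
rewrite -eS in SR2 cd2 Sz2 cl2 cz2 pd2 cc *; congr (_, _); rewrite -cl1 -cl2.
have aS : anti lt S1 by rewrite e1; apply: Sel_anti; case: fx.
have [_ _ cc3] := cellP aS (introT andP (conj k1 l1)).
apply: cc3 => //; first by rewrite cz1 cz2.
apply: leq_trans (rhoP l1).
have := sdistT (proj lt S1 z1) (proj lt S1 x) (proj lt S1 z2).
have := sdistT (proj lt S1 x) (proj lt S1 y) (proj lt S1 z2).
rewrite (sdistC (proj lt S1 z1) (proj lt S1 x)) -!/(pdist _ _ _).
by have := pdist_leq lt S1 x y; lia.
Qed.

(** * The number of labels on a ball *)

Section Count.
Variable y0 : {fset E}.
Hypothesis y0far : far y0.

Let ball y := far y /\ sdist y0 y <= rad.
Let Hm := marks 0 y0.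
(** The only window in which [h] may be selected at some points of the ball and not at others, see
    [Sel_lower] and [Sel_upper]. *)
Let q h := (depth h y0 + rad) %/ W.

Let ball_dist x y : ball x -> ball y -> sdist x y <= 2 * rad.
Proof.
by move=> [_ x0] [_]; have := sdistT x y0 y; rewrite sdistC in x0; lia.
Qed.

Lemma Sel_lower a y h : ball y -> a < D * K -> h \in Hm -> a < q h -> h \in Sel a y.
Proof.
move=> [fy y0y] aK hH; rewrite leq_divRL // => aq.
have [/andP[k1 k2] _ _] := selP fy aK.
move: hH; rewrite !in_sep => /and3P[hy0 -> _] /=.
have dl := depth_lip lt h y0 y.
have t1 : thr a (ksel a y) + 2 * rad < a.+1 * W.
  have eW : W = gap + (gap + D * gap) by [].
  have eg : gap = (2 * rad).+1 by [].
  rewrite /thr mulSn.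
  have : (D.+1 - ksel a y) * gap <= D * gap by rewrite leq_mul2r; apply/orP; right; lia.
  by lia.
have -> : h \in y by apply: (depth_gt0 dfC (proj1 fy)); lia.
by lia.
Qed.

Lemma Sel_upper a y h : ball y -> a < D * K -> h \in Sel a y -> (h \in Hm) && (a <= q h).
Proof.
move=> [fy y0y] aK; have [/andP[k1 k2] _ _] := selP fy aK.
rewrite !in_sep => /and3P[hy -> dh].
have dl := depth_lip lt h y y0; rewrite sdistC in dl.
have t1 : gap <= (D.+1 - ksel a y) * gap by rewrite leq_pmull // subn_gt0 ltnS.
rewrite /thr in dh; rewrite leq_divRL //.
have -> : h \in y0 by apply: (depth_gt0 dfC (proj1 y0far)); rewrite /gap in dh t1; lia.
by rewrite /gap in dh t1 *; lia.
Qed.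

Let zn h := q h %/ K.

Lemma asel_zone s y : far y -> s < D -> asel s y < D * K /\ asel s y %/ K = s.
Proof.
move=> fy sD; have [/andP[a1 a2] _ _ _ _] := stageP fy sD.
split; first exact: ltn_zone a2.
by apply/eqP; rewrite eqn_leq -ltnS ltn_divLR // a2 leq_divRL.
Qed.

Lemma card_Sel a y : ball y -> a < D * K ->
  count (fun h => a < q h) Hm <= #|` Sel a y| <=
    count (fun h => a < q h) Hm + count (fun h => q h == a) Hm.
Proof.
move=> By aK; rewrite -!size_filter; apply/andP; split.
  apply: uniq_leq_size => [|h]; first exact/filter_uniq/fset_uniq.
  by rewrite mem_filter => /andP[aq hH]; apply: Sel_lower.
rewrite -size_cat; apply: uniq_leq_size => [|h hS]; first exact: fset_uniq.
have /andP[hH] := Sel_upper By aK hS.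
by rewrite mem_cat !mem_filter hH !andbT leq_eqVlt eq_sym orbC.
Qed.

(** A new label is determined by the old one and the size of the new antichain. This size varies
    only through marks in the window of the old label, and distinct old labels use distinct windows;
    so the marks of range [s.+1] pay for all additional labels. *)
Lemma stage_step s n (L : seq ({fset E} * {fset E})) : s.+1 < D ->
  uniq L -> size L <= n -> (forall y, ball y -> stage s y \in L) ->
  (forall l, l \in L -> exists2 y, ball y & stage s y = l) ->
  exists L', [/\ uniq L', size L' <= n + count (fun h => zn h == s.+1) Hm,
    forall y, ball y -> stage s.+1 y \in L' &
    forall l, l \in L' -> exists2 y, ball y & stage s.+1 y = l].
Proof.
move=> sD uL sL Ls Ly.
pose a (l : {fset E} * {fset E}) := idx s.+1 (typ l).
pose lo l := count (fun h => a l < q h) Hm.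
pose num l := count (fun h => q h == a l) Hm.
pose r := [seq (l, k) | l <- L, k <- iota (lo l) (num l).+1].
pose g y := (stage s y, #|` (stage s.+1 y).1|).
have aE y : asel s.+1 y = a (stage s y) by [].
have [||L' [uL' sz L's L'y]] := @image_seq _ _ _ ball (stage s.+1) g r.
- move=> x y Bx By [e1 e2].
  have [ax _] := asel_zone (proj1 Bx) sD; have [ay _] := asel_zone (proj1 By) sD.
  have e3 : Sel (asel s.+1 x) x = Sel (asel s.+1 y) y.
    apply: Sel_eq ax ay _ _; [exact: (proj1 Bx)|exact: (proj1 By)|exact: ball_dist|].
    by rewrite -!stage1.
  by move: e3; rewrite /= e1 => ->.
- move=> y By; apply/allpairsPdep; exists (stage s y), #|` (stage s.+1 y).1|.
  split=> //; first exact: Ls.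
  rewrite stage1 mem_iota addnS ltnS -/a.
  by apply: card_Sel => //; case: (asel_zone (proj1 By) sD).
exists L'; split=> //; apply: leq_trans sz _; rewrite size_allpairs_dep sumnE big_map.
under eq_bigr => l _ do rewrite size_iota -addn1 addnC.
rewrite big_split /= sum1_size leq_add //.
apply: sum_count_inj => // [l l' /Ly[y By <-] /Ly[y' By' <-]|l h /Ly[y By <-] e].
  rewrite /a => e; have sD' := ltnW sD.
  apply: stage_inj => //; [exact: (proj1 By)|exact: (proj1 By')|exact: ball_dist|].
  apply: idx_inj e.
    by have [_ _ _ + _] := stageP (proj1 By) sD'; rewrite /typ /=; lia.
  by have [_ _ _ + _] := stageP (proj1 By') sD'; rewrite /typ /=; lia.
by rewrite /zn e -aE; case: (asel_zone (proj1 By) sD) => _ ->.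
Qed.

(** All antichains on the ball have size [k], so by [stage_inj] the labels differ only in their
    colour. *)
Lemma stage_free t : t < D -> (forall h, h \in Hm -> zn h != t) ->
  let k := count (fun h => t < zn h) Hm in
  exists L', [/\ uniq L', size L' <= (D - k).+1,
    forall y, ball y -> stage t y \in L' &
    forall l, l \in L' -> exists2 y, ball y & stage t y = l].
Proof.
move=> tD free k.
have sz y : ball y -> #|` (stage t y).1| = k.
  move=> By; have [aK at'] := asel_zone (proj1 By) tD.
  have := card_Sel By aK; rewrite -stage1.
  have -> : count (fun h => q h == asel t y) Hm = 0.
    apply/eqP; rewrite -leqn0 leqNgt -has_count; apply/hasPn => h hH.
    by apply: contra (free h hH) => /eqP; rewrite /zn => ->; apply/eqP.
  rewrite addn0 -eqn_leq => /eqP <-; apply: eq_in_count => h hH.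
  apply/idP/idP => [ah|].
    by rewrite ltn_neqAle eq_sym free // -at' leq_div2r // ltnW.
  by apply: contraTT; rewrite -!leqNgt => /(leq_div2r K); rewrite at'.
have [||L' [uL' szL L's L'y]] := @image_seq _ _ _ ball (stage t)
    (fun y => c (stage t y).1 (stage t y).2) (iota 0 (D - k).+1).
- move=> x y Bx By e; apply: stage_inj => //; [exact: (proj1 Bx)|exact: (proj1 By)|exact: ball_dist|].
  by rewrite /typ e !sz.
- move=> y By; rewrite mem_iota /= add0n ltnS -(sz y By).
  by have [_ _ _ + _] := stageP (proj1 By) tD.
by exists L'; split=> //; rewrite size_iota in szL.
Qed.

(* At some stage [t] no mark of [y0] has its depth in the range of the windows,
   so that [Sel] is constant on the ball. *)
Lemma stage_card : exists L : seq ({fset E} * {fset E}),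
  size L <= D /\ forall y, ball y -> stage D.-1 y \in L.
Proof.
have [Cy0 [h0 h0T]] := y0far.
have h0H : h0 \in Hm by apply: (fsubsetP (marks_leq _ _ _ _)) h0T.
have h0z : D <= zn h0.
  move: h0T; rewrite in_sep => /and3P[_ _ hT].
  by rewrite /zn /q !leq_divRL // (leq_trans hT) // leq_addr.
have szH : size Hm <= D by apply: (marks_card dfC N 0 Cy0).
have [t tD free] : exists2 t, t < D & forall h, h \in Hm -> zn h != t.
  apply: contrapT => nt.
  (* The value [D] is taken by [h0]; if no range were free, at most [D] marks would take [D.+1]
     values. *)
  have all t : t < D.+1 -> t \in [seq minn (zn h) D | h <- Hm].
    rewrite ltnS leq_eqVlt => /orP[/eqP->|tD].
      by apply/mapP; exists h0 => //; rewrite (minn_idPr h0z).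
    apply: contrapT => nin; apply: nt; exists t => // h hH; apply/eqP => e.
    by apply: nin; apply/mapP; exists h; rewrite // e; lia.
  have : size (iota 0 D.+1) <= size [seq minn (zn h) D | h <- Hm].
    by apply: uniq_leq_size (iota_uniq _ _) _ => t; rewrite mem_iota => /all.
  by rewrite size_iota size_map; lia.
pose m s := count (fun h => t < zn h <= s) Hm.
set k := count (fun h => t < zn h) Hm.
have kD : k <= D by rewrite (leq_trans (count_size _ _)).
have IH i : t + i < D -> exists L', [/\ uniq L',
    size L' <= (D - k).+1 + m (t + i),
    forall y, ball y -> stage (t + i) y \in L' &
    forall l, l \in L' -> exists2 y, ball y & stage (t + i) y = l].
  elim: i => [|i IH] tiD.
    rewrite addn0; have [L' [uL sL h1 h2]] := stage_free tD free.
    by exists L'; split=> //; rewrite (leq_trans sL) ?leq_addr.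
  rewrite addnS in tiD *; have [L [uL sL h1 h2]] := IH (ltnW tiD).
  have [L' [uL' sL' h1' h2']] := stage_step tiD uL sL h1 h2.
  exists L'; split=> //; rewrite (leq_trans sL') // -addnA leq_add2l.
  rewrite /m -count_predUI addnC.
  set c0 := count (predI _ _) _.
  have -> : c0 = 0.
    by apply/eqP; rewrite -leqn0 leqNgt -has_count; apply/hasPn => h _ /=; lia.
  by apply: sub_count => h /=; lia.
have [|L [uL sL h1 h2]] := IH (D.-1 - t); first by lia.
have e : t + (D.-1 - t) = D.-1 by lia.
rewrite e in sL h1 h2; exists L; split=> //; rewrite (leq_trans sL) //.
(* [h0] is counted in [k] but lies beyond range [D.-1], which saves the last label. *)
suff : m D.-1 < k by lia.
have h0k : 0 < count (fun h => D <= zn h) Hm.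
  by rewrite -has_count; apply/hasP; exists h0.
apply: leq_trans (_ : m D.-1 + count (fun h => D <= zn h) Hm <= _); first by lia.
rewrite /m -count_predUI addnC.
set c0 := count (predI _ _) _.
have -> : c0 = 0.
  by apply/eqP; rewrite -leqn0 leqNgt -has_count; apply/hasPn => h _ /=; lia.
by apply: sub_count => h /=; lia.
Qed.

End Count.
End Labels.

(** * Induction on the width *)

Definition downfam_col D r M :=
  forall (E : choiceType) (lt : rel E) (C : {fset E} -> Prop),
  downfam lt C D -> col (@sdist E) C D.+1 r M.

Lemma hgt_card (E : choiceType) (lt : rel E) C D x w : downfam lt C D -> C x -> hgt lt x <= w ->
  #|` x| <= D * w.
Proof.
move=> dfC Cx hw; have := level_card dfC 0 w Cx; apply: leq_trans.
apply: fsubset_leq_card; apply/fsubsetP => e ex; rewrite in_sep ex /= add0n.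
exact: leq_trans (ltn_hgt lt ex) hw.
Qed.

Lemma annulus_col D r w (MT : nat -> nat -> nat) : 0 < D ->
  (forall j s, j < D -> downfam_col j s (MT j s)) ->
  exists M, forall (E : choiceType) (lt : rel E) C a, downfam lt C D ->
    col (@sdist E) (fun x => C x /\ a <= hgt lt x < a + w) D r M.
Proof.
move=> D0 MTP; pose rad := D * r.
pose Tmax := D * (D.+1 * D.+1) * (D.+2 * (2 * rad).+1).
(* The recursion is on the residual width [D - k], since errors grow as the antichain shrinks. *)
pose fix e j := if j is i.+1 then D * Tmax + e i + MT i (2 * e i + 2 * rad) else 0.
have e_homo i j : i <= j -> e i <= e j.
  by elim: j => [|j IH]; rewrite leq_eqVlt => /orP[/eqP->//|//] /IH /= ij; lia.
pose ecc k := e (D - k); pose rho k := 2 * ecc k + 2 * rad.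
pose Bd k := MT (D - k) (rho k).
have eccP k' k : k' < k -> k <= D -> D * Tmax + ecc k + Bd k <= ecc k'.
  by move=> kk kD; apply: (e_homo (D - k).+1); lia.
have rhoP k : k <= D -> 2 * ecc k + 2 * rad <= rho k by [].
pose M0 := 2 * e D + 2 * (D * (D * (Tmax + w))).
exists (M0 + 2 * (D * r)) => E lt C a dfC.
(* Below [Tmax] there may be no deep marks, but the members have bounded size and one colour
   suffices. *)
have [aT|aT] := ltnP a Tmax.
  exists (fun _ => 0); split=> // i x y xy.
  have [<-|] := conn_ends xy; first by rewrite sdistxx.
  move=> [[[Cx /andP[_ hx]] _] [[Cy /andP[_ hy]] _]].
  have := hgt_card dfC Cx (ltnW hx); have := hgt_card dfC Cy (ltnW hy).
  have : D * (a + w) <= D * (D * (Tmax + w)) by rewrite leq_mul2l; apply/orP; right; nia.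
  have := fsubset_leq_card (fsubsetDl x y).
  have := fsubset_leq_card (fsubsetDl y x).
  by rewrite /sdist /M0; lia.
(* At this height every [x] of the layer has a mark of depth at least [Tmax], and no depth exceeds
   [D * (Tmax + w)]. *)
pose N := a - Tmax.
have /choice[ccl cclP] S : exists p : ({fset E} -> nat) * ({fset E} -> {fset E}),
    anti lt S -> 0 < #|` S| <= D ->
    cell_system lt C S (D - #|` S|).+1 (rho #|` S|) (Bd #|` S|) p.1 p.2.
  have [[aS /andP[S0 SD]]|nS] := pselect (anti lt S /\ 0 < #|` S| <= D); last first.
    by exists (fun=> 0, id) => aS S0; case: nS.
  have /cells[c [cl ccl]] : col (@sdist E) (fam_proj lt C S) (D - #|` S|).+1
      (rho #|` S|) (Bd #|` S|).
    by apply: MTP (downfam_proj dfC aS); lia.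
  by exists (c, cl).
pose c S := (ccl S).1; pose cl S := (ccl S).2.
have farP x : C x -> a <= hgt lt x -> far lt C D N rad x.
  move=> Cx ax; split=> //; apply: (marks_gt0 dfC) => //; first by rewrite !muln_gt0 D0.
  by rewrite -/Tmax /N subnK.
apply: (@col_labels _ _ (@sdist_metric E) _ _
          (stage lt D N rad c cl D.-1)) => [x [Cx /andP[ax _]]|].
  have [L [sL Lx]] := stage_card dfC D0 cclP eccP rhoP (farP _ Cx ax).
  exists [fset l in L]; first by rewrite card_fseq (leq_trans (size_undup _)).
  move=> y [Cy /andP[ay _]] xy; rewrite inE /=.
  by apply: Lx; split=> //; apply: farP.
move=> x y [Cx /andP[ax xw]] [Cy /andP[ay yw]].
have fx := farP _ Cx ax; have fy := farP _ Cy ay.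
have D1 : D.-1 < D by lia.
have := stageP dfC D0 cclP eccP fx D1; have := stageP dfC D0 cclP eccP fy D1.
have := stage1 lt D N rad c cl D.-1 x; have := stage1 lt D N rad c cl D.-1 y.
rewrite /stage_ok => e2 e1 + + e3; rewrite -e3 in e2 *.
case: (stage _ _ _ _ _ _ _ x) e1 e2 {e3} => S R /= e1 e2.
move=> [_ /andP[S0 SD] _ _ [z2 [Cz2 Sz2 cl2 _ pd2]]].
move=> [_ _ _ _ [z1 [Cz1 Sz1 cl1 _ pd1]]].
have Sx : S `<=` x by rewrite e1; apply: Sel_sub.
have Sy : S `<=` y by rewrite e2; apply: Sel_sub.
have aS : anti lt S by rewrite e1; apply: (Sel_anti dfC).
have dep z : C z -> S `<=` z -> hgt lt z < a + w ->
    (forall h, h \in S -> ht lt h = N) -> 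
    {in S, forall h, depth lt h z <= D * (Tmax + w)}.
  move=> Cz Sz zw SN h hS; apply: (depth_leq dfC Cz _ (SN h hS)).
    exact: (fsubsetP Sz).
  by rewrite /N; lia.
have SN h : h \in S -> ht lt h = N.
  by rewrite e1 in_sep => /and3P[_ /eqP].
apply: leq_trans (sdist_leq_pdist dfC Cx Cy Sx Sy (dep _ Cx Sx xw SN)
  (dep _ Cy Sy yw SN)) _.
apply: leq_add; last by rewrite leq_mul2l leq_mul2r SD !orbT.
have [_ cc _] := cclP _ aS (introT andP (conj S0 SD)).
have [_ _ pz1 _] := cc _ Cz1 Sz1; have [_ _ pz2 _] := cc _ Cz2 Sz2.
rewrite cl1 in pz1; rewrite cl2 in pz2.
have eD := eccP 0 _ S0 SD; rewrite /ecc subn0 in eD.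
have tri u v t : pdist lt S u t <= pdist lt S u v + pdist lt S v t by apply: sdistT.
have sym u v : pdist lt S u v = pdist lt S v u by apply: sdistC.
have := tri x z1 y; have := tri z1 R y; have := tri R z2 y.
rewrite (sym z2 y) (sym R z2) -/(ecc _) in pz2 *.
by rewrite /ecc in pd1 pd2; lia.
Qed.

Theorem downfam_colorable D r : exists M, downfam_col D r M.
Proof.
elim/ltn_ind: D r => -[|D] IH r.
  exists 0 => E lt C dfC; exists (fun=> 0); split=> // i x y xy.
  have C0 z : C z -> z = fset0.
    move=> Cz; apply/eqP; rewrite -cardfs_eq0 -leqn0.
    by have := hgt_card dfC Cz (leqnn _); rewrite mul0n.
  by have [<-|[[/C0-> _] [/C0-> _]]] := conn_ends xy; rewrite sdistxx.
have /choice[MT MTP] : forall p : nat * nat, exists M,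
    p.1 < D.+1 -> downfam_col p.1 p.2 M.
  move=> [j s]; have [jD|] := boolP (j < D.+1); last by exists 0.
  by have [M MP] := IH j jD s; exists M.
have /choice[Mf MfP] : forall s, exists M, forall E lt C a, @downfam E lt C D.+1 ->
    col (@sdist E) (fun x => C x /\ a <= hgt lt x < a + r.+1) D.+1 s M.
  move=> s; apply: (@annulus_col _ _ _ (fun j s => MT (j, s))) => //.
  by move=> j s' jD; apply: MTP (j, s') jD.
exists (union_bound (fun s => Mf (3 * s) + 2 * s) r D.+2) => E lt C dfC.
apply: (col_layers (sdist_metric E) (n := hgt lt)) => [x y|a s].
  exact: (hgt_lip dfC).
exact: MfP.
Qed.

(** * Median graphs *)

Section MedianMetric.
Variables (T : choiceType) (d : T -> T -> nat).
Implicit Types (a b m o p q w x y z : T).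

Definition btw x m y := d x y = d x m + d m y.

Hypothesis dP : pseudometric d.
Hypothesis d_eq0 : forall x y, d x y = 0 -> x = y.
Hypothesis d_geo : forall x y n, d x y = n.+1 -> exists z, d x z = n /\ d z y = 1.
Hypothesis d_med : forall x y z, exists m, [/\ btw x m y, btw x m z & btw y m z].
Hypothesis d_medU : forall x y z m n, btw x m y -> btw x m z -> btw y m z ->
  btw x n y -> btw x n z -> btw y n z -> m = n.

Let dxx x : d x x = 0. Proof. by case: dP. Qed.
Let dC x y : d x y = d y x. Proof. by case: dP. Qed.
Let dT x y z : d x z <= d x y + d y z. Proof. by case: dP. Qed.

(** The median of a lower bound [z] with [x] and [y] is also a median of [o], [x] and [y], hence
    equals [m]. *)
Lemma med_glb o x y m : btw o m x -> btw o m y -> btw x m y ->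
  forall z, btw o z x -> btw o z y -> btw o z m.
Proof.
rewrite /btw => mx my xy z zx zy.
have [p [zpx zpy xpy]] := d_med z x y; rewrite /btw in zpx zpy xpy.
have := dT o z p; have := dT o p x; have := dT o p y => t1 t2 t3.
suff -> : m = p by lia.
by apply: (@d_medU o x y); rewrite /btw //; lia.
Qed.

Variable o : T.
Local Notation nrm := (d o).
Definition mle x y := btw o x y.

Lemma mlexx x : mle x x. Proof. by rewrite /mle /btw dxx addn0. Qed.
Lemma mle0 x : mle o x. Proof. by rewrite /mle /btw dxx. Qed.

Lemma mle_trans x y z : mle x y -> mle y z -> mle x z.
Proof.
rewrite /mle /btw => xy yz.
have := dT x y z; have := dT o x z; lia.
Qed.

Lemma mle_eq x y : mle x y -> nrm x = nrm y -> x = y.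
Proof. by rewrite /mle /btw => xy e; apply: d_eq0; lia. Qed.

Lemma mle_norm x y : mle x y -> nrm x <= nrm y.
Proof. by rewrite /mle /btw; lia. Qed.

Lemma mle_anti x y : mle x y -> mle y x -> x = y.
Proof. by move=> xy yx; apply: mle_eq => //; have := mle_norm xy; have := mle_norm yx; lia. Qed.

Lemma meetP x y : exists m, [/\ mle m x, mle m y, btw x m y &
  forall z, mle z x -> mle z y -> mle z m].
Proof. by have [m [mx my xy]] := d_med o x y; exists m; split=> //; apply: med_glb. Qed.

(* In the interval [o, x] the order based at [x] is the reverse order. *)
Lemma joinP x a b : mle a x -> mle b x -> exists p, [/\ mle a p, mle b p, mle p x, btw a p b &
  forall c, mle a c -> mle b c -> mle c x -> mle p c].
Proof.
rewrite /mle /btw => ax bx; have [p [xa xb ab]] := d_med x a b.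
have g := med_glb xa xb ab.
have tr u : d o u + d u x = d o x -> forall v, d x u = d x v + d v u ->
    d o v = d o u + d u v /\ d o x = d o v + d v x.
  by move=> ux v; have := dT o u v; have := dT o v x; rewrite (dC x u) (dC x v) (dC v u); lia.
rewrite /btw in xa xb ab; exists p.
have [ap px] := tr a (esym ax) p xa; have [bp _] := tr b (esym bx) p xb.
split=> // c ac bc cx.
have xca : btw x c a.
  by rewrite /btw (dC x) (dC x c) (dC c a); have := dT a c x; have := dT o a x; lia.
have xcb : btw x c b.
  by rewrite /btw (dC x) (dC x c) (dC c b); have := dT b c x; have := dT o b x; lia.
have := g c xca xcb; rewrite /btw (dC x p) (dC x c) (dC c p).
have := dT o p c; lia.
Qed.

Definition lcover w x := mle w x /\ nrm x = (nrm w).+1.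

Lemma bipartite x y : d x y = 1 -> lcover x y \/ lcover y x.
Proof.
move=> xy; have [m [ox oy b]] := d_med o x y; rewrite /btw in ox oy b.
rewrite /lcover /mle /btw.
have [xm|xm] : d x m = 0 \/ d m y = 0 by lia.
  by left; have := d_eq0 xm => e; subst m; lia.
by right; have := d_eq0 xm => e; subst m; rewrite (dC y x) in ox *; lia.
Qed.

Lemma lcover_dist w x : lcover w x -> d w x = 1.
Proof. by case; rewrite /mle /btw; lia. Qed.

Lemma lcover_ex x y : mle x y -> x <> y -> exists2 z, mle x z & lcover z y.
Proof.
rewrite /mle /btw => xy nxy.
case e : (d x y) => [|n]; first by case: nxy; apply: d_eq0.
have [z [xz zy]] := d_geo e; exists z; rewrite /lcover /mle /btw.
  by have := dT o z y; have := dT o x z; lia.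
by have := dT o z y; have := dT o x z; lia.
Qed.

(* As [z] lies below [x] but not below [w], its distance to [w] is
   [d z x + 1]. *)
Lemma lcover_meet w x z : lcover w x -> mle z x -> ~ mle z w ->
  exists u, [/\ mle u w, lcover u z & forall t, mle t w -> mle t z -> mle t u].
Proof.
move=> wx zx zw; have [u [uw uz wuz g]] := meetP w z.
have wx1 := lcover_dist wx; case: wx => _ wx.
exists u; split=> //; split=> //; move: zw zx uw uz wuz.
rewrite /mle /btw => zw zx uw uz wuz.
have h : d z w = (d z x).+1.
  have := dT z w x; have := dT z x w; rewrite (dC x w) wx1 => t1 t2.
  have [m [wm xm b]] := d_med z w x; rewrite /btw wx1 in wm xm b.
  have [e|e] : d w m = 0 \/ d m x = 0 by lia.
    have em := d_eq0 e; subst m; case: zw.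
    by have := dT o z w; lia.
  by have em := d_eq0 e; subst m; rewrite (dC x w) in wm; lia.
by rewrite (dC z w) in h; rewrite (dC w u) in wuz; lia.
Qed.

(* The join-irreducible vertices, which correspond to the hyperplanes. *)
Definition ji j := exists2 w, lcover w j & forall w', lcover w' j -> w' = w.

Lemma ji_min w x j : lcover w x ->
  (ji j /\ mle j x /\ ~ mle j w) <->
  (mle j x /\ ~ mle j w /\ forall z, mle z j -> z <> j -> mle z w).
Proof.
move=> wx; split=> [[[u uj uU] [jx jw]]|[jx [jw jmin]]].
  split=> //; split=> // z zj /(lcover_ex zj)[v zv vj].
  have [u' [u'w u'j _]] := lcover_meet wx jx jw.
  by apply: mle_trans u'w; rewrite (uU _ u'j) -(uU _ vj).
split=> //; have [u [uw uj g]] := lcover_meet wx jx jw.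
exists u => // u' u'j; apply: mle_eq; last by case: uj; case: u'j; lia.
case: (u'j) => u'lj e; apply: g => //; apply: jmin => // e'.
by rewrite e' in e; lia.
Qed.

Lemma card_meet_join a b m p : mle m a -> mle m b -> btw a m b ->
  mle a p -> mle b p -> btw a p b -> nrm p + nrm m = nrm a + nrm b.
Proof.
rewrite /mle /btw (dC a m) (dC b p) => ma mb amb ap bp apb.
by lia.
Qed.

(* Both [p] and [q] would be medians of the three vertices. *)
Lemma K23_free x1 x2 x3 p q : x1 <> x2 -> x1 <> x3 -> x2 <> x3 ->
  lcover x1 p -> lcover x2 p -> lcover x3 p -> lcover q x1 -> lcover q x2 ->
  lcover q x3 -> False.
Proof.
move=> n12 n13 n23 c1 c2 c3 q1 q2 q3.
have two a b : a <> b -> lcover a p -> lcover b p -> lcover q a -> lcover q b ->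
    btw a p b /\ btw a q b.
  move=> nab cap cbp cqa cqb.
  have da := lcover_dist cap; have db := lcover_dist cbp.
  have dqa := lcover_dist cqa; have dqb := lcover_dist cqb.
  have ab := dT a q b; rewrite (dC a q) in ab.
  have ab0 : d a b <> 0 by move/d_eq0.
  have ab1 : d a b <> 1.
    by move/bipartite; case: cqa => _; case: cqb => _ ? ? [[]|[]]; lia.
  by rewrite /btw (dC p b) (dC a q); lia.
have [p12 q12] := two _ _ n12 c1 c2 q1 q2.
have [p13 q13] := two _ _ n13 c1 c3 q1 q3.
have [p23 q23] := two _ _ n23 c2 c3 q2 q3.
have e := d_medU p12 p13 p23 q12 q13 q23.
by case: c1 => _; case: q1 => _; rewrite e; lia.
Qed.

(** An edge crosses a single hyperplane. Otherwise let [w1] and [w2] be the meets of [w] with [j1]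
    and [j2]: the join of [w1] and [j2], the join of [j1] and [w2], and the meet of [w] with the
    join of [j1] and [j2] are three vertices that contradict [K23_free]. *)
Lemma ji_uniq w x j1 j2 : lcover w x -> ji j1 -> mle j1 x -> ~ mle j1 w ->
  ji j2 -> mle j2 x -> ~ mle j2 w -> j1 = j2.
Proof.
move=> wx J1 j1x j1w J2 j2x j2w; apply: contrapT => j12.
have m1 := (ji_min j1 wx).1 (conj J1 (conj j1x j1w)).
have m2 := (ji_min j2 wx).1 (conj J2 (conj j2x j2w)).
have {m1}[_ [_ m1]] := m1; have {m2}[_ [_ m2]] := m2.
have [w1 [w1w w1j g1]] := lcover_meet wx j1x j1w.
have [w2 [w2w w2j g2]] := lcover_meet wx j2x j2w.
have [m [mj1 mj2 bm gm]] := meetP j1 j2.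
have nm1 : m <> j1.
  by move=> e; apply: j1w; apply: m2; [rewrite -e|exact: j12].
have nm2 : m <> j2.
  by move=> e; apply: j2w; apply: m1; [rewrite -e|move=> e'; apply: j12].
have mw1 : mle m w1 by apply: g1 => //; apply: m1.
have mw2 : mle m w2 by apply: g2 => //; apply: m2.
have w1lj := w1j.1; have w2lj := w2j.1.
have w1x := mle_trans w1lj j1x; have w2x := mle_trans w2lj j2x.
(* All the joins below have the same underlying meet [m], so their norms can be computed. *)
have card a b p : mle m a -> mle m b -> mle a j1 -> mle b j2 ->
    mle a p -> mle b p -> btw a p b -> nrm p + nrm m = nrm a + nrm b.
  move=> ma mb aj bj ap bp apb; have [n [na nb anb gn]] := meetP a b.
  suff <- : n = m by apply: card_meet_join apb.
  by apply: mle_anti; [apply: gm; [exact: mle_trans aj|exact: mle_trans bj]|apply: gn].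
have [p [p1 p2 px pb gp]] := joinP j1x j2x.
have [s [s1 s2 sx sb gs]] := joinP w1x j2x.
have [s' [s'1 s'2 s'x s'b gs']] := joinP j1x w2x.
have [q [q1 q2 qx qb gq]] := joinP w1x w2x.
have qw : mle q w by apply: gq => //; exact: wx.1.
have pw : ~ mle p w by move/(mle_trans p1).
have [r [rw rp gr]] := lcover_meet wx px pw.
have cp := card _ _ _ mj1 mj2 (mlexx _) (mlexx _) p1 p2 pb.
have cs := card _ _ _ mw1 mj2 w1lj (mlexx _) s1 s2 sb.
have cs' := card _ _ _ mj1 mw2 (mlexx _) w2lj s'1 s'2 s'b.
have cq := card _ _ _ mw1 mw2 w1lj w2lj q1 q2 qb.
have [_ e1] := w1j; have [_ e2] := w2j; have [_ er] := rp.
have sp : mle s p by apply: gs => //; apply: mle_trans p1.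
have s'p : mle s' p by apply: gs' => //; apply: mle_trans p2.
have qs : mle q s by apply: gq => //; apply: mle_trans s2.
have qs' : mle q s' by apply: gq => //; apply: mle_trans s'1.
have qp := mle_trans qs sp; have qr : mle q r by apply: gr.
apply: (@K23_free r s s' p q) => //; try (by split=> //; lia).
- by move=> e; apply: j2w; apply: mle_trans rw; rewrite e.
- by move=> e; apply: j1w; apply: mle_trans rw; rewrite e.
- move=> e; have /mle_norm : mle p s by apply: gp => //; rewrite e.
  by lia.
Qed.

Lemma ji_ex w x : lcover w x -> exists j, [/\ ji j, mle j x & ~ mle j w].
Proof.
move=> wx; have nxw : ~ mle x w by move/mle_norm; case: wx => _; lia.
have : exists n, `[< exists z, [/\ mle z x, ~ mle z w & nrm z = n] >].
  by exists (nrm x); apply/asboolP; exists x; split=> //; apply: mlexx.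
move=> /ex_minnP[n /asboolP[j [jx jw jn]] nmin]; exists j.
suff /(ji_min j wx)[] : mle j x /\ ~ mle j w /\
  forall z, mle z j -> z <> j -> mle z w by [].
split=> //; split=> // z zj nzj; apply: contrapT => zw.
have : n <= nrm z.
  by apply: nmin; apply/asboolP; exists z; split=> //; apply: mle_trans jx.
rewrite -jn => jz; apply: nzj; apply: mle_eq => //.
by apply/eqP; rewrite eqn_leq jz (mle_norm zj).
Qed.

(** Along a geodesic from [o], each edge adds exactly one join-irreducible vertex. *)
Lemma ji_set x : exists s : {fset T}, #|` s| = nrm x /\
  forall j, j \in s <-> ji j /\ mle j x.
Proof.
case e : (d o x) => [|n].
  exists fset0; split=> [|j]; first by rewrite cardfs0.
  split=> // -[[w [_ jw] _] /mle_norm]; lia.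
elim: n x e => [|n IH] x e.
  all: have [z [zn zx]] := d_geo e.
  all: have zx' : lcover z x by case: (bipartite zx) => // -[_]; lia.
  all: have [j [jj jx jz]] := ji_ex zx'.
  have z0 := d_eq0 zn; exists [fset j]; split=> [|i]; first by rewrite cardfs1.
  rewrite inE; split=> [/eqP->//|[ii ix]]; apply/eqP.
  apply: (ji_uniq zx') => // iz; case: ii => w [_ iw] _.
  by have := mle_norm iz; rewrite zn iw.
have [s [sn sP]] := IH z zn; exists (j |` s); split=> [|i].
  rewrite cardfsU1 sn; case: (boolP (j \in s)) => [/sP[_ /jz//]|_]; lia.
rewrite !inE; split=> [/orP[/eqP->//|/sP[ii iz]]|[ii ix]].
  by split=> //; apply: mle_trans iz zx'.1.
have [iz|iz] := pselect (mle i z).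
  by apply/orP; right; apply/sP.
by rewrite (ji_uniq zx' ii ix iz jj jx jz) eqxx.
Qed.

(** * The isometry onto down-sets of join-irreducible vertices *)

Section JiSets.
Variable J : T -> {fset T}.
Hypothesis Jcard : forall x, #|` J x| = nrm x.
Hypothesis JP : forall x j, j \in J x <-> ji j /\ mle j x.

Definition jlt (j' j : T) := `[< [/\ ji j', ji j, mle j' j & j' <> j] >].

Lemma J_mono x y : mle x y -> J x `<=` J y.
Proof.
move=> xy; apply/fsubsetP => j /JP[jj jx]; apply/JP; split=> //.
exact: mle_trans xy.
Qed.

Lemma J_meet x y m : mle m x -> mle m y ->
  (forall z, mle z x -> mle z y -> mle z m) -> J m = J x `&` J y.
Proof.
move=> mx my g; apply/eqP; rewrite eqEfsubset fsubsetI !J_mono //=.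
apply/fsubsetP => j; rewrite inE => /andP[/JP[jj jx] /JP[_ jy]]; apply/JP.
by split=> //; apply: g.
Qed.

Lemma J_le x y : J x `<=` J y -> mle x y.
Proof.
move=> xy; have [m [mx my _ g]] := meetP x y.
have := J_meet mx my g; move/fsetIidPl: xy => -> e.
by rewrite -(mle_eq mx) // -!Jcard e.
Qed.

Lemma sdist_J x y : sdist (J x) (J y) = d x y.
Proof.
have [m [mx my b g]] := meetP x y.
rewrite /sdist !cardfsD [J y `&` _]fsetIC -(J_meet mx my g) !Jcard.
by move: mx my b; rewrite /mle /btw (dC x m); lia.
Qed.

Lemma J_ji w k : ji k -> lcover w k -> J w = J k `\ k.
Proof.
move=> kk wk; have kw : ~ mle k w by move/mle_norm; case: wk => _; lia.
apply/eqP; rewrite eqEfsubset; apply/andP; split; apply/fsubsetP => j.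
  move=> /JP[jj jw]; rewrite !inE; apply/andP; split.
    by apply/eqP => e; apply: kw; rewrite -e.
  by apply/JP; split=> //; apply: mle_trans jw wk.1.
rewrite !inE => /andP[/eqP jk /JP[jj jlk]]; apply/JP; split=> //.
apply: contrapT => jw; apply: jk.
exact: (ji_uniq wk jj jlk jw kk (mlexx k)).
Qed.

(** Removing a [k] of maximal norm leaves the set of some [u]. The meet of [u] and [k] is the lower
    cover of [k], so their join lies one edge above [u], and its set is [S]. *)
Lemma J_realize S x : S `<=` J x ->
  (forall e e', e \in S -> jlt e' e -> e' \in S) -> exists2 u, mle u x & J u = S.
Proof.
have [n] := ubnP #|` S|; elim: n S => // n IH S Sn Sx Sd; have [->|/fset0Pn[k0 k0S]] := eqVneq S fset0.
  exists o; first exact: mle0.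
  by apply/cardfs0_eq; rewrite Jcard dxx.
have [k kS kmax] : exists2 k, k \in S & forall e, e \in S -> nrm e <= nrm k.
  pose P n := `[< exists k, k \in S /\ nrm k = n >].
  have exP : exists n, P n by exists (nrm k0); apply/asboolP; exists k0.
  have Pb n' : P n' -> n' <= nrm x.
    by move=> /asboolP[k [kS <-]]; apply: mle_norm; have /JP[] := fsubsetP Sx _ kS.
  have [n' /asboolP[k [kS kn]] nmax] := ex_maxnP exP Pb; exists k => // e eS.
  by rewrite kn; apply: nmax; apply/asboolP; exists e.
have [kk kx] := (JP x k).1 (fsubsetP Sx _ kS).
have Sk : #|` S| = #|` S `\ k|.+1 by rewrite (cardfsD1 k) kS.
have [|||u ux Ju] := IH (S `\ k).
- by move: Sn; rewrite Sk; lia.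
- by apply: fsubset_trans Sx; apply: fsubD1set.
- move=> e e' + ee'; rewrite !inE => /andP[nek eS]; rewrite (Sd _ _ eS ee') andbT.
  move/asboolP: ee' => [_ _ e'e ne]; apply/eqP => e'k; subst e'.
  by apply: ne; apply: mle_eq => //; have := mle_norm e'e; have := kmax _ eS; lia.
have [w wk _] := kk; have Jw := J_ji kk wk.
have wu : mle w u.
  apply: J_le; rewrite Jw Ju; apply/fsubsetP => e; rewrite !inE => /andP[ek eJ].
  rewrite ek /=; apply: (Sd k) => //; apply/asboolP.
  by have [ej elk] := (JP k e).1 eJ; split=> //; apply/eqP.
have [m [mu mk bm gm]] := meetP u k.
have Jm : J m = J w.
  rewrite (J_meet mu mk gm) Jw Ju; apply/eqP; rewrite eqEfsubset; apply/andP; split.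
    by apply/fsubsetP => e; rewrite !inE => /andP[/andP[-> _] ->].
  by rewrite -Jw fsubsetI -Ju J_mono //= J_mono //; case: wk.
have [v [uv kv vx bv _]] := joinP ux kx.
exists v => //; have nv := card_meet_join mu mk bm uv kv bv.
have mw : nrm m = nrm w by rewrite -!Jcard Jm.
apply/eqP; rewrite eq_sym eqEfcard Jcard Sk -Ju Jcard; apply/andP; split.
  apply/fsubsetP => e eS; have [->|ek] := eqVneq e k; first by apply/JP.
  by apply: (fsubsetP (J_mono uv)); rewrite Ju !inE ek.
by case: wk => _; lia.
Qed.

Definition cube_embedding (q : {fset T}) := exists f : {fset T} -> T,
  forall B B', B `<=` q -> B' `<=` q -> d (f B) (f B') = sdist B B'.

Lemma jlt_irr : irreflexive jlt.
Proof. by move=> j; apply/asboolPn => -[_ _ _]. Qed.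

Lemma jlt_trans : transitive jlt.
Proof.
move=> j i k /asboolP[ii jj ij nij] /asboolP[_ kk jk njk].
apply/asboolP; split=> //; first exact: mle_trans jk.
by move=> e; subst k; apply: nij; apply: mle_anti.
Qed.

(** The join-irreducibles strictly below [q], together with any part of [q], form a down-set, hence
    come from a vertex. *)
Lemma J_antichain x (q : {fset T}) : q `<=` J x -> {in q &, forall e e', ~~ jlt e e'} ->
  cube_embedding q.
Proof.
move=> qx qa; pose S0 := [fset e in J x | has (fun a => jlt e a) q].
have S0q e : e \in S0 -> e \in q = false.
  rewrite in_sep => /andP[_ /hasP[a aq ea]]; apply/negP => eq.
  by move/negP: (qa _ _ eq aq).
have /choice[f fP] : forall B, exists u, B `<=` q -> J u = S0 `|` B.
  move=> B; have [Bq|] := boolP (B `<=` q); last by exists o.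
  have [|e e'|u _ Ju] := @J_realize (S0 `|` B) x; last by exists u.
    rewrite fsubUset (fsubset_trans Bq qx) andbT.
    by apply/fsubsetP => e; rewrite in_sep => /andP[].
  move=> eS ee'.
  have e'S a : a \in q -> jlt e' a -> e' \in S0 `|` B.
    move=> aq e'a; rewrite inE in_sep; apply/orP; left; apply/andP; split.
      move/asboolP: e'a => [e'e' aa e'la _]; apply/JP; split=> //.
      by apply: mle_trans e'la _; have /JP[] := fsubsetP qx _ aq.
    by apply/hasP; exists a.
  move: eS; rewrite inE => /orP[|eB]; last by apply: e'S ee'; apply: (fsubsetP Bq).
  rewrite in_sep => /andP[_ /hasP[a aq ea]]; apply: (e'S a) => //.
  exact: jlt_trans ea.
exists f => B B' Bq B'q; rewrite -sdist_J !fP //.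
have sub B1 B2 : B1 `<=` q -> (S0 `|` B1) `\` (S0 `|` B2) = B1 `\` B2.
  move=> B1q; apply/fsetP => e; rewrite !in_fsetD !in_fsetU.
  case: (boolP (e \in S0)) => //= eS; apply/esym/andP => -[_ /(fsubsetP B1q)].
  by rewrite S0q.
by rewrite /sdist !sub.
Qed.

Lemma J_downfam D : (forall q : {fset T}, cube_embedding q -> #|` q| <= D) ->
  downfam jlt (fun s => exists x, J x = s) D.
Proof.
move=> dimD; split.
- exact: jlt_irr.
- exact: jlt_trans.
- move=> s e e' [x <-] /JP[_ ex] /asboolP[e'e' _ e'e _]; apply/JP; split=> //.
  exact: mle_trans ex.
- by move=> s s' [x <-] s'x s'd; have [u _ Ju] := J_realize s'x s'd; exists u.
- by move=> s q [x <-] qx qa; apply/dimD/(J_antichain qx).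
Qed.

End JiSets.
Theorem median_downfam D : (forall q : {fset T}, cube_embedding q -> #|` q| <= D) ->
  exists (lt : rel T) (C : {fset T} -> Prop) (J : T -> {fset T}),
    [/\ downfam lt C D, forall x, C (J x) & forall x y, sdist (J x) (J y) = d x y].
Proof.
have /choice[J JP] := ji_set; move=> dimD.
have Jcard x : #|` J x| = nrm x by case: (JP x).
have {}JP x j : j \in J x <-> ji j /\ mle j x by case: (JP x).
exists jlt, (fun s => exists x, J x = s), J; split=> [|x|x y].
- exact: J_downfam.
- by exists x.
- exact: sdist_J.
Qed.

End MedianMetric.

Definition hamming_cube (T : Type) (d : T -> T -> nat) k :=
  exists f : {ffun 'I_k -> bool} -> T,
    forall v w, d (f v) (f w) = #|[pred i | v i != w i]|.

Lemma cube_embedding_hamming (T : choiceType) (d : T -> T -> nat) (q : {fset T}) :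
  cube_embedding d q -> hamming_cube d #|` q|.
Proof.
case=> f fP.
pose s := tnth (in_tuple (enum_fset q)); have s_inj : injective s.
  by apply/tuple_uniqP; apply: fset_uniq.
have sq i : s i \in q by apply: mem_tnth.
pose B (v : {ffun 'I_#|` q| -> bool}) := [fset s i | i : 'I_#|` q| & v i].
have inB v i : (s i \in B v) = v i.
  by rewrite (mem_imfset _ _ s_inj) inE.
have Bq v : B v `<=` q by apply/fsubsetP => x /imfsetP[i _ ->].
exists (f \o B) => v w; rewrite /= fP // /sdist.
have cardB v' w' : #|` B v' `\` B w'| = #|[pred i | v' i && ~~ w' i]|.
  have -> : B v' `\` B w' = [fset s i | i : 'I_#|` q| & v' i && ~~ w' i].
    apply/fsetP => x; rewrite in_fsetD; apply/andP/imfsetP => [[xw /imfsetP[i /= vi xi]]|].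
      by rewrite inE in vi; exists i => //; rewrite inE vi -inB -xi.
    by move=> [i /= /andP[vi wi] ->]; rewrite !inB.
  rewrite card_imfset //=.
  rewrite -(card_uniqP _) ?filter_uniq // -?enumT ?enum_uniq //.
  by apply: eq_card => i; rewrite mem_filter mem_enum !inE andbT.
rewrite !cardB -cardUI [X in _ + X]eq_card0 ?addn0.
  by apply: eq_card => i; rewrite !inE; case: (v i); case: (w i).
by move=> i; rewrite !inE; case: (v i); case: (w i).
Qed.

Record median_metric (T : choiceType) (d : T -> T -> nat) : Prop := MedianMetric {
  mm_dist : pseudometric d;
  mm_eq0 : forall x y, d x y = 0 -> x = y;
  mm_geo : forall x y n, d x y = n.+1 -> exists z, d x z = n /\ d z y = 1;
  mm_med : forall x y z, exists m, [/\ btw d x m y, btw d x m z & btw d y m z];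
  mm_medU : forall x y z m n, btw d x m y -> btw d x m z -> btw d y m z ->
    btw d x n y -> btw d x n z -> btw d y n z -> m = n }.

Theorem median_col D r : exists M,
  forall (T : choiceType) (d : T -> T -> nat) (o : T), median_metric d ->
  (forall k, hamming_cube d k -> k <= D) -> col d (fun=> True) D.+1 r M.
Proof.
have [M MP] := downfam_colorable D r; exists M.
move=> T d o [dP d0 dg dm dmU] dimD.
have [|lt [C [J [dfC JC Jd]]]] := median_downfam dP d0 dg dm dmU o (D := D).
  by move=> q /cube_embedding_hamming /dimD.
have [c [cD cM]] := MP _ _ _ dfC; exists (c \o J); split=> [x _|i x y xy].
  exact: cD.
rewrite -Jd; apply: (cM i); move: xy; elim=> [|u v _ uv [[_ cu] [_ cv] duv]]; first by left.
by right with (J u) => //; split=> //; rewrite Jd.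
Qed.

End Colorings.

Import Order.TTheory GRing.Theory Num.Theory.
Local Open Scope classical_set_scope.
Local Open Scope ring_scope.

(** * Graph metrics of components *)

Section GraphMetric.
Variables (T : choiceType) (G : set (T * T)).
Implicit Types (x y z : T) (V : set T).

Definition wlen x y n := exists2 p, walk G x y p & size p = n.

(** Between different components the value is [0] instead of infinity; symmetry, separation and the
    triangle inequality therefore assume a common component. *)
Definition gd x y : nat :=
  if pselect (exists n, `[< wlen x y n >]) is left exn then ex_minn exn else 0%N.

Lemma gdP x y : graph_eqrel G (x, y) -> wlen x y (gd x y).
Proof.
move=> [p xyp]; rewrite /gd; case: pselect => [exn|[]].
  by case: ex_minnP => n /asboolP.
by exists (size p); apply/asboolP; exists p.
Qed.

Lemma gd_leq x y n : wlen x y n -> (gd x y <= n)%N.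
Proof.
move=> xyn; rewrite /gd; case: pselect => // exn.
by case: ex_minnP => m _; apply; apply/asboolP.
Qed.

Lemma wlen_eqrel x y n : wlen x y n -> graph_eqrel G (x, y).
Proof. by case=> p xyp _; exists p. Qed.

Lemma graph_distE (R : realType) x y : graph_eqrel G (x, y) ->
  graph_dist R G x y = ((gd x y)%:R)%:E.
Proof.
move=> xy; apply/eqP; rewrite eq_le; apply/andP; split.
  by have [p pw ps] := gdP xy; apply: ereal_inf_lbound; exists p => //; rewrite ps.
apply: le_ereal_inf_tmp => _ [p pw <-]; rewrite lee_fin ler_nat.
by apply: gd_leq; exists p.
Qed.

Lemma graph_dist_pinfty (R : realType) x y : ~ graph_eqrel G (x, y) ->
  graph_dist R G x y = +oo%E.
Proof.
move=> nxy; rewrite /graph_dist (_ : [set _ | p in _] = set0) ?ereal_inf0 //.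
by rewrite -subset0 => ? [p pw _]; apply: nxy; exists p.
Qed.

Lemma wlen0 x y : wlen x y 0 <-> x = y.
Proof.
split=> [[p [_ <-] /size0nil->]|->] //.
by exists [::].
Qed.

Lemma wlenS x y n : wlen x y n.+1 <-> exists2 z, wlen x z n & G (z, y).
Proof.
split=> [[p]|[z [p [pp lp] <-] zy]].
  case/lastP: p => [[]|p z [+ <-]]; first by [].
  rewrite rcons_path last_rcons size_rcons => /andP[pp /set_mem pz] [<-].
  by exists (last x p) => //; exists p.
exists (rcons p y); last by rewrite size_rcons.
by split; [rewrite rcons_path pp lp; apply/mem_set|rewrite last_rcons].
Qed.

Lemma wlen_cat x y z m n : wlen x y m -> wlen y z n -> wlen x z (m + n).
Proof.
move=> [p [pp lp] <-] [q [qp lq] <-]; exists (p ++ q); last by rewrite size_cat.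
by split; rewrite ?cat_path ?last_cat lp ?pp.
Qed.

Hypothesis Gsym : forall x y, G (x, y) -> G (y, x).

Lemma wlen_sym x y n : wlen x y n -> wlen y x n.
Proof.
elim: n x y => [|n IH] x y; first by move=> /wlen0 ->; apply/wlen0.
move=> /wlenS[z xz /Gsym zy]; rewrite -add1n; apply: wlen_cat (IH _ _ xz).
by apply/wlenS; exists y => //; apply/wlen0.
Qed.

Lemma eqrel_refl x : graph_eqrel G (x, x).
Proof. by exists [::]. Qed.

Lemma eqrel_sym x y : graph_eqrel G (x, y) -> graph_eqrel G (y, x).
Proof. by move=> /gdP /wlen_sym /wlen_eqrel. Qed.

Lemma eqrel_trans x y z : graph_eqrel G (x, y) -> graph_eqrel G (y, z) ->
  graph_eqrel G (x, z).
Proof. by move=> /gdP xy /gdP yz; apply: wlen_eqrel (wlen_cat xy yz). Qed.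

Lemma gdxx x : gd x x = 0%N.
Proof. by apply/eqP; rewrite -leqn0; apply: gd_leq; apply/wlen0. Qed.

Lemma gdC x y : graph_eqrel G (x, y) -> gd x y = gd y x.
Proof.
move=> xy; apply/eqP; rewrite eqn_leq !gd_leq //; apply/wlen_sym/gdP => //.
exact: eqrel_sym.
Qed.

Lemma gdT x y z : graph_eqrel G (x, y) -> graph_eqrel G (y, z) ->
  (gd x z <= gd x y + gd y z)%N.
Proof. by move=> xy yz; apply/gd_leq/wlen_cat; apply: gdP. Qed.

Lemma gd_eq0 x y : graph_eqrel G (x, y) -> gd x y = 0%N -> x = y.
Proof. by move=> /gdP xy e; apply/wlen0; rewrite -e. Qed.

End GraphMetric.

Lemma walk_induced (T : choiceType) (G : set (T * T)) x y n :
  wlen (induced_subgraph G (graph_component G x)) x y n <-> wlen G x y n.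
Proof.
elim: n y => [|n IH] y; first by rewrite !wlen0.
rewrite !wlenS; split=> [[z /IH xz [zy _]]|[z xz zy]]; first by exists z.
exists z; first exact/IH.
split=> //; split; first exact: wlen_eqrel xz.
by apply: (@wlen_eqrel _ _ _ _ n.+1); apply/wlenS; exists z.
Qed.

Lemma cube_hamming (T : choiceType) (V : set T) (G : set (T * T)) k
    (f : {ffun 'I_k -> bool} -> T) : injective f -> (forall v, V (f v)) ->
  (forall v w, G (f v, f w) <-> #|[pred i | v i != w i]| = 1%N) -> cube V G f.
Proof.
elim: k f => [|[|[|k]] IH] f f_inj fV fG.
- exact: Cube0.
- apply: Cube1; apply/fG; rewrite -[RHS](card_ord 1); apply: eq_card => i.
  by rewrite !inE !ffunE.
- exact: Cube2.
- apply: CubeS => // i b; apply: IH => [v w /f_inj vw|v|v w]; first 2 last.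
  + rewrite /= fG -!sum1_card !(big_mkcond (fun _ => _ \in _)) /= (bigD1_ord i) //=.
    rewrite !inE !ffunE unlift_none eqxx add0n.
    suff -> : (\sum_(j < k.+2)
       (if lift i j \in [pred j | facet i b v j != facet i b w j] then 1 else 0) =
       \sum_(j < k.+2) (if j \in [pred j | v j != w j] then 1 else 0))%N by [].
    by apply: eq_bigr => j _; rewrite !inE !ffunE liftK.
  + apply/ffunP => j; have := congr1 (fun u : {ffun _} => u (lift i j)) vw.
    by rewrite /facet !ffunE liftK.
  + exact: fV.
Qed.

Section Component.
Variables (R : realType) (T : choiceType) (G : set (T * T)) (x0 : T).
Hypothesis GP : is_graph G.
Let V := graph_component G x0.
Let GV := induced_subgraph G V.
Hypothesis medG : median_graph R V GV.

Let Gsym : forall x y, G (x, y) -> G (y, x). Proof. by case: GP. Qed.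

Let Vrel x y : V x -> V y -> graph_eqrel G (x, y).
Proof. by move=> Vx Vy; apply: eqrel_trans Vy; apply: eqrel_sym. Qed.

Let gdV x y : V x -> gd GV x y = gd G x y.
Proof.
move=> Vx; have VE : V = graph_component G x.
  rewrite eqEsubset; split=> z; first exact: Vrel.
  by move=> xz; apply: eqrel_trans xz.
have wE : wlen GV x y = wlen G x y.
  by apply/funext => n; apply/propext; rewrite /GV VE; apply: walk_induced.
by rewrite /gd wE.
Qed.

Let distV x y : V x -> V y -> graph_dist R GV x y = ((gd G x y)%:R)%:E.
Proof.
move=> Vx Vy; have [_ _ con _] := medG.
by rewrite graph_distE ?gdV //; apply: con.
Qed.

Let btwE x y z : V x -> V y -> V z ->
  (graph_dist R GV x z = graph_dist R GV x y + graph_dist R GV y z)%E <->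
  btw (gd G) x y z.
Proof.
move=> Vx Vy Vz; rewrite !distV // -EFinD -natrD /btw.
by split=> [[/eqP]|->//]; rewrite eqr_nat => /eqP.
Qed.

Lemma component_col D (D_dim : (cube_dim R V GV <= (D%:R)%:E)%E) r M :
  (forall (T : choiceType) (d : T -> T -> nat) (o : T), median_metric d ->
     (forall k, hamming_cube d k -> k <= D)%N -> col d (fun=> True) D.+1 r M) ->
  col (gd G) V D.+1 r M.
Proof.
move=> colD; pose T' := {y | y \in V}.
have V' (u : T') : V (val u) by apply/set_mem/(valP u).
pose d (u v : T') := gd G (val u) (val v).
have Vx0 : x0 \in V by apply/mem_set/eqrel_refl.
have dM : median_metric d.
  split.
  - split=> [u|u v|u v w]; first exact: gdxx.
      by apply: gdC => //; apply: Vrel.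
    by apply: gdT; apply: Vrel.
  - by move=> u v /gd_eq0 uv; apply/val_inj/uv/Vrel.
  - move=> u v n uv; have := gdP (Vrel (V' u) (V' v)); rewrite -/(d u v) uv.
    move=> /wlenS[z uz zv]; have Vz : z \in V.
      by apply/mem_set/eqrel_trans/(wlen_eqrel uz)/(V' u).
    exists (exist _ z Vz); have zv1 : wlen G z (val v) 1.
      by apply/wlenS; exists z => //; apply/wlen0.
    have h1 := gd_leq uz; have h2 := gd_leq zv1.
    have := gdT (wlen_eqrel uz) (wlen_eqrel zv1).
    rewrite -/(d u v) uv /d /= in h1 h2 *.
    by move: h1 h2; case: (gd G z _) => [|[|]] //; case: (gd G _ z); lia.
  - move=> u v w; have [_ _ _ /(_ _ _ _ (V' u) (V' v) (V' w))] := medG.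
    move=> [m [[Vm uv uw vw] _]]; exists (exist _ m (mem_set Vm)).
    by split; [exact: (btwE (V' u) Vm (V' v)).1|exact: (btwE (V' u) Vm (V' w)).1|
      exact: (btwE (V' v) Vm (V' w)).1].
  - move=> u v w m n; have [_ _ _ /(_ _ _ _ (V' u) (V' v) (V' w))] := medG.
    move=> [p [_ pU]] h1 h2 h3 h4 h5 h6; apply: val_inj.
    have E a b c : btw d a b c -> graph_dist R GV (val a) (val c) =
        (graph_dist R GV (val a) (val b) + graph_dist R GV (val b) (val c))%E.
      by move=> abc; apply: (btwE (V' a) (V' b) (V' c)).2.
    by apply: etrans (esym (pU _ _)) (pU _ _); split; rewrite -?E.
have [|c [cD cM]] := colD _ d (exist _ x0 Vx0) dM.
  move=> k [f fP]; rewrite -(ler_nat R) -lee_fin; apply: le_trans D_dim.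
  apply: ereal_sup_ubound; exists k => //; exists (val \o f).
  apply: cube_hamming => [v w /val_inj vw|v|v w]; last first.
  + rewrite -fP /d; split=> [[/= vw _]|].
      have h : wlen G (val (f v)) (val (f w)) 1.
        by apply/wlenS; exists (val (f v)) => //; apply/wlen0.
      have := gd_leq h; case: (gd G _ _) (gdP (wlen_eqrel h)) => [/wlen0 e|[]//].
      by case: GP => irr _; case: (irr (val (f v))); rewrite {2}e.
    move=> e; have := gdP (Vrel (V' (f v)) (V' (f w))); rewrite e.
    by move=> /wlenS[z /wlen0 <- vw]; split=> //; split; apply: V'.
  + exact: V'.
  + apply/ffunP => i; apply/eqP; rewrite -[_ == _]negbK; apply/negP => vi.
    have : #|[pred i | v i != w i]| = 0 by rewrite -fP vw /d gdxx.
    by move=> /card0_eq/(_ i); rewrite inE vi.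
exists (fun x => oapp c 0%N (insub x)).
have cE x (xV : x \in V) : oapp c 0%N (insub x) = c (exist _ x xV).
  by rewrite (insubT (fun x => x \in V) xV).
split=> [x Vx|i x y xy]; first by rewrite (cE _ (mem_set Vx)); apply: cD.
have [<-|[[Vx _] [Vy _]]] := conn_ends xy; first by rewrite gdxx.
suff [yV cxy] : exists yV : y \in V, conn (step d (fun u => True /\ c u = i) r)
    (exist _ x (mem_set Vx)) (exist _ y yV) by apply: (cM i _ _ cxy).
elim: xy => [|u v _ [uV cu] [[Vu cui] [Vv cvi] duv]]; first by exists (mem_set Vx); left.
have vV := mem_set Vv; exists vV; right with (exist _ u uV) => //.
by split=> //; rewrite -cE.
Qed.

End Component.

Lemma median_graph_col (R : realType) D r : exists M : nat,
  forall (T : choiceType) (G : set (T * T)) x0, is_graph G ->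
  let V := graph_component G x0 in
  median_graph R V (induced_subgraph G V) ->
  (cube_dim R V (induced_subgraph G V) <= (D%:R)%:E)%E ->
  col (gd G) V D.+1 r M.
Proof.
have [M MP] := median_col D r; exists M => T G x0 GP V medG dimG.
exact: (component_col GP medG dimG).
Qed.

(** * Partial transversals of smooth equivalence relations *)

Section BorelStructure.
Local Open Scope nat_scope.

Section MeasurableFormulas.
Context d (X : measurableType d).
Implicit Types A B : set X.

Lemma meas_ex (K : countType) (A : K -> set X) :
  (forall k, measurable (A k)) -> measurable [set x | exists k, A k x].
Proof.
move=> mA; rewrite (_ : [set _ | _] = \bigcup_k A k).
  exact: countable_bigcupT_measurable.
by apply/seteqP; split=> x [k]; exists k.
Qed.

Lemma meas_not A : measurable A -> measurable [set x | ~ A x].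
Proof. exact: measurableC. Qed.

Lemma meas_and A B : measurable A -> measurable B -> measurable [set x | A x /\ B x].
Proof. exact: measurableI. Qed.

Lemma meas_all (K : countType) (A : K -> set X) :
  (forall k, measurable (A k)) -> measurable [set x | forall k, A k x].
Proof.
move=> mA; rewrite (_ : [set _ | _] = [set x | ~ exists k, ~ A k x]).
  by apply/meas_not/meas_ex => k; apply: meas_not.
apply/seteqP; split=> x /= Ax; first by case=> k; apply.
by move=> k; apply: contrapT => nA; apply: Ax; exists k.
Qed.

Lemma meas_prop (P : Prop) : measurable [set x : X | P].
Proof.
have [p|np] := pselect P.
  by rewrite (_ : [set _ | _] = setT) //; apply/seteqP; split.
by rewrite (_ : [set _ | _] = set0) //; apply/seteqP; split.
Qed.

Lemma meas_imp (P : Prop) A : (P -> measurable A) -> measurable [set x | P -> A x].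
Proof.
move=> PA; have [p|np] := pselect P.
  by rewrite (_ : [set _ | _] = A); [exact: PA|apply/seteqP; split=> x //=; exact].
by rewrite (_ : [set _ | _] = setT) //; apply/seteqP; split=> // x _ /np.
Qed.

Lemma meas_Imp A B : measurable A -> measurable B -> measurable [set x | A x -> B x].
Proof.
move=> mA mB; rewrite (_ : [set _ | _] = [set x | ~ (A x /\ ~ B x)]).
  by apply/meas_not/meas_and => //; apply: meas_not.
by apply/seteqP; split=> x /= H; [case=> /H|move=> Ax; apply: contrapT => Bx; exact: H].
Qed.

Lemma meas_iff A B : measurable A -> measurable B -> measurable [set x | A x <-> B x].
Proof. by move=> mA mB; apply: meas_and; apply: meas_Imp. Qed.

End MeasurableFormulas.

(** * Closed codes in Baire space *)

Section Codes.
Context d (X : measurableType d).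

(** A Borel injection into Baire space with closed image. *)
Record code (e : X -> nat -> nat) : Prop := Code {
  code_meas : forall n i, measurable [set x | e x n = i];
  code_inj : forall x y, (forall n, e x n = e y n) -> x = y;
  code_closed : forall a, (forall n, exists x, forall i, i < n -> e x i = a i) ->
    exists x, forall i, e x i = a i }.

Definition decides (e : X -> nat -> nat) (A : set X) :=
  exists j, forall x y, e x j = e y j -> A x -> A y.

(** The counterpart of refining a Polish topology to a zero-dimensional one in which countably many
    given Borel sets are clopen. *)
Definition codable := forall A : nat -> set X, (forall k, measurable (A k)) ->
  exists2 e, code e & forall k, decides e (A k).

Lemma codable_count (K : countType) (A : K -> set X) : codable ->
  (forall k, measurable (A k)) -> exists2 e, code e & forall k, decides e (A k).
Proof.
move=> cX mA; pose A' n := if unpickle n is Some k then A k else set0.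
have [|e ce eA] := cX A'; first by move=> n; rewrite /A'; case: unpickle.
by exists e => // k; have := eA (pickle k); rewrite /A' pickleK.
Qed.

Definition cyl (e : X -> nat -> nat) (s : seq nat) : set X :=
  [set x | forall i, i < size s -> e x i = nth 0 s i].

Lemma cyl_meas e s : code e -> measurable (cyl e s).
Proof. by move=> ce; apply: meas_all => i; apply: meas_imp => _; apply: code_meas. Qed.

Lemma cyl_rcons e s n x : cyl e (rcons s n) x <-> cyl e s x /\ e x (size s) = n.
Proof.
rewrite /cyl /= size_rcons; split=> [h|[h1 h2] i].
  split=> [i si|]; first by rewrite h ?nth_rcons ?si // ltnS ltnW.
  by rewrite h // nth_rcons ltnn eqxx.
by rewrite ltnS leq_eqVlt nth_rcons => /orP[/eqP->|si]; [rewrite ltnn eqxx|rewrite si h1].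
Qed.

Lemma cyl_mkseq e a n x : cyl e (mkseq a n) x <-> forall i, i < n -> e x i = a i.
Proof.
rewrite /cyl /= size_mkseq; split=> h i si; first by rewrite h // nth_mkseq.
by rewrite nth_mkseq // h.
Qed.

End Codes.

Section Smooth.
Context d (X : measurableType d).
Hypothesis cX : codable X.
Variable W : nat -> set X.
Hypothesis mW : forall k, measurable (W k).
Implicit Types (x y : X) (A B M : set X).

Definition ker x y := forall k, W k x <-> W k y.

Lemma ker_refl x : ker x x. Proof. by []. Qed.
Lemma ker_sym x y : ker x y -> ker y x.
Proof. by move=> xy k; split=> /xy. Qed.
Lemma ker_trans x y z : ker x y -> ker y z -> ker x z.
Proof. by move=> xy yz k; split=> [/xy/yz|/yz/xy]. Qed.

Definition inv B := measurable B /\ forall x y, ker x y -> B x -> B y.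

Lemma inv_ex (K : countType) (B : K -> set X) : (forall k, inv (B k)) ->
  inv [set x | exists k, B k x].
Proof.
move=> iB; split; first by apply: meas_ex => k; case: (iB k).
by move=> x y xy [k Bx]; exists k; apply: (iB k).2 xy Bx.
Qed.

Lemma inv_all (K : countType) (B : K -> set X) : (forall k, inv (B k)) ->
  inv [set x | forall k, B k x].
Proof.
move=> iB; split; first by apply: meas_all => k; case: (iB k).
by move=> x y xy Bx k; apply: (iB k).2 xy (Bx k).
Qed.

Lemma inv_imp (P : Prop) B : (P -> inv B) -> inv [set x | P -> B x].
Proof.
move=> iB; split; first by apply: meas_imp => /iB[].
by move=> x y xy Bx p; apply: (iB p).2 xy (Bx p).
Qed.

Lemma inv_prop (P : Prop) : inv [set x | P].
Proof. by split=> //; apply: meas_prop. Qed.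

Lemma inv_and A B : inv A -> inv B -> inv [set x | A x /\ B x].
Proof.
move=> [mA iA] [mB iB]; split; first exact: meas_and.
by move=> x y xy [/(iA _ _ xy) ? /(iB _ _ xy)].
Qed.

Lemma inv_iff k (p : Prop) : inv [set x | W k x <-> p].
Proof.
split; first by apply: meas_iff => //; apply: meas_prop.
by move=> x y /(_ k) [xy yx] [Wp pW]; split=> [/yx/Wp|/pW/xy].
Qed.

(** * Separation by invariant Borel sets *)

Section Separation.
Variable I : finType.
Implicit Types P : I -> set X.

Definition sep P := exists B : I -> set X,
  [/\ forall i, inv (B i), forall i, P i `<=` B i & forall x, exists i, ~ B i x].

Lemma sep_mono P P' : (forall i, P' i `<=` P i) -> sep P -> sep P'.
Proof.
by move=> PP [B [iB PB Bn]]; exists B; split=> // i x /PP/PB.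
Qed.

Lemma sep_split1 P i0 (Q : nat -> set X) : (forall x, exists n, Q n x) ->
  (forall n, sep (fun i x => P i x /\ (i = i0 -> Q n x))) -> sep P.
Proof.
move=> Qc /choice[B BP].
exists (fun i x => if i == i0 then exists n, B n i x else forall n, B n i x); split.
- by move=> i; case: (i == i0); [apply: inv_ex|apply: inv_all] => n; case: (BP n).
- move=> i x Px; case: eqP => [ii|ni].
    by have [n Qx] := Qc x; exists n; case: (BP n) => _ + _; apply.
  by move=> n; case: (BP n) => _ + _; apply.
- move=> x; have [[n Bn]|nB] := pselect (exists n, B n i0 x); last first.
    by exists i0; rewrite eqxx.
  have [_ _ /(_ x)[i ni]] := BP n; exists i; case: eqP => [e|_]; last exact.
  by case: ni; rewrite e.
Qed.

Lemma sep_split P (Q : I -> nat -> set X) : (forall i x, exists n, Q i n x) ->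
  ~ sep P -> exists c : I -> nat, ~ sep (fun i => P i `&` Q i (c i)).
Proof.
move=> Qc nP.
suff [c nc] : exists c : I -> nat,
    ~ sep (fun i x => P i x /\ (i \in enum I -> Q i (c i) x)).
  exists c; apply: contra_not nc; apply: sep_mono => i x [Px Qx]; split=> //.
  by apply: Qx; rewrite mem_enum.
elim: (enum I) => [|i0 s [c nc]].
  by exists (fun=> 0); apply: contra_not nP; apply: sep_mono => i x Px; split.
have [n nn] : exists n, ~ sep (fun i x => (P i x /\ (i \in s -> Q i (c i) x)) /\
    (i = i0 -> Q i0 n x)).
  by apply/existsNP; apply: contra_not nc; apply: sep_split1.
have [i0s|i0s] := boolP (i0 \in s).
  exists c; apply: contra_not nc; apply: sep_mono => i x [Px Qx]; split=> //.
  by rewrite inE => /orP[/eqP ii|]; [apply: Qx; rewrite ii|exact: Qx].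
exists (fun i => if i == i0 then n else c i); apply: contra_not nn.
apply: sep_mono => i x [[Px Qx] Qn]; split=> //; rewrite inE.
by case: eqP => [ii _|_ /=]; [rewrite {1}ii; exact: Qn|exact: Qx].
Qed.

(** Novikov's generalized separation theorem, for the saturations of the [M i]. An inseparable
    family stays inseparable on ever smaller cylinders, which shrink to points [y i] of [M i]; some
    [W k] distinguishes two of these points and thereby separates the cylinders at a finite
    stage. *)
Theorem novikov (M : I -> set X) : (forall i, measurable (M i)) ->
  (forall x, exists i, forall y, M i y -> ~ ker x y) -> sep M.
Proof.
move=> mM nM.
pose A (k : nat + I) := match k with inl k => W k | inr i => M i end.
have mA z : measurable (A z) by case: z => [k|i]; [exact: mW|exact: mM].
have [e ce eA] := codable_count cX mA.
pose MN (u : I -> seq nat) i := M i `&` cyl e (u i).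
have /choice[F FP] (u : I -> seq nat) : exists c : I -> nat,
    ~ sep (MN u) -> ~ sep (MN (fun i => rcons (u i) (c i))).
  have [|nsp] := pselect (sep (MN u)); first by exists (fun=> 0).
  have [|c nc] := @sep_split (MN u) (fun i n => [set x | e x (size (u i)) = n]) _ nsp.
    by move=> i x; exists (e x (size (u i))).
  exists c => _; apply: contra_not nc; apply: sep_mono => i x [[Mx sx] ex].
  by split=> //; apply/cyl_rcons.
apply: contrapT => nsep.
pose u n := iter n (fun u i => rcons (u i) (F u i)) (fun=> [::]).
pose a i n := F (u n) i.
have uE n i : u n i = mkseq (a i) n.
  elim: n => [//|n IH]; rewrite mkseqS -IH.
  by [].
have nu n : ~ sep (MN (u n)).
  elim: n => [|n IH]; last exact: FP.
  by apply: contra_not nsep; apply: sep_mono => i x Mx; split.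
have ne n i : exists2 x, M i x & forall j, j < n -> e x j = a i j.
  apply: contrapT => nx; apply: (nu n).
  exists (fun j x => j <> i); split=> [j|j x [Mx]|x]; first exact: inv_prop.
    by rewrite uE => /cyl_mkseq ex ji; apply: nx; exists x; rewrite -ji.
  by exists i; apply.
have /choice[y yP] i : exists y, M i y /\ forall j, e y j = a i j.
  have [|y ey] := code_closed ce (a := a i); first by move=> n; have [x _ ex] := ne n i; exists x.
  have [j jM] := eA (inr i); exists y; split=> //.
  by have [x Mx ex] := ne j.+1 i; apply: jM Mx; rewrite ex ?ey.
have [i0 _] : exists i0 : I, True.
  by apply: contrapT => nI; case: (nM (point : X)) => i; case: nI; exists i.
have [i1 i1P] := nM (y i0).
have /existsNP[k nk] := i1P _ (yP i1).1.
have [j jW] := eA (inl k).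
have WE i x : MN (u j.+1) i x -> W k x <-> W k (y i).
  move=> [_]; rewrite uE => /cyl_mkseq ex.
  by split; apply: jW; rewrite ex // (yP i).2.
apply: (nu j.+1); exists (fun i x => (i = i0 -> W k x <-> W k (y i0)) /\
  (i = i1 -> W k x <-> W k (y i1))); split.
- by move=> i; apply: inv_and; apply: inv_imp => _; apply: inv_iff; split.
- by move=> i x Mx; split=> ii; subst i; apply: WE.
- move=> x; have [Wx|Wx] := pselect (W k x <-> W k (y i0)).
    exists i1 => -[_ /(_ erefl) Wx']; apply: nk.
    by split=> [/Wx/Wx'|/Wx'/Wx].
  by exists i0 => -[/(_ erefl)].
Qed.

End Separation.

Lemma separate A B : measurable A -> measurable B ->
  (forall x y, A x -> B y -> ~ ker x y) ->
  exists2 C, inv C & A `<=` C /\ forall x, B x -> ~ C x.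
Proof.
move=> mA mB AB; pose M b := if b then A else B.
have [[]//|x|C [iC MC nC]] := @novikov bool M.
  have [[y Ay xy]|nA] := pselect (exists2 y, A y & ker x y).
    by exists false => z Bz xz; apply: (AB y z) => //; apply: ker_trans xz; apply: ker_sym.
  by exists true => y Ay xy; apply: nA; exists y.
exists (C true) => //; split=> [|x Bx Cx]; first exact: (MC true).
by have [[]] := nC x; apply => //; apply: (MC false).
Qed.

Definition indep A := forall x y, A x -> A y -> ker x y -> x = y.

Definition conf (s t : seq nat) :=
  exists i, [/\ i < size s, i < size t & nth 0 s i <> nth 0 t i].

Lemma conf_sym s t : conf s t -> conf t s.
Proof. by move=> [i [si ti n]]; exists i; split=> // e; apply: n. Qed.

Lemma cyl_conf e s t x y : conf s t -> cyl e s x -> cyl e t y -> x <> y.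
Proof. by move=> [i [si ti n]] sx ty xy; apply: n; rewrite -sx // xy ty. Qed.

(* The Lusin-Souslin theorem, for the saturation of a partial transversal. *)
Theorem sat_indep A : measurable A -> indep A ->
  measurable [set x | exists2 y, A y & ker x y].
Proof.
move=> mA iA; pose F (k : option nat) := if k is Some k then W k else A.
have mF k : measurable (F k) by case: k.
have [e ce eF] := codable_count cX mF.
pose As s := A `&` cyl e s.
have mAs s : measurable (As s) by apply: measurableI => //; apply: cyl_meas.
have /choice[C CP] (st : seq nat * seq nat) : exists C, conf st.1 st.2 ->
    [/\ inv C, As st.1 `<=` C & forall x, As st.2 x -> ~ C x].
  have [cst|ncst] := pselect (conf st.1 st.2); last by exists set0.
  have [|C iC [AC nC]] := separate (mAs st.1) (mAs st.2); last by exists C.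
  by move=> x y [Ax sx] [Ay ty] xy; apply: (cyl_conf cst sx ty); apply: iA.
(* [B s] contains the saturation of [As s]. Conflicting strings have disjoint sets [B s], so the
   strings at a point form one branch; the conditions on [W k] make the limit of the branch
   equivalent to the point, and contradict each other if [As s] is empty. *)
pose B s : set X := [set x | [/\ forall t, conf s t -> C (s, t) x /\ ~ C (t, s) x,
  forall k, As s `<=` W k -> W k x & forall k, As s `<=` ~` W k -> ~ W k x]].
have mB s : measurable (B s).
  rewrite (_ : B s = [set x | (forall t, conf s t -> C (s, t) x /\ ~ C (t, s) x) /\
    ((forall k, As s `<=` W k -> W k x) /\ (forall k, As s `<=` ~` W k -> ~ W k x))]).
    apply: meas_and; last apply: meas_and.
    - apply: meas_all => t; apply: meas_imp => st; apply: meas_and.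
        by have [[]] := CP (s, t) st.
      by apply: meas_not; have [[]] := CP (t, s) (conf_sym st).
    - by apply: meas_all => k; apply: meas_imp.
    - by apply: meas_all => k; apply: meas_imp => _; apply: meas_not.
  by apply/seteqP; split=> x; [case|case=> ? []].
rewrite (_ : [set _ | _] = [set x | forall n, exists s, size s = n /\ B s x]).
  apply: meas_all => n; apply: meas_ex => s; apply: meas_and => //.
  exact: meas_prop.
apply/seteqP; split=> x.
  move=> [y Ay xy] n; exists (mkseq (e y) n); split; first by rewrite size_mkseq.
  have yA : As (mkseq (e y) n) y by split=> //; apply/cyl_mkseq.
  split=> [t st|k kW|k kW].
  - have [iC AC _] := CP (_, t) st; have [iC' _ nC'] := CP (t, _) (conf_sym st).
    split; first by apply: iC.2 (ker_sym xy) _; apply: AC.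
    by move=> /(iC'.2 _ _ xy); apply: nC'.
  - by apply/(xy k)/kW.
  - by move/(xy k); apply: kW.
move=> /choice[s sB].
have ncs m n : ~ conf (s m) (s n).
  move=> mn; have [c1 _ _] := (sB m).2; have [c2 _ _] := (sB n).2.
  by case: (c2 _ (conf_sym mn)) => _; apply; case: (c1 _ mn).
pose a n := nth 0 (s n.+1) n.
have sa n : s n = mkseq a n.
  apply: (@eq_from_nth _ 0); rewrite (sB n).1 ?size_mkseq // => i iN.
  rewrite nth_mkseq // /a; apply: contrapT => ne; apply: (ncs n i.+1).
  by exists i; rewrite !(sB _).1.
have ne n : exists2 y, As (s n) y & True.
  apply: contrapT => nA; have [_ /(_ 0) W1 /(_ 0) W2] := (sB n).2.
  by apply: W2; [|apply: W1] => y Ay; case: nA; exists y.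
have [|y ey] := code_closed ce (a := a).
  by move=> n; have [y [_ ys] _] := ne n; exists y; apply/cyl_mkseq; rewrite -sa.
have dec k j : (forall u v, e u j = e v j -> F k u -> F k v) ->
    forall u, As (s j.+1) u -> F k u <-> F k y.
  move=> jF u [_]; rewrite sa => /cyl_mkseq uy.
  by split; apply: jF; rewrite ey uy.
exists y.
  have [j jA] := eF None; have [z Az _] := ne j.+1.
  by apply/(dec None j jA z Az); case: Az.
move=> k; have [j jW] := eF (Some k); have /= := dec _ _ jW; set n := j.+1 => dW.
have [_ W1 W2] := (sB n).2; have [Wy|Wy] := pselect (W k y).
  by split=> // _; apply: W1 => u /dW ->.
split=> // Wx; case: (W2 k) => // u uA; apply: contra_not Wy.
by move/(dW u uA).
Qed.

(** * Countable covers by Borel partial transversals *)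

Section PartialTransversals.
Variable e : X -> nat -> nat.
Hypothesis ce : code e.

Let mcyl s : measurable (cyl e s). Proof. exact: cyl_meas. Qed.

Definition meets (a : seq (seq nat)) (Y : set X) :=
  exists x, forall s, s \in a -> exists y, [/\ Y y, cyl e s y & ker x y].

(** [P] is defined by existential conditions and need not be Borel. For conflicting [t] and [t'],
    two copies of these conditions, tagged by a boolean, cannot be met by one class, and [novikov]
    gives an invariant [C] between the two parts of [P]. These countably many constraints define the
    hull. *)
Lemma indep_hull s (a : seq (seq nat)) (Y : set X) : measurable Y ->
  let P := [set y | [/\ Y y, cyl e s y &
    forall s', s' \in a -> exists y', [/\ Y y', cyl e s' y' & ker y y']]] in
  indep P -> exists B, [/\ measurable B, indep B & P `<=` B].
Proof.
move=> mY P iP; pose I : finType := (option 'I_(size a) * bool)%type.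
pose M t t' (i : I) := Y `&` (if i.1 is Some j then cyl e (nth [::] a j)
  else cyl e s `&` cyl e (if i.2 then t else t')).
have mM t t' i : measurable (M t t' i).
  by apply: measurableI => //; case: i => -[j|] b //=; apply: measurableI.
have MP t t' x : (forall i, exists2 y, M t t' i y & ker x y) -> forall b,
    exists y, [/\ P y, cyl e (if b then t else t') y & ker x y].
  move=> xM b; have [y [Yy [sy by_]] xy] := xM (None, b); exists y; split=> //.
  split=> // s' s'a; have si : index s' a < size a by rewrite index_mem.
  have [y' [Yy' sy'] xy'] := xM (Some (Ordinal si), b); exists y'; split=> //.
    by move: sy'; rewrite /= nth_index.
  exact: ker_trans (ker_sym xy) xy'.
have /choice[C CP] (tt : seq nat * seq nat) : exists C, conf tt.1 tt.2 ->
    [/\ inv C, P `&` cyl e tt.1 `<=` C & forall x, P x -> cyl e tt.2 x -> ~ C x].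
  case: tt => t t' /=; have [ct|nct] := pselect (conf t t'); last by exists set0.
  have [|x|B [iB MB nB]] := @novikov I (M t t'); first exact: mM.
    apply: contrapT => nx.
    have /MP xP : forall i, exists2 y, M t t' i y & ker x y.
      move=> i; apply: contrapT => ny; apply: nx; exists i => y My xy.
      by apply: ny; exists y.
    have [y [Py ty xy]] := xP true; have [y' [Py' ty' xy']] := xP false.
    apply: (cyl_conf ct ty ty'); apply: iP => //.
    exact: ker_trans (ker_sym xy) xy'.
  have PB b y : P y -> cyl e (if b then t else t') y -> forall j, B (j, b) y.
    move=> [Yy sy ay] ty [j|].
      have [y' [Yy' sy' yy']] := ay _ (mem_nth [::] (ltn_ord j)).
      by apply: (iB _).2 (ker_sym yy') _; apply: MB.
    by apply: MB.
  exists [set x | forall j, B (j, true) x] => _; split.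
  - by apply: inv_all => j.
  - by move=> y [Py ty] j; apply: (PB true).
  - move=> y Py ty By; have [[j [|]]] := nB y; apply; first exact: By.
    exact: (PB false).
exists [set y | forall t t', conf t t' -> cyl e t y -> C (t, t') y /\ ~ C (t', t) y].
split.
- do 2![apply: meas_all => ?]; apply: meas_imp => tt'; apply: meas_Imp => //.
  apply: meas_and; first by have [[]] := CP (_, _) tt'.
  by apply: meas_not; have [[]] := CP (_, _) (conf_sym tt').
- move=> x y xB yB xy; apply: (code_inj ce) => n; apply: contrapT => nxy.
  have ctt : conf (mkseq (e x) n.+1) (mkseq (e y) n.+1).
    by exists n; rewrite !size_mkseq !nth_mkseq.
  have [|Cx _] := xB _ _ ctt; first exact/cyl_mkseq.
  have [|_ Cy] := yB _ _ (conf_sym ctt); first exact/cyl_mkseq.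
  by apply: Cy; have [iC _ _] := CP (_, _) ctt; apply: iC.2 xy Cx.
- move=> y Py t t' tt' ty; have [_ PC _] := CP (_, _) tt'.
  have [_ _ nC] := CP (_, _) (conf_sym tt').
  by split; [apply: PC|apply: nC].
Qed.

Definition small B := exists F : nat -> set X,
  [/\ forall n, measurable (F n), forall n, indep (F n) &
    forall x, B x <-> exists n, F n x].

Lemma small_meas B : small B -> measurable B.
Proof.
move=> [F [mF _ BF]]; rewrite (_ : B = [set x | exists n, F n x]).
  exact: meas_ex.
by apply/seteqP; split=> x /BF.
Qed.

Lemma small0 : small set0.
Proof. by exists (fun=> set0); split=> [//|n x y []|x]; split=> // -[]. Qed.

Lemma small_indep B : measurable B -> indep B -> small B.
Proof.
by move=> mB iB; exists (fun=> B); split=> // x; split=> [|[]//]; exists 0.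
Qed.

Lemma small_ex (K : countType) (B : K -> set X) : (forall k, small (B k)) ->
  small [set x | exists k, B k x].
Proof.
move=> /choice[F FP]; pose F' n := if unpickle n is Some (k, i) then F k i else set0.
exists F'; split=> [n|n|x].
- by rewrite /F'; case: unpickle => // -[k i]; case: (FP k).
- by rewrite /F'; case: unpickle => // -[k i]; case: (FP k).
- split=> [[k]|[n]].
    have [_ _ /(_ x) BF] := FP k => /BF[i Fx]; exists (pickle (k, i)).
    by rewrite /F' pickleK.
  rewrite /F'; case: unpickle => // -[k i] Fx; exists k.
  by have [_ _ /(_ x) BF] := FP k; apply/BF; exists i.
Qed.

(** Small sets act as the ideal of a perfect set argument: a list that is not killable survives the
    removal of any small set. *)
Definition killable (a : seq (seq nat)) :=
  exists2 B, small B & ~ meets a (~` B).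

Lemma killable_eqi a b : a =i b -> killable a -> killable b.
Proof.
move=> ab [B sB nB]; exists B => //; apply: contra_not nB => -[x xb].
by exists x => s; rewrite ab; apply: xb.
Qed.

Definition ext (s t : seq nat) :=
  size s < size t /\ forall i, i < size s -> nth 0 t i = nth 0 s i.

(** If all conflicting pairs of extensions were killed, then off the union of the killing sets the
    points of [cyl e s] whose class meets all of [a] would form a partial transversal; its Borel
    hull would complete a small set that kills [s :: a]. *)
Lemma split1 s a : ~ killable (s :: a) -> exists t t',
  [/\ conf t t', ext s t, ext s t' & ~ killable [:: t, t' & a]].
Proof.
move=> nk; apply: contrapT => nsp.
have /choice[B BP] (tt : seq nat * seq nat) : exists B, small B /\
    (conf tt.1 tt.2 -> ext s tt.1 -> ext s tt.2 ->
      ~ meets [:: tt.1, tt.2 & a] (~` B)).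
  have [[B sB nB]|nB] := pselect (killable [:: tt.1, tt.2 & a]); first by exists B.
  exists set0; split; first exact: small0.
  by move=> h1 h2 h3; case: nsp; exists tt.1, tt.2.
pose B' : set X := [set x | exists tt, B tt x].
have sB' : small B' by apply: small_ex => tt; case: (BP tt).
have [||B'' [mB'' iB'' PB'']] := @indep_hull s a (~` B').
- exact/measurableC/small_meas.
- move=> y y' [By sy ya] [By' sy' _] yy'; apply: (code_inj ce) => n.
  apply: contrapT => nyy.
  have sn : size s <= n.
    by rewrite leqNgt; apply/negP => ns; apply: nyy; rewrite sy ?sy'.
  have sext z : cyl e s z -> ext s (mkseq (e z) n.+1).
    move=> sz; split=> [|i si]; first by rewrite size_mkseq.
    by rewrite nth_mkseq ?sz // ltnS ltnW // (leq_trans si).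
  have [_] := BP (mkseq (e y) n.+1, mkseq (e y') n.+1); apply.
  + by exists n; rewrite !size_mkseq !nth_mkseq.
  + exact: sext.
  + exact: sext.
  have nB z : ~ B' z -> ~ B (mkseq (e y) n.+1, mkseq (e y') n.+1) z.
    by apply: contra_not => Bz; eexists; exact: Bz.
  exists y => s'; rewrite !inE => /or3P[/eqP->|/eqP->|/ya].
  + by exists y; split=> //; [exact: nB|exact/cyl_mkseq].
  + by exists y'; split=> //; [exact: nB|exact/cyl_mkseq].
  + by move=> [z [/nB Bz sz yz]]; exists z.
apply: nk; pose BB (b : bool) := if b then B' else B''.
exists [set x | exists b, BB b x].
  by apply: small_ex => -[] //; apply: small_indep.
have nBB x : ~ (exists b, BB b x) -> ~ B' x /\ ~ B'' x.
  by move=> nx; split=> Bx; apply: nx; [exists true|exists false].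
move=> [x xa]; have [|y [/nBB[nB' nB''] sy xy]] := xa s; first exact: mem_head.
apply/nB''/PB''; split=> // s' s'a.
have [|z [/nBB[nz _] sz xz]] := xa s'; first by rewrite inE s'a orbT.
by exists z; split=> //; apply: ker_trans xz; apply: ker_sym.
Qed.

Lemma split_all (U : nat -> seq nat) (ws : seq nat) acc : uniq ws ->
  ~ killable (map U ws ++ acc) -> exists V : bool -> nat -> seq nat,
  (forall j, j \in ws -> conf (V false j) (V true j) /\ forall b, ext (U j) (V b j)) /\
  ~ killable (map (V false) ws ++ map (V true) ws ++ acc).
Proof.
elim: ws acc => [|j ws IH] acc /=; first by move=> _ nk; exists (fun=> U).
move=> /andP[jws uws] /split1[t [t' [ctt st st' nk]]].
have [|V [VP nV]] := IH [:: t, t' & acc] uws.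
  apply: contra_not nk; apply: killable_eqi => z.
  by rewrite mem_cat !inE mem_cat; case: (z \in map U ws); rewrite /= ?orbT.
exists (fun b i => if i == j then (if b then t' else t) else V b i); split.
  move=> i; rewrite inE; case: eqVneq => [->|_] /=; last exact: VP.
  by move=> _; split=> // -[].
have mapV b : map (fun i => if i == j then (if b then t' else t) else V b i) ws =
    map (V b) ws.
  by apply/eq_in_map => i iws; case: eqP => // ij; rewrite -ij iws in jws.
rewrite eqxx (mapV false) (mapV true); apply: contra_not nV; apply: killable_eqi => z.
by rewrite !inE !mem_cat !inE !mem_cat; case: (z == t); case: (z == t'); rewrite /= ?orbT.
Qed.

Hypothesis eW : forall k, decides e (W k).
Hypothesis ker_count : forall x, countable [set y | ker x y].

Let nk n (U : nat -> seq nat) := ~ killable (map U (iota 0 (2 ^ n))).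

Lemma nk_step n U : exists V, nk n U -> nk n.+1 V /\ forall j, j < 2 ^ n ->
  conf (V j.*2) (V j.*2.+1) /\ ext (U j) (V j.*2) /\ ext (U j) (V j.*2.+1).
Proof.
have [nkU|] := pselect (nk n U); last by exists U.
have [|V [VP nV]] := @split_all U (iota 0 (2 ^ n)) [::] (iota_uniq _ _).
  by rewrite cats0.
exists (fun i => V (odd i) i./2) => _; split=> [|j jn].
  apply: contra_not nV; apply: killable_eqi => z; rewrite cats0 mem_cat.
  apply/mapP/orP => [[i]|].
    rewrite mem_iota /= => iN ->; have hi : i./2 \in iota 0 (2 ^ n).
      by rewrite mem_iota /=; rewrite expnS in iN; lia.
    by case: (odd i); [right|left]; apply: map_f.
  by case=> /mapP[i]; rewrite mem_iota /= => iN ->;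
    [exists i.*2|exists i.*2.+1]; rewrite ?mem_iota ?expnS /= ?odd_double /=
    ?doubleK ?uphalf_double //=; lia.
have [|cV eV] := VP j; first by rewrite mem_iota.
by rewrite /= odd_double /= doubleK uphalf_double; split.
Qed.

(* Otherwise the splittings of [nk_step] form a Cantor scheme, all of whose
   branches lie in one class. *)
Theorem small_setT : small setT.
Proof.
apply: contrapT => nsmall.
have /choice[F FP] (nU : nat * (nat -> seq nat)) := nk_step nU.1 nU.2.
pose fix U n := if n is n'.+1 then F (n', U n') else fun=> [::].
have nkU n : nk n (U n).
  elim: n => [|n IH]; last by have [] := FP (n, U n) IH.
  move=> [B sB nB]; apply: nsmall; suff -> : setT = B by [].
  apply/seteqP; split=> // x _; apply: contrapT => nBx; apply: nB; exists x.
  by move=> s; rewrite /= inE => /eqP ->; exists x.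
have US n j : j < 2 ^ n -> conf (U n.+1 j.*2) (U n.+1 j.*2.+1) /\
    ext (U n j) (U n.+1 j.*2) /\ ext (U n j) (U n.+1 j.*2.+1).
  by have [_] := FP (n, U n) (nkU n); apply.
pose fix idx (al : nat -> bool) n := if n is n'.+1 then al n' + (idx al n').*2 else 0.
have idxP al n : idx al n < 2 ^ n.
  by elim: n => //= n IH; rewrite expnS; case: (al n); lia.
pose w al n := U n (idx al n).
have wS al n : ext (w al n) (w al n.+1).
  have [_ [e0 e1]] := US n _ (idxP al n).
  by rewrite /w [idx al n.+1]/=; case: (al n).
have wn al n : n <= size (w al n).
  by elim: n => // n IH; have [h _] := wS al n; apply: leq_ltn_trans h.
have wle al m n i : m <= n -> i < size (w al m) ->
    i < size (w al n) /\ nth 0 (w al n) i = nth 0 (w al m) i.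
  move=> + im; elim: n => [|n IH]; first by rewrite leqn0 => /eqP e0; subst m.
  rewrite leq_eqVlt => /orP[/eqP <-//|/IH[h1 h2]].
  by have [s1 s2] := wS al n; rewrite s2 //; split=> //; apply: ltn_trans s1.
pose a al i := nth 0 (w al i.+1) i.
have wa al n i : i < n -> nth 0 (w al n) i = a al i.
  by move=> iN; have [_ ->] := wle al i.+1 n i iN (wn al i.+1).
have nkM n : meets (map (U n) (iota 0 (2 ^ n))) setT.
  apply: contrapT => nm; apply: (nkU n); exists set0; first exact: small0.
  by rewrite setC0.
have cylw al n y : cyl e (w al n) y -> forall i, i < n -> e y i = a al i.
  by move=> wy i iN; rewrite wy ?wa // (leq_trans iN).
have wM n : exists x, forall al, exists2 y, cyl e (w al n) y & ker x y.
  have [x xM] := nkM n; exists x => al.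
  have [|y [_ wy xy]] := xM (w al n); last by exists y.
  by apply/mapP; exists (idx al n) => //; rewrite mem_iota /= idxP.
have /choice[y yP] al : exists y, forall i, e y i = a al i.
  apply: (code_closed ce) => n; have [x /(_ al)[y wy _]] := wM n.
  by exists y; apply: cylw.
(* [W k] is read off coordinate [j], and at level [j.+1] one class meets the cylinders of both
   branches. *)
have yker al be : ker (y al) (y be).
  move=> k; have [j jW] := eW k; have [x xw] := wM j.+1.
  have yW ga : W k x <-> W k (y ga).
    have [z /cylw/(_ j (ltnSn j)) ej xz] := xw ga.
    by split=> [/(xz k)|] Wz; last apply/(xz k); apply: jW Wz; rewrite ej yP.
  by split=> [/yW/yW|/yW/yW].
have y_inj al be : y al = y be -> al = be.
  move=> ey; apply/funext; apply: contrapT => nab.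
  have : exists n, al n != be n.
    by apply: contrapT => nn; apply: nab => n; apply/eqP; apply: contra_notT nn => ?; exists n.
  move=> /ex_minnP[n abn nmin].
  have ab m : m < n -> al m = be m.
    by move=> mn; apply/eqP; apply: contraTT mn => /nmin; rewrite -leqNgt.
  have idxE m : m <= n -> idx al m = idx be m.
    by elim: m => // m IH mn /=; rewrite ab // IH // ltnW.
  have [cU _] := US n _ (idxP al n).
  have c : conf (w al n.+1) (w be n.+1).
    rewrite /w /= -idxE //; case: (al n) (be n) abn => [] [] // _.
    by apply: conf_sym.
  have [i [i1 i2]] := c; apply.
  have [m i_m] : exists m, i < m /\ n.+1 <= m by exists (maxn i.+1 n.+1); lia.
  have [_ <-] := wle al n.+1 m i i_m.2 i1; have [_ <-] := wle be n.+1 m i i_m.2 i2.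
  by rewrite !wa ?i_m.1 // -!yP ey.
have /countable_injP[p p_inj] := ker_count (y (fun=> true)).
have q_inj al be : p (y al) = p (y be) -> al = be.
  by move=> pab; apply: y_inj; apply: p_inj => //; apply/mem_set; apply: yker.
(* Cantor's diagonal argument against the injection of binary sequences into the integers. *)
pose de n := `[< forall al, p (y al) = n -> al n = false >].
have [dt|df] := boolP (de (p (y de))).
  by move: (dt) => /asboolP/(_ de erefl); rewrite dt.
by move: (df) => /negP; apply; apply/asboolP => al /q_inj ->; apply/negbTE.
Qed.

End PartialTransversals.
End Smooth.

(** * Existence of codes *)

Section Witness.
Context d (X : measurableType d).
Implicit Types (x y p : X) (S : nat -> set X) (e : X -> nat -> nat).

(** A coordinate that records the least witness makes a countable union of decided sets decided, and
    still passes to limits by [wit_lim]. *)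
Definition wit S x : nat :=
  if pselect (exists j, `[< S j x >]) is left ex then (ex_minn ex).+1 else 0.

Lemma witP S x : (wit S x = 0 /\ forall j, ~ S j x) \/
  (exists j, [/\ wit S x = j.+1, S j x & forall i, i < j -> ~ S i x]).
Proof.
rewrite /wit; case: pselect => [ex|nex]; last first.
  by left; split=> // j Sx; apply: nex; exists j; apply/asboolP.
right; case: ex_minnP => j /asboolP Sj jmin; exists j; split=> // i ij Si.
by have := jmin i; rewrite leqNgt ij => h; have : false by apply/h/asboolP.
Qed.

Lemma wit0 S x : wit S x = 0 <-> forall j, ~ S j x.
Proof.
by have [[-> h]|[j [-> Sj _]]] := witP S x; split=> // /(_ j).
Qed.

Lemma witS S x j : wit S x = j.+1 <-> S j x /\ forall i, i < j -> ~ S i x.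
Proof.
have [[-> h]|[k [-> Sk nk]]] := witP S x; split=> //.
- by case=> /h.
- by case=> <-.
case=> Sj nj; congr _.+1; apply/eqP; rewrite eqn_leq; apply/andP; split; rewrite leqNgt; apply/negP.
  by move/nk; apply.
by move/nj; apply.
Qed.

Lemma wit_meas S n : (forall j, measurable (S j)) -> measurable [set x | wit S x = n].
Proof.
move=> mS; case: n => [|n].
  rewrite (_ : [set _ | _] = [set x | forall j, ~ S j x]).
    by apply: meas_all => j; apply: meas_not.
  by apply/seteqP; split=> x /wit0.
rewrite (_ : [set _ | _] = [set x | S n x /\ forall i, i < n -> ~ S i x]).
  apply: meas_and => //; apply: meas_all => j; apply: meas_imp => _.
  exact: meas_not.
by apply/seteqP; split=> x /witS.
Qed.

Definition approx e (a : nat -> nat) :=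
  forall l : seq nat, exists x, forall i, i \in l -> e x i = a i.

(** Closedness is stated with finite sets of coordinates, which unlike initial segments behave well
    when codes are merged. *)
Definition closed_code e := forall a, approx e a -> exists x, forall i, e x i = a i.

Lemma wit_lim S e a c0 p : approx e a -> (forall x, e x c0 = wit S x) ->
  (forall j, exists c, forall x, e x c = a c -> S j x <-> S j p) ->
  e p c0 = a c0.
Proof.
move=> ea ew /choice[c cP]; rewrite ew.
case E : (a c0) => [|j].
  apply/wit0 => j Sp; have [x xa] := ea [:: c0; c j].
  have : wit S x = 0 by rewrite -ew -E xa // mem_head.
  by move/wit0 => /(_ j); apply; apply/(cP j) => //; apply: xa; rewrite !inE eqxx orbT.
have [x xa] := ea (c0 :: map c (iota 0 j.+1)).
have Sx i : i <= j -> S i x <-> S i p.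
  move=> ij; apply: cP; apply: xa; rewrite inE map_f ?orbT //.
  by rewrite mem_iota.
have : wit S x = j.+1 by rewrite -ew -E xa // mem_head.
move=> /witS[Sj nS]; apply/witS; split=> [|i ij]; first exact/Sx.
by move/(Sx i (ltnW ij)); apply: nS.
Qed.

Section Base.
(* [O i m] is the pullback of the ball of radius 1/(m+1) about the [i]-th point
   of a countable dense set; [inside] is [closure (O j k) `<=` O i m]. *)
Variable O : nat -> nat -> set X.
Hypothesis O_meas : forall i m, measurable (O i m).
Hypothesis O_small : forall m x, exists i, O i m x.
Hypothesis O_complete : forall I : nat -> nat,
  (forall n, exists x, forall m, m < n -> O (I m) m x) ->
  exists p, forall i m, O i m p -> exists n, O (I n) n `<=` O i m.
Hypothesis O_sep : forall x y, (forall i m, O i m x -> O i m y) -> x = y.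

Definition inside j k i m :=
  forall p, (forall i' m', O i' m' p -> exists2 y, O i' m' y & O j k y) -> O i m p.

Hypothesis O_reg : forall i m x, O i m x -> exists j k, O j k x /\ inside j k i m.
Hypothesis O_gen : forall Q : set X -> Prop, (forall i m, Q (O i m)) ->
  (forall A, Q A -> Q (~` A)) ->
  (forall A : nat -> set X, (forall n, Q (A n)) -> Q [set x | exists n, A n x]) ->
  forall A, measurable A -> Q A.

Let coord : countType := (nat * nat + nat + nat * nat)%type.

(** The coordinates record membership in [O i m], the first basic set of level [m] around the point,
    and the first one well inside [O i m]. The second kind makes limits converge; the third
    preserves membership in [O i m] in the limit. *)
Let S0 (c : coord) (j : nat) : set X := match c with
  | inl (inl (i, m)) => O i m
  | inl (inr m) => O j m
  | inr (i, m) => if unpickle j is Some (k, l) then [set x | O k l x /\ inside k l i m]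
                  else set0
  end.

Let S0r i m j x : S0 (inr (i, m)) j x -> exists kl : nat * nat,
  [/\ unpickle j = Some kl, O kl.1 kl.2 x & inside kl.1 kl.2 i m].
Proof. by rewrite /S0; case: unpickle => [[k l] [Ox ikl]|[]]; exists (k, l). Qed.

Definition code0 x n := if unpickle n is Some c then wit (S0 c) x else 0.

Let code0E x c : code0 x (pickle c) = wit (S0 c) x.
Proof. by rewrite /code0 pickleK. Qed.

Lemma code0_meas n i : measurable [set x | code0 x n = i].
Proof.
rewrite /code0; case: unpickle => [c|]; last exact: meas_prop.
apply: wit_meas => j; case: c => [[[k m]|m]|[k m]] //=; case: unpickle => // -[k' l'].
by apply: meas_and => //; apply: meas_prop.
Qed.

Lemma code0_inj x y : (forall n, code0 x n = code0 y n) -> x = y.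
Proof.
move=> xy; apply: O_sep => i m Ox; apply: contrapT => Oy.
have := xy (pickle (inl (inl (i, m)) : coord)); rewrite !code0E.
have -> : wit (S0 (inl (inl (i, m)))) x = 1 by apply/witS.
by have -> : wit (S0 (inl (inl (i, m)))) y = 0 by apply/wit0.
Qed.

Lemma code0_closed : closed_code code0.
Proof.
move=> a ea.
pose cO i m := pickle (inl (inl (i, m)) : coord).
pose cI m := pickle (inl (inr m) : coord).
pose cR i m := pickle (inr (i, m) : coord).
have OI x m : code0 x (cI m) = a (cI m) -> O (a (cI m)).-1 m x.
  rewrite code0E; have [i Oi] := O_small m x.
  case: (a (cI m)) => [|j]; first by move/wit0 => /(_ i).
  by move/witS => [].
have OR x i m : code0 x (cR i m) = a (cR i m) -> O i m x ->
    exists k l, inside k l i m /\ forall y, code0 y (cR i m) = a (cR i m) -> O k l y.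
  rewrite code0E => xa Ox; have [k [l [Okl ikl]]] := O_reg Ox.
  case E : (a (cR i m)) xa => [|j].
    by move/wit0 => /(_ (pickle (k, l))); rewrite /= pickleK; case.
  move=> /witS[/S0r[[k' l'] [ej _ ikl']] _]; exists k', l'; split=> // y.
  rewrite code0E => /witS[/S0r[[k2 l2] [+ + _]] _].
  by rewrite ej => -[<- <-].
have Oa x i m : code0 x (cO i m) = a (cO i m) -> O i m x <-> a (cO i m) <> 0.
  rewrite code0E => <-; split=> [Ox /wit0/(_ 0)|]; first exact.
  by move=> h; apply: contrapT => nO; apply: h; apply/wit0.
have [|p pP] := O_complete (I := fun m => (a (cI m)).-1).
  move=> n; have [x xa] := ea (map cI (iota 0 n)); exists x => m mn.
  by apply/OI/xa/map_f; rewrite mem_iota.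
have Op i m : O i m p <-> a (cO i m) <> 0.
  split=> [Oimp|ne].
    have [n nO] := pP _ _ Oimp; have [x xa] := ea [:: cI n; cO i m].
    apply/(Oa x); first by apply: xa; rewrite !inE eqxx orbT.
    by apply/nO/OI/xa; rewrite mem_head.
  have [x xa] := ea [:: cO i m; cR i m].
  have [||k [l [ikl Okl]]] := @OR x i m.
  - by apply: xa; rewrite !inE eqxx orbT.
  - by apply/Oa => //; apply: xa; rewrite mem_head.
  apply: ikl => i' m' /pP[n nO]; have [y ya] := ea [:: cI n; cR i m].
  exists y; first by apply/nO/OI/ya; rewrite mem_head.
  by apply: Okl; apply: ya; rewrite !inE eqxx orbT.
have dec i m x : code0 x (cO i m) = a (cO i m) -> O i m x <-> O i m p.
  by move=> xa; split=> [/(Oa _ _ _ xa)/Op|/Op/(Oa _ _ _ xa)].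
exists p => n; case E : (unpickle n : option coord) => [c|]; last first.
  by have [x xa] := ea [:: n]; rewrite -(xa n) ?mem_head // /code0 E.
have En x : code0 x n = wit (S0 c) x by rewrite /code0 E.
apply: (wit_lim ea En) => j.
case: c {E En} => [[[i m]|m]|[i m]] /=.
- by exists (cO i m) => x; apply: dec.
- by exists (cO j m) => x; apply: dec.
- case: unpickle => [[k l]|]; last by exists 0.
  by exists (cO k l) => x /dec Ox; split=> -[/Ox].
Qed.

Definition refinement e := [/\ forall n i, measurable [set x | e x n = i],
  closed_code e & forall i, exists j, forall x, e x j = code0 x i].

(** The limits found by the various [e k] agree because all refine the injective [code0]; hence the
    merged code is closed, and [wit A] can be added to it. *)
Lemma combine_refinements (e : nat -> X -> nat -> nat) (A : nat -> set X) :
  (forall k, refinement (e k)) -> (forall k, decides (e k) (A k)) ->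
  (forall k, measurable (A k)) ->
  exists E, [/\ refinement E, forall k, decides E (A k) &
    decides E [set x | exists k, A k x]].
Proof.
move=> re eA mA.
pose E x n := match unpickle n : option (nat * nat + unit) with
  | Some (inl (k, i)) => e k x i
  | Some (inr _) => wit A x
  | None => 0
  end.
pose c k i := pickle (inl (k, i) : nat * nat + unit).
pose cw := pickle (inr tt : nat * nat + unit).
have Ec x k i : E x (c k i) = e k x i by rewrite /E pickleK.
have Ew x : E x cw = wit A x by rewrite /E pickleK.
exists E; split; last first.
- exists cw => x y; rewrite !Ew => xy [k Ak]; apply: contrapT => nA.
  have /wit0/(_ k) : wit A x = 0 by rewrite xy; apply/wit0 => j Aj; apply: nA; exists j.
  exact.
- by move=> k; have [j jA] := eA k; exists (c k j) => x y; rewrite !Ec; apply: jA.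
split.
- move=> n i; rewrite /E; case: unpickle => [[[k j]|_]|]; last exact: meas_prop.
    by have [+ _ _] := re k; apply.
  exact: wit_meas.
- move=> a Ea.
  have /choice[p pP] k : exists p, forall i, e k p i = a (c k i).
    have [_ + _] := re k; apply => l; have [x xa] := Ea (map (c k) l).
    by exists x => i il; rewrite -Ec xa // map_f.
  have pE k : p k = p 0.
    apply: code0_inj => n; have [_ _ /(_ n)[j je]] := re k; have [_ _ /(_ n)[j' je']] := re 0.
    rewrite -je -je' !pP; have [x xa] := Ea [:: c k j; c 0 j'].
    rewrite -!xa ?mem_head ?inE ?eqxx ?orbT // !Ec je je'; done.
  exists (p 0) => n; case e_n : (unpickle n : option (nat * nat + unit)) => [[[k i]|u]|].
  + have En x : E x n = E x (c k i) by rewrite Ec /E e_n.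
    have [x xa] := Ea [:: n; c k i]; rewrite -xa ?mem_head // !En xa ?inE ?eqxx ?orbT //.
    by rewrite Ec -(pE k) pP.
  + apply: (@wit_lim A) Ea _ _ => [x|k]; first by rewrite /E e_n.
    have [j jA] := eA k; exists (c k j) => x; rewrite Ec -pP pE => xp.
    by split; apply: jA.
  + by have [x xa] := Ea [:: n]; rewrite -xa ?mem_head // /E e_n.
- move=> i; have [_ _ /(_ i)[j je]] := re 0; exists (c 0 j) => x.
  by rewrite Ec.
Qed.

Lemma refinement0 : refinement code0.
Proof. by split; [exact: code0_meas|exact: code0_closed|move=> i; exists i]. Qed.

Lemma measurable_decided A : measurable A -> exists2 e, refinement e & decides e A.
Proof.
move=> mA; suff [] : measurable A /\ exists2 e, refinement e & decides e A by [].
elim/O_gen : mA => {A} [i m|A [mA [e re [j jA]]]|A mA].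
- split=> //; exists code0; first exact: refinement0.
  exists (pickle (inl (inl (i, m)) : coord)) => x y; rewrite !code0E => xy Ox.
  have : wit (S0 (inl (inl (i, m)))) x = 1 by apply/witS.
  by rewrite xy => /witS[].
- split; first exact: measurableC.
  by exists e => //; exists j => x y xy; apply: contra_not; apply: jA.
- have /choice[e eP] n : exists e, refinement e /\ decides e (A n).
    by have [_ [e re eA]] := mA n; exists e.
  have mA' n : measurable (A n) by case: (mA n).
  split; first exact: meas_ex.
  have [| |//|E [rE _ EA]] := @combine_refinements e A; last by exists E.
  + by move=> k; case: (eP k).
  + by move=> k; case: (eP k).
Qed.

Theorem base_codable : codable X.
Proof.
move=> A mA; have /choice[e eP] n : exists e, refinement e /\ decides e (A n).
  by have [e re eA] := measurable_decided (mA n); exists e.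
have [| |//|E [[mE cE rE] EA _]] := @combine_refinements e A.
- by move=> k; case: (eP k).
- by move=> k; case: (eP k).
exists E => //; split=> // [x y xy|a aE].
  by apply: code0_inj => i; have [j je] := rE i; rewrite -!je.
apply: cE => l; have [x xa] := aE (\max_(i <- l) i).+1.
by exists x => i il; apply: xa; rewrite ltnS; apply: leq_bigmax_seq il _.
Qed.

End Base.
End Witness.

End BorelStructure.

(** * Basic open sets of a separable complete metric space *)

Section Base.
Variables (R : realType) (P : completePseudoMetricType R) (q : nat -> P).
Hypothesis q_dense : forall U : set P, open U -> U !=set0 -> exists n, U (q n).
Implicit Types (x y : P) (e : R).

Let rad (m : nat) : R := m.+1%:R^-1.

Let rad_gt0 m : 0 < rad m. Proof. by rewrite invr_gt0. Qed.

Let rad_lt e : 0 < e -> exists n, forall m, (n <= m)%N -> rad m < e.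
Proof.
move=> e0; have := near_infty_natSinv_lt (PosNum e0) => -[n _ nP].
by exists n => m /nP.
Qed.

Definition bas i m : set P := (ball (q i) (rad m))°.

Lemma bas_ball i m x : bas i m x -> ball (q i) (rad m) x.
Proof. exact: interior_subset. Qed.

Lemma ball_bas i m x : ball (q i) (rad m / 2) x -> bas i m x.
Proof.
move=> qx; apply/nbhs_ballP; exists (rad m / 2); first by rewrite /= divr_gt0.
by move=> y xy; apply: ball_split qx xy.
Qed.

Lemma ball_q x e : 0 < e -> exists i, ball x e (q i).
Proof.
move=> e0; have [|n qn] := q_dense (open_interior (ball x e)).
  by exists x; apply: nbhsx_ballx.
by exists n; apply: interior_subset.
Qed.

Lemma bas_small m x : exists i, bas i m x.
Proof.
have [|i xi] := @ball_q x (rad m / 2); first by rewrite divr_gt0.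
by exists i; apply/ball_bas/ball_sym.
Qed.

Lemma bas_dist i m x y : bas i m x -> bas i m y -> ball x (rad m + rad m) y.
Proof. by move=> /bas_ball/ball_sym ix /bas_ball; apply: ball_triangle. Qed.

Lemma bas_basis (U : set P) x : open U -> U x ->
  exists i m, bas i m x /\ bas i m `<=` U.
Proof.
move=> oU Ux; have /nbhs_ballP[e /= e0 eU] := open_nbhs_nbhs (conj oU Ux).
have [|n nP] := @rad_lt (e / 2); first by rewrite divr_gt0.
have [i ix] := bas_small n x; exists i, n; split=> // y iy; apply: eU.
have := nP n (leqnn n) => r2; apply: le_ball (bas_dist ix iy); lra.
Qed.

Lemma bas_reg i m x : bas i m x -> exists j k, bas j k x /\
  forall p, (forall i' m', bas i' m' p -> exists2 y, bas i' m' y & bas j k y) ->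
    bas i m p.
Proof.
move=> ix; have oU := open_interior (ball (q i) (rad m)).
have /nbhs_ballP[e /= e0 eU] := open_nbhs_nbhs (conj oU ix).
have [|n nP] := @rad_lt (e / 4); first by rewrite divr_gt0.
have [j jx] := bas_small n x; exists j, n; split=> // p pP; apply: eU.
have [i' ip] := bas_small n p; have [y iy jy] := pP _ _ ip.
have := nP n (leqnn n) => r2.
apply: le_ball (ball_triangle (bas_dist jx jy) (bas_dist iy ip)); lra.
Qed.

Lemma bas_complete (I : nat -> nat) :
  (forall n, exists x, forall m, (m < n)%N -> bas (I m) m x) ->
  exists p, forall i m, bas i m p -> exists n, bas (I n) n `<=` bas i m.
Proof.
move=> IP; pose u n := q (I n).
have un m n : (m <= n)%N -> ball (u m) (rad m + rad n) (u n).
  move=> mn; have [x xP] := IP n.+1.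
  by apply: (@ball_triangle _ _ x); [|apply: ball_sym]; apply/bas_ball/xP; rewrite ltnS.
have /cauchy_cvg : cauchy (u @ \oo).
  apply/cauchyP => e e0; have [|n nP] := @rad_lt (e / 2); first by rewrite divr_gt0.
  exists (u n); exists n => // m /= nm; apply: le_ball (un _ _ nm).
  by have := nP n (leqnn n); have := nP m nm; lra.
move=> /cvg_ex[p up]; exists p => i m ip.
have oU := open_interior (ball (q i) (rad m)).
have /nbhs_ballP[e /= e0 eU] := open_nbhs_nbhs (conj oU ip).
have [|n nP] := @rad_lt (e / 2); first by rewrite divr_gt0.
have [|k _ kP] := cvg_ball up (eps := e / 2); first by rewrite divr_gt0.
exists (maxn n k) => y /bas_ball uy; apply: eU.
have := kP (maxn n k) (leq_maxr _ _) => pu.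
have := nP (maxn n k) (leq_maxl _ _) => r2.
apply: le_ball (ball_triangle pu uy); lra.
Qed.

Lemma bas_sep x y : hausdorff_space P ->
  (forall i m, bas i m x -> bas i m y) -> x = y.
Proof.
rewrite ball_hausdorff => hP xy; apply/eqP; apply: contrapT => /negP nxy.
have [[r1 r2] /= /eqP xy0] := hP _ _ nxy.
have xb : (ball x r1%:num)° x by apply: nbhsx_ballx.
have [i [m [ix iU]]] := bas_basis (open_interior _) xb.
suff : set0 y by [].
by rewrite -xy0; split; [apply: interior_subset; apply/iU/xy|apply: ballxx].
Qed.

End Base.

Section StandardBorel.
Variables (R : realType) (d : measure_display) (X : measurableType d).
Hypothesis sbX : standard_borel R X.

Lemma standard_borel_codable : codable X.
Proof.
have [P [f [hP [Q cQ dQ] [g fK gK] fB]]] := sbX.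
have [c c_inj] := countable_injP _ cQ.
pose q n := xget point [set y | Q y /\ c y = n].
have q_dense (U : set P) : open U -> U !=set0 -> exists n, U (q n).
  move=> oU U0; have [y [Uy Qy]] := dQ U U0 oU; exists (c y); rewrite /q.
  case: xgetP => [z _ [Qz cz]|/(_ y)[]//].
  by rewrite (c_inj z y) ?inE.
have mO (U : set P) : open U -> measurable (f @^-1` U).
  by move=> oU; apply/fB; apply: sub_gen_smallest.
apply: (@base_codable _ _ (fun i m => f @^-1` bas q i m)).
- by move=> i m; apply: mO; apply: open_interior.
- by move=> m x; apply: bas_small.
- move=> I IP; have [|p pP] := @bas_complete _ _ q I.
    by move=> n; have [x xP] := IP n; exists (f x).
  exists (g p) => i m; rewrite /= gK => /pP[n nP]; exists n => x; apply: nP.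
- move=> x y xy; apply: (can_inj fK); exact: (bas_sep q_dense).
- move=> i m x /(bas_reg q_dense)[j [k [jx jP]]]; exists j, k; split=> // p pP.
  by apply: jP => i' m' /pP[y iy jy]; exists (f y).
- move=> S SO SC SU A mA.
  have S0 : S set0.
    rewrite (_ : set0 = ~` [set x | exists n, (if n == 0%N then f @^-1` bas q 0 0
      else ~` (f @^-1` bas q 0 0)) x]).
      by apply/SC/SU => n; case: ifP => _; [exact: SO|exact/SC/SO].
    apply/esym/seteqP; split=> // x; apply; have [fx|nfx] := pselect ((f @^-1` bas q 0 0) x).
      by exists 0%N.
    by exists 1%N.
  have : <<s @open P >> [set f x | x in A].
    apply/fB; rewrite (_ : _ @^-1` _ = A) //; apply/seteqP; split=> x /=.
      by move=> [y Ay /(can_inj fK) <-].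
    by move=> Ax; exists x.
  move=> /(_ [set B | S (f @^-1` B)]) /=.
  have -> : f @^-1` [set f x | x in A] = A.
    apply/seteqP; split=> x /=; last by move=> Ax; exists x.
    by move=> [y Ay /(can_inj fK) <-].
  apply; split; last first.
    move=> U oU /=; pose F n := if (unpickle n : option (nat * nat)) is Some (i, m) then
      [set x | bas q i m (f x) /\ bas q i m `<=` U] else set0.
    rewrite (_ : f @^-1` U = [set x | exists n, F n x]).
      apply: SU => n; rewrite /F; case: unpickle => [[i m]|//].
      have [iU|niU] := pselect (bas q i m `<=` U).
        by rewrite (_ : [set _ | _] = f @^-1` bas q i m) //; apply/seteqP; split=> x // [].
      by rewrite (_ : [set _ | _] = set0) //; apply/seteqP; split=> x // [].
    apply/seteqP; split=> x /=.
      move=> /(bas_basis q_dense oU)[i [m [ix iU]]]; exists (pickle (i, m)).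
      by rewrite /F pickleK.
    by move=> [n]; rewrite /F; case: unpickle => // -[i m] [ix]; apply.
  split=> [//|B /= SB|F /= SF].
    by rewrite setTD -preimage_setC; apply: SC.
  rewrite preimage_bigcup (_ : \bigcup_n _ = [set x | exists n, (f @^-1` F n) x]).
    exact: SU.
  by apply/seteqP; split=> x [n]; exists n.
Qed.

Lemma standard_borel_separating : exists S : nat -> set X,
  (forall n, measurable (S n)) /\ forall x y, (forall n, S n x <-> S n y) -> x = y.
Proof.
have [e ce _] := standard_borel_codable (fun=> measurable0).
exists (fun n => if unpickle n is Some (i, k) then [set x | e x i = k] else set0).
split=> [n|x y xy]; first by case: unpickle => [[i k]|] //; apply: code_meas.
apply: (code_inj ce) => i; have := xy (pickle (i, e x i)).
by rewrite pickleK => -[/(_ erefl)].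
Qed.

End StandardBorel.

(** * Leftmost branches *)

Section Branches.
Local Open Scope nat_scope.

Section Transversals.
Context d (X : measurableType d).
Hypothesis cX : codable X.
Variable W : nat -> set X.
Hypothesis mW : forall k, measurable (W k).
Variable F : nat -> set X.
Hypothesis mF : forall n, measurable (F n).
Hypothesis iF : forall n, indep W (F n).
Hypothesis F_cover : forall x, exists n, F n x.
Implicit Types (x y z : X) (m n : nat).
Local Notation ker := (ker W).

Definition trdom n x := exists2 y, F n y & ker x y.
(** The default [x] keeps the value in the class of [x] in all cases, see [trv_ker]. *)
Definition trv n x : X := xget x [set y | F n y /\ ker x y].

Lemma trvP n x : trdom n x -> F n (trv n x) /\ ker x (trv n x).
Proof. by move=> [y Fy xy]; rewrite /trv; case: xgetP => [_ _ //|/(_ y)[]]. Qed.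

Lemma trv_ker n x : ker x (trv n x).
Proof. by rewrite /trv; case: xgetP => [_ _ []|_] //; apply: ker_refl. Qed.

Lemma trv_eq n x y : F n y -> ker x y -> trv n x = y.
Proof.
move=> Fy xy; have [|Fx xx] := @trvP n x; first by exists y.
by apply: iF Fx Fy _; apply: ker_trans (ker_sym xx) xy.
Qed.

Lemma trdom_meas n : measurable (trdom n).
Proof. exact: (sat_indep cX mW (mF n) (@iF n)). Qed.

Lemma trv_meas n : measurable_fun [set: X] (trv n).
Proof.
move=> _ A mA; rewrite setTI (_ : _ @^-1` _ =
  [set x | exists2 y, (F n `&` A) y & ker x y] `|` (A `&` [set x | ~ trdom n x])).
  apply: measurableU; last by apply: measurableI => //; apply/meas_not/trdom_meas.
  apply: (sat_indep cX mW); first exact: measurableI.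
  by move=> x y [Fx _] [Fy _]; apply: iF Fx Fy.
apply/seteqP; split=> x /=.
  have [Dx Ax|nDx] := pselect (trdom n x).
    by left; have [Fx xx] := trvP Dx; exists (trv n x).
  rewrite /trv; case: xgetP => [z _ [Fz xz]|_ Ax]; last by right.
  by case: nDx; exists z.
case=> [[y [Fy Ay] xy]|[Ax nDx]]; first by rewrite (trv_eq Fy xy).
by rewrite /trv; case: xgetP => // z _ [Fz xz]; case: nDx; exists z.
Qed.

Lemma trdom_ker n x y : ker x y -> trdom n x -> trdom n y.
Proof. by move=> xy [z Fz xz]; exists z => //; apply: ker_trans xz; apply: ker_sym. Qed.

Lemma trv_kerE n x y : ker x y -> trdom n x -> trv n x = trv n y.
Proof.
move=> xy Dx; have [Fx xx] := trvP Dx; apply/esym/trv_eq => //.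
by apply: ker_trans xx; apply: ker_sym.
Qed.

Variable G : set (X * X).
Hypothesis mG : measurable G.
Hypothesis GW : forall x y, graph_eqrel G (x, y) <-> ker x y.

Lemma edge_meas m n : measurable [set x | G (trv m x, trv n x)].
Proof.
rewrite -[[set x | _]]setTI.
exact: (measurable_fun_pair (trv_meas m) (trv_meas n)).
Qed.

Definition trlen k m n x := [/\ trdom m x, trdom n x & wlen G (trv m x) (trv n x) k].

(** The intermediate vertices of a walk are quantified through their integer indices, so only
    countable unions occur. *)
Lemma trlen_meas k m n : measurable (trlen k m n).
Proof.
elim: k n => [|k IH] n.
  rewrite (_ : trlen 0 m n = [set x | exists2 y, (F m `&` F n) y & ker x y]).
    apply: (sat_indep cX mW); first exact: measurableI.
    by move=> x y [Fx _] [Fy _]; apply: iF Fx Fy.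
  apply/seteqP; split=> x.
    move=> [/trvP[Fm xm] /trvP[Fn _] /wlen0 mn]; exists (trv m x) => //.
    by split=> //; rewrite mn.
  move=> [y [Fm Fn] xy]; split; [by exists y|by exists y|].
  by apply/wlen0; rewrite (trv_eq Fm xy) (trv_eq Fn xy).
rewrite (_ : trlen k.+1 m n = [set x | exists l, (trlen k m l x /\
    G (trv l x, trv n x)) /\ trdom n x]).
  apply: meas_ex => l; apply: meas_and; last exact: trdom_meas.
  by apply: meas_and => //; apply: edge_meas.
apply/seteqP; split=> x.
  move=> [Dm Dn /wlenS[z mz zn]]; have [l Fl] := F_cover z.
  have xz : ker x z.
    by apply: ker_trans (trv_ker m x) _; apply/GW/(wlen_eqrel mz).
  exists l; rewrite /trlen (trv_eq Fl xz); split=> //; split=> //; split=> //.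
  by exists z.
by move=> [l [[[Dm Dl ml] ln] Dn]]; split=> //; apply/wlenS; exists (trv l x).
Qed.

Definition trclose r m n x := exists k, k <= r /\ trlen k m n x.

Lemma trclose_meas r m n : measurable (trclose r m n).
Proof.
by apply: meas_ex => k; apply: meas_and; [apply: meas_prop|apply: trlen_meas].
Qed.

Lemma trcloseP r m n x : trclose r m n x <->
  [/\ trdom m x, trdom n x & gd G (trv m x) (trv n x) <= r].
Proof.
split=> [[k [kr [Dm Dn /gd_leq mn]]]|[Dm Dn mn]].
  by split=> //; apply: leq_trans kr.
exists (gd G (trv m x) (trv n x)); split=> //; split=> //; apply: gdP.
by apply/GW; apply: ker_trans (ker_sym (trv_ker m x)) (trv_ker n x).
Qed.

Lemma trclose_ker r m n x y : ker x y -> trclose r m n x -> trclose r m n y.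
Proof.
move=> xy /trcloseP[Dm Dn mn]; apply/trcloseP.
by split; [exact: trdom_ker xy _|exact: trdom_ker xy _|rewrite -!(trv_kerE xy)].
Qed.

Variables (dim r M : nat).

Fixpoint trpath m p x :=
  if p is n :: p' then trclose r m n x /\ trpath n p' x else True.

(** Colours are attached to indices, not to vertices; a vertex with several indices may receive
    several colours, and its least index will decide. *)
Definition good_prefix (t : seq nat) x := forall n p,
  all (fun j => (j < size t) && (nth 0 t j == nth 0 t n)) (n :: p) ->
  trdom n x -> trpath n p x -> trclose M n (last n p) x.

Definition extendible (s : seq nat) x := forall N, exists t,
  (N <= size t /\ all (fun i => i <= dim) t /\ prefix s t) /\ good_prefix t x.

Lemma good_meas t : measurable (good_prefix t).
Proof.
apply: meas_all => n; apply: meas_all => p; apply: meas_imp => _.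
apply: meas_Imp; first exact: trdom_meas.
apply: meas_Imp; last exact: trclose_meas.
elim: p n => [|k p IH] n /=; first exact: meas_prop.
by apply: meas_and => //; apply: trclose_meas.
Qed.

Lemma extendible_meas s : measurable (extendible s).
Proof.
apply: meas_all => N; apply: meas_ex => t; apply: meas_and; last exact: good_meas.
exact: meas_prop.
Qed.

Lemma extendible_ker s x y : ker x y -> extendible s x -> extendible s y.
Proof.
move=> xy xs N; have [t [tP gt]] := xs N; exists t; split=> // n p np Dy ypath.
have yx := ker_sym xy; apply: (trclose_ker xy); apply: gt np _ _.
  exact: trdom_ker yx Dy.
by elim: p n ypath {Dy} => //= k p IH n [/(trclose_ker yx) ? /IH].
Qed.

(** The step of Koenig's lemma: if each of the finitely many colours failed from some length on, all
    would fail at a common length. *)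
Lemma extendible_rcons s x : extendible s x ->
  exists2 i, i <= dim & extendible (rcons s i) x.
Proof.
move=> xs; apply: contrapT => nex.
have /choice[N NP] i : exists N, i <= dim -> forall t, N <= size t ->
    all (fun i => i <= dim) t -> prefix (rcons s i) t -> ~ good_prefix t x.
  have [[id ni]|nn] := pselect (i <= dim /\ ~ extendible (rcons s i) x); last first.
    by exists 0 => id; case: nex; exists i => //; apply: contrapT => h; apply: nn.
  move/existsNP: ni => [N nN]; exists N => _ t tN ta tp gt; apply: nN.
  by exists t.
have [t [[tN [ta /prefixP[t' tE]]] gt]] := xs (maxn (size s).+1 (\max_(i < dim.+1) N i)).
have st : size s < size t by lia.
case: t' tE => [|i t'] tE; first by rewrite tE cats0 ltnn in st.
have id : i <= dim.
  by move: ta; rewrite tE all_cat /= => /and3P[].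
apply: (NP i id t _ ta _ gt).
  have := @leq_bigmax _ (fun i : 'I_dim.+1 => N i) (Ordinal (id : i < dim.+1)).
  by move/leq_trans; apply; apply: leq_trans tN; apply: leq_maxr.
by rewrite tE -cat_rcons prefix_prefix.
Qed.

(** The predecessor undoes the shift in [wit], whose value [0] does not occur at an extendible
    prefix. *)
Definition next s x := (wit (fun i => extendible (rcons s i)) x).-1.
Fixpoint branch n x := if n is n'.+1 then rcons (branch n' x) (next (branch n' x) x)
  else [::].

Lemma next_meas s i : measurable [set x | next s x = i].
Proof.
rewrite (_ : [set _ | _] = [set x | exists j, j.-1 = i /\
    wit (fun i => extendible (rcons s i)) x = j]).
  apply: meas_ex => j; apply: meas_and; first exact: meas_prop.
  by apply: wit_meas => k; apply: extendible_meas.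
by apply/seteqP; split=> x; [move=> <-; eexists|case=> j [<- <-]].
Qed.

Lemma branch_meas n s : measurable [set x | branch n x = s].
Proof.
elim: n s => [|n IH] s; first exact: (meas_prop X ([::] = s)).
rewrite (_ : [set _ | _] = [set x | exists si : seq nat * nat, rcons si.1 si.2 = s /\
    (branch n x = si.1 /\ next si.1 x = si.2)]).
  apply: meas_ex => -[s' i] /=; apply: meas_and; first exact: meas_prop.
  by apply: meas_and; [exact: IH|exact: next_meas].
apply/seteqP; split=> x /= [].
  by move=> <-; exists (branch n x, next (branch n x) x).
by move=> [s' i] /= [<- [-> ->]].
Qed.

Lemma branch_ker n x y : ker x y -> branch n x = branch n y.
Proof.
move=> xy; elim: n => //= n ->; rewrite /next; congr (rcons _ _.-1).
have [[-> nx]|[j [-> jx nj]]] := witP (fun i => extendible (rcons (branch n y) i)) x.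
  by apply/esym/wit0 => j /(extendible_ker (ker_sym xy)); apply: nx.
apply/esym/witS; split; first exact: extendible_ker xy _.
by move=> i ij /(extendible_ker (ker_sym xy)); apply: nj.
Qed.

Lemma size_branch n x : size (branch n x) = n.
Proof. by elim: n => //= n IH; rewrite size_rcons IH. Qed.

Lemma nth_branch m n x : n < m -> nth 0 (branch m x) n = nth 0 (branch n.+1 x) n.
Proof.
elim: m => // m IH; rewrite ltnS leq_eqVlt => /orP[/eqP ->//|nm] /=.
by rewrite nth_rcons size_branch nm IH.
Qed.

Section Branch.
Variable x : X.
Hypothesis xcol : extendible [::] x.

Lemma branch_extendible n : extendible (branch n x) x.
Proof.
elim: n => //= n IH; rewrite /next; have [i _ ei] := extendible_rcons IH.
by have [[_ /(_ i)]//|[j [-> ej _]]] := witP (fun i => extendible (rcons (branch n x) i)) x.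
Qed.

Lemma branch_good n : good_prefix (branch n x) x.
Proof.
have [t [[_ [_ /prefixP[t' tE]]] gt]] := branch_extendible n 0.
move=> m p mp; have mn : m < size (branch n x) by case/andP: mp => /andP[].
apply: gt; apply: sub_all mp => j /andP[jn].
rewrite tE !nth_cat jn mn => ->; rewrite andbT size_cat.
exact: leq_trans jn (leq_addr _ _).
Qed.

Lemma branch_leq n : nth 0 (branch n.+1 x) n <= dim.
Proof.
have [t [[_ [ta /prefixP[t' tE]]] gt]] := branch_extendible n.+1 0.
move: ta; rewrite tE all_cat => /andP[/all_nthP + _]; apply.
by rewrite size_branch.
Qed.

End Branch.

Lemma col_extendible x : col (gd G) (graph_component G x) dim.+1 r M ->
  extendible [::] x.
Proof.
move=> [c [cD cM]] N.
have gx n : graph_component G x (trv n x) by apply/GW/trv_ker.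
exists (mkseq (fun n => c (trv n x)) N); rewrite size_mkseq; split.
  split=> //; split; last exact: prefix0s.
  apply/allP => _ /mapP[n _ ->].
  by rewrite -ltnS; apply: cD.
move=> n p; rewrite size_mkseq => np Dn xp.
have {np} [nN np] : n < N /\ all (fun j => (j < N) && (c (trv j x) == c (trv n x))) p.
  case/andP: np => /andP[nN _] /allP np; split=> //; apply/allP => j /np /andP[jN].
  by rewrite jN !nth_mkseq.
suff [Dl ch] : trdom (last n p) x /\ conn (step (gd G)
    (fun y => graph_component G x y /\ c y = c (trv n x)) r) (trv n x) (trv (last n p) x).
  by apply/trcloseP; split=> //; apply: cM ch.
elim/last_ind: p xp np => [|p k IH] xp np; first by split=> //; left.
rewrite last_rcons; move: np; rewrite all_rcons => /andP[/andP[_ /eqP ck] np].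
have [xp' /trcloseP[Dl Dk lk]] : trpath n p x /\ trclose r (last n p) k x.
  elim: (p) n xp {IH Dn ck np nN} => [|j q IHq] n /=; first by case.
  by move=> [nj /IHq[]].
have [_ ch] := IH xp' np; split=> //; right with (trv (last n p) x) => //.
split=> //; split=> //.
case: (lastP p) np => [//|q j]; rewrite all_rcons last_rcons.
by move=> /andP[/andP[_ /eqP]].
Qed.

End Transversals.

End Branches.

(** * The Borel colouring of the whole space *)

Section Assembly.
Variables (R : realType) (d : measure_display) (X : measurableType d).
Variables (W F : nat -> set X) (G : set (X * X)) (dim : nat).
Hypothesis cX : codable X.
Hypothesis mW : forall k, measurable (W k).
Hypothesis mF : forall n, measurable (F n).
Hypothesis iF : forall n, indep W (F n).
Hypothesis F_cover : forall x, exists n, F n x.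
Hypothesis mG : measurable G.
Hypothesis GW : forall x y, graph_eqrel G (x, y) <-> ker W x y.
Hypothesis colG : forall r, exists M, forall x, col (gd G) (graph_component G x) dim.+1 r M.

Lemma transversal_asdim : asdimB_bound (graph_dist R G) dim.
Proof.
move=> r0 r0_gt0; pose r := Num.bound r0; have [M colM] := colG r.
have ext0 x : extendible W F G dim r M [::] x by apply: (@col_extendible _ _ _ _ _ GW _ _ _ _ (colM x)).
pose br n x := branch W F G dim r M n x.
pose first n x := F n x /\ forall m, (m < n)%N -> ~ F m x.
have /choice[idx idxP] x : exists n, first n x.
  have [n0 Fn0] := F_cover x.
  have ex : exists n, `[< F n x >] by exists n0; apply/asboolP.
  have [n /asboolP Fn nmin] := ex_minnP ex; exists n; split=> // m mn Fm.
  by have := nmin m; rewrite leqNgt mn => h; have : false by apply/h/asboolP.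
have first_uniq n x : first n x -> n = idx x.
  move=> [Fn nn]; have [Fi ni] := idxP x; apply/eqP; rewrite eqn_leq.
  by apply/andP; split; rewrite leqNgt; apply/negP => lt; [exact: nn lt Fi|exact: ni lt Fn].
exists (fun i => [set y | exists n, first n y /\ exists s, br n.+1 y = s /\
  nth 0%N s n = i]); split.
- move=> i; apply: meas_ex => n; apply: meas_and.
    by apply: meas_and => //; apply: meas_all => m; apply: meas_imp => _; apply: meas_not.
  apply: meas_ex => s; apply: meas_and; last exact: meas_prop.
  exact: (branch_meas cX mW mF iF F_cover mG GW).
- apply/seteqP; split=> // x _.
  have lt_dim : (nth 0%N (br (idx x).+1 x) (idx x) < dim.+1)%N.
    by rewrite ltnS; apply: branch_leq.
  exists (Ordinal lt_dim) => //=; exists (idx x); split; first exact: idxP.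
  by exists (br (idx x).+1 x).
exists M.+1%:R => [|i x y [s [sU sr <-]]]; first by rewrite ltr0n.
have colE z : z \in x :: s -> nth 0%N (br (idx z).+1 z) (idx z) = i.
  by move=> /sU[n [/first_uniq -> [_ [<- ->]]]].
have close a b : (graph_dist R G a b <= r0%:E)%E ->
    graph_eqrel G (a, b) /\ (gd G a b <= r)%N.
  have [ab|nab] := pselect (graph_eqrel G (a, b)); last first.
    by rewrite graph_dist_pinfty.
  rewrite graph_distE // lee_fin => abr; split=> //; rewrite -(ler_nat R).
  apply: le_trans abr _; exact/ltW/archi_boundP/ltW.
have Dz z : ker W x z -> trdom W F (idx z) x /\ trv W F (idx z) x = z.
  move=> xz; have [Fz _] := idxP z; split; first by exists z.
  exact: (trv_eq iF).
have chain s' z : path (fun a b => (graph_dist R G a b <= r0%:E)%E) z s' ->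
    ker W x z -> (forall b, b \in s' -> ker W x b) /\
    trpath W F G r (idx z) (map idx s') x.
  elim: s' z => [|b s' IH] z //= /andP[/close[zb lezb] bs'] xz.
  have xb : ker W x b by apply: ker_trans xz _; apply/GW.
  have [h1 h2] := IH b bs' xb; split=> [c|]; first by rewrite inE => /orP[/eqP ->|/h1].
  split=> //; have [Dz1 ez] := Dz _ xz; have [Db eb] := Dz _ xb.
  by apply/(@trcloseP _ _ _ _ _ GW); rewrite ez eb.
have [xs xpath] := chain s x sr (ker_refl W x).
have xz z : z \in x :: s -> ker W x z by rewrite inE => /orP[/eqP ->|/xs].
(* The chain stays in one class, so its finitely many indices are all coloured by one prefix of a
   single branch. *)
pose N := (\max_(n <- map idx (x :: s)) n).+1.
have idxN z : z \in x :: s -> (idx z < N)%N.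
  by move=> zs; rewrite ltnS; apply: leq_bigmax_seq => //; apply: map_f.
have gN : good_prefix W F G r M (br N x) x by apply: branch_good.
have brN z : z \in x :: s -> nth 0%N (br N x) (idx z) = i.
  move=> zs; rewrite /br nth_branch ?idxN // -(colE z zs).
  by rewrite (@branch_ker _ _ _ _ iF _ GW _ _ _ _ _ _ (xz _ zs)).
have mono : all (fun j => (j < size (br N x)) &&
    (nth 0%N (br N x) j == nth 0%N (br N x) (idx x)))%N (idx x :: map idx s).
  rewrite -map_cons; apply/allP => _ /mapP[z zs ->].
  by rewrite size_branch idxN //= !brN ?mem_head.
have /(@trcloseP _ _ _ _ _ GW)[_ _] := gN _ _ mono (Dz x (ker_refl W x)).1 xpath.
rewrite last_map.
have xl : ker W x (last x s) by apply: xz; apply: mem_last.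
rewrite (Dz _ xl).2 (Dz _ (ker_refl W x)).2 => leM.
rewrite graph_distE; last exact/GW.
by rewrite lee_fin ler_nat; apply: leqW.
Qed.

End Assembly.

Theorem proposition1p2 (R : realType) (d : measure_display)
    (X : measurableType d) (G : set (X * X)) (D : nat) :
  standard_borel R X ->
  borel_median_graph R G ->
  countable_graph G ->
  smooth_eqrel R (graph_eqrel G) ->
  (forall x : X,
     (cube_dim R (graph_component G x)
        (induced_subgraph G (graph_component G x)) <= (D%:R)%:E)%E) ->
  (graph_asdimB R G <= (D%:R)%:E)%E.
Proof.
move=> sbX [GP mG medG] Gcount [d' [Z [f [sbZ mf Ef]]]] dimG.
have cX := standard_borel_codable sbX.
have [S [mS Ssep]] := standard_borel_separating sbZ.
pose W n := f @^-1` S n.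
have mW n : measurable (W n) by rewrite -[W n]setTI; apply: mf.
have GW x y : graph_eqrel G (x, y) <-> ker W x y.
  by split=> [/Ef xy k|xy]; [rewrite /W /= xy|apply/Ef/Ssep].
have kerE x : [set y | ker W x y] = graph_component G x.
  by apply/seteqP; split=> y /GW.
have [e ce eW] := cX W mW.
have [|F [mF iF cF]] := small_setT cX mW ce eW; first by move=> x; rewrite kerE.
have F_cover x : exists n, F n x by apply/cF.
apply: ereal_inf_lbound; exists D => //.
apply: (transversal_asdim cX mW mF iF F_cover mG GW) => r.
have [M colM] := median_graph_col R D r; exists M => x.
exact: (colM _ _ _ GP (medG x) (dimG x)).
Qed.
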